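(* Let $T>0$, let $\varepsilon,\mu,\beta$ be positive constants, let $b\in C^2[0,1]$ and $\eta_b(x)=1-\beta b(x)$, with $\eta_b(x)>0$ for all $x\in[0,1]$. Let $(\zeta,u)$ be a sufficiently smooth solution on $[0,1]\times[0,T]$, with $\eta:=\varepsilon\zeta+\eta_b>0$, of the initial-boundary-value problem $$\zeta_t+(\eta u)_x=0,$$ $$u_t+\zeta_x+\varepsilon uu_x-\tfrac{\mu}{3}u_{xxt}=0,$$ for $(x,t)\in[0,1]\times[0,T]$, with $\zeta(x,0)=\zeta_0(x)$, $u(x,0)=u_0(x)$ for $x\in[0,1]$ and $u(0,t)=u(1,t)=0$ for $t\in[0,T]$. Let $r\ge 2$ and $0\le k\le r-2$ be integers and let $S_h$, $S_{h,0}$ be the finite element spaces of piecewise polynomials of degree at most $r-1$ and smoothness $C^k$ on a quasiuniform family of partitions of $[0,1]$ with maximal mesh length $h$. Consider the semidiscrete problem: find $\zeta_h:[0,T]\to S_h$, $u_h:[0,T]\to S_{h,0}$ such that for $0\le t\le T$ $$(\zeta_{ht},\phi)+\varepsilon\bigl((\zeta_hu_h)_x,\phi\bigr)+\bigl((\eta_bu_h)_x,\phi\bigr)=0\quad\forall\phi\in S_h,$$ $$a(u_{ht},\chi)+(\zeta_{hx},\chi)+\varepsilon(u_hu_{hx},\chi)=0\quad\forall\chi\in S_{h,0},$$ $$\zeta_h(0)=\mathrm{P}\zeta_0,\qquad u_h(0)=\widetilde{\mathrm{R}}_hu_0,$$ where $a(v,w)=(v,w)+\tfrac{\mu}{3}(v',w')$,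 $\mathrm{P}$ is the $L^2$ projection onto $S_h$, and $\widetilde{\mathrm{R}}_h$ is the elliptic projection onto $S_{h,0}$ associated with $a$. Then there exist $h_0>0$ and a constant $C$ independent of $h$ such that, for every partition of the family with $h\le h_0$, the semidiscrete problem has a unique solution $(\zeta_h,u_h)$ for $0\le t\le T$, and it satisfies $$\max_{0\le t\le T}\bigl(\|\zeta(t)-\zeta_h(t)\|+\|u(t)-u_h(t)\|_1\bigr)\le C\,h^{r-1}.$$
   Context: Notation: $(\cdot,\cdot)$ and $\|\cdot\|$ are the inner product and norm of $L^2=L^2(0,1)$; $\|\cdot\|_1$ is the norm of the Sobolev space $H^1=H^1(0,1)$; $H_0^1$ is the subspace of $H^1$ of functions vanishing at $x=0$ and $x=1$. $\zeta(t)$ denotes $\zeta(\cdot,t)$, etc. Subscripts $t,x$ denote partial derivatives and primes denote $d/dx$. Finite element spaces: $0=x_1<x_2<\dots<x_{N+1}=1$ is a partition of $[0,1]$ with $h=\max_i(x_{i+1}-x_i)$; the family of partitions is quasiuniform, i.e. $h/\min_i(x_{i+1}-x_i)$ is bounded by a constant independent of the partition. $S_h=\{\phi\in C^k[0,1]:\ \phi|_{[x_i,x_{i+1}]}\in\mathbb{P}_{r-1}\ \text{for all } i\}$, where $\mathbb{P}_{r-1}$ is the set of polynomials of degree at most $r-1$, and $S_{h,0}=\{\phi\in S_h:\ \phi(0)=\phi(1)=0\}$. Projections: $\mathrm{P}:L^2\to S_h$ is defined by $(\mathrm{P}v,\phi)=(v,\phi)$ for all $\phi\in S_h$. $\widetilde{\mathrm{R}}_h:H_0^1\to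 S_{h,0}$ is defined by $a(\widetilde{\mathrm{R}}_hv,\chi)=a(v,\chi)$ for all $\chi\in S_{h,0}$. The parameters $\varepsilon,\mu,\beta$ are fixed positive constants (the modelling regime is $\varepsilon=\mathcal{O}(\mu)$, $\beta=\mathcal{O}(\mu)$, $\mu\ll1$); the constant $C$ and the threshold $h_0$ may depend on them and on $T$, $b$, $r$, $k$, the quasiuniformity constant and the solution $(\zeta,u)$, but not on $h$. ''Sufficiently smooth'' means that $\zeta$ and $u$ possess on $[0,1]\times[0,T]$ as many continuous derivatives (a number depending only on $r$) as needed for the estimate. It is a standing assumption that the initial-boundary-value problem has a unique solution that is this smooth. *)

(* Defs.v *)
(* MathComp-Analysis, over an arbitrary R : realType.

   Functions of space are total functions R -> R of which only the values on
   [0, 1] matter.  Functions of space and time take the time first, so that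
   z t : R -> R is the function written z(t) = z(., t) in the literature. *)
From mathcomp Require Import all_boot all_order all_algebra.
From mathcomp Require Import all_classical all_reals all_analysis.

Set Implicit Arguments.
Unset Strict Implicit.
Unset Printing Implicit Defensive.

Import Order.TTheory GRing.Theory Num.Theory.
Import numFieldNormedType.Exports.

Local Open Scope classical_set_scope.
Local Open Scope ring_scope.

(** * Derivatives on a closed interval, classes C^m *)

Definition diff_quot (R : realType) (f : R -> R) (x y : R) : R :=
  (f y - f x) / (y - x).

(* Only points y of A are used: on a closed interval this is the one-sided
   derivative at the end points and the usual derivative inside. *)
Definition derivable_on (R : realType) (A : set R) (f : R -> R) (x : R) : Prop :=
  cvg (diff_quot f x @ within A x^').

Definition deriv_on (R : realType) (A : set R) (f : R -> R) (x : R) : R :=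
  lim (diff_quot f x @ within A x^').

Fixpoint C_on (R : realType) (A : set R) (m : nat) (f : R -> R) : Prop :=
  {within A, continuous f} /\
  (if m is m'.+1 then
     (forall x, A x -> derivable_on A f x) /\ C_on A m' (deriv_on A f)
   else True).

Definition Dt (R : realType) (T : R) (z : R -> R -> R) : R -> R -> R :=
  fun t x => deriv_on `[0, T] (fun s => z s x) t.

Definition Dx (R : realType) (z : R -> R -> R) : R -> R -> R :=
  fun t x => deriv_on `[0, 1] (z t) x.

(* All partial derivatives of order <= m, in any order of differentiation,
   exist and are jointly continuous on the closed rectangle [0,T] x [0,1]. *)
Fixpoint C_rect (R : realType) (T : R) (m : nat) (z : R -> R -> R) : Prop :=
  {within `[0, T] `*` `[0, 1], continuous (fun p : R * R => z p.1 p.2)} /\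
  (if m is m'.+1 then
     [/\ forall t x, t \in `[0, T] -> x \in `[0, 1] ->
           derivable_on `[0, T] (fun s => z s x) t /\
           derivable_on `[0, 1] (z t) x,
         C_rect T m' (Dt T z) &
         C_rect T m' (Dx z)]
   else True).

(** * L^2(0,1), H^1(0,1) and the bilinear form a *)

Definition ip (R : realType) (v w : R -> R) : R :=
  \int[lebesgue_measure]_(x in `]0, 1[) (v x * w x).

Definition normL2 (R : realType) (v : R -> R) : R := Num.sqrt (ip v v).

(* Here and in the weak formulation below, the x-derivative is the pointwise
   derivative derive1.  It represents the weak derivative because it is only
   taken of functions that are continuous on [0, 1] and C^1 on each closed cell
   of some partition; the breakpoints, where derive1 may be a junk value, form
   a null set. *)
Definition normH1 (R : realType) (v : R -> R) : R :=
  Num.sqrt (normL2 v ^+ 2 + normL2 (derive1 v) ^+ 2).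

Definition form_a (R : realType) (mu : R) (v w : R -> R) : R :=
  ip v w + mu / 3 * ip (derive1 v) (derive1 w).

(** * Partitions and finite element spaces *)

(* A partition is given by s with itv_partition 0 1 s; its nodes are
   0 = node s 0 < node s 1 < ... < node s (size s) = 1. *)
Definition node (R : realType) (s : seq R) (i : nat) : R := nth 1 (0 :: s) i.

Definition cell_length (R : realType) (s : seq R) (i : nat) : R :=
  node s i.+1 - node s i.

Definition mesh (R : realType) (s : seq R) : R :=
  \big[Num.max/0]_(i < size s) cell_length s i.

(* The ratio of the longest to the shortest cell is at most q. *)
Definition quasiuniform (R : realType) (q : R) (s : seq R) : Prop :=
  forall i, (i < size s)%N -> mesh s <= q * cell_length s i.

Definition Sh (R : realType) (r k : nat) (s : seq R) : set (R -> R) :=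
  [set phi | C_on `[0, 1] k phi /\
     forall i, (i < size s)%N -> exists p : {poly R}, (size p <= r)%N /\
       forall x, x \in `[node s i, node s i.+1] -> phi x = p.[x]].

Definition Sh0 (R : realType) (r k : nat) (s : seq R) : set (R -> R) :=
  [set phi | [/\ Sh r k s phi, phi 0 = 0 & phi 1 = 0]].

Definition is_L2_proj (R : realType) (V : set (R -> R)) (v p : R -> R) : Prop :=
  V p /\ forall phi, V phi -> ip p phi = ip v phi.

Definition is_elliptic_proj (R : realType) (mu : R) (V : set (R -> R))
    (v p : R -> R) : Prop :=
  V p /\ forall chi, V chi -> form_a mu p chi = form_a mu v chi.

(** * The initial-boundary-value problem and its semidiscretization *)

Definition eta_b (R : realType) (beta : R) (b : R -> R) : R -> R :=
  fun x => 1 - beta * b x.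

Definition eta (R : realType) (eps beta : R) (b : R -> R) (zeta : R -> R -> R) :
    R -> R -> R :=
  fun t x => eps * zeta t x + eta_b beta b x.

Record ibvp_solution (R : realType) (T eps mu beta : R) (b zeta0 u0 : R -> R)
    (zeta u : R -> R -> R) : Prop := IbvpSolution {
  ibvp_mass : forall t x, t \in `[0, T] -> x \in `[0, 1] ->
    Dt T zeta t x + Dx (fun t x => eta eps beta b zeta t x * u t x) t x = 0;
  ibvp_momentum : forall t x, t \in `[0, T] -> x \in `[0, 1] ->
    Dt T u t x + Dx zeta t x + eps * (u t x * Dx u t x)
      - mu / 3 * Dt T (Dx (Dx u)) t x = 0;
  ibvp_init_zeta : forall x, x \in `[0, 1] -> zeta 0 x = zeta0 x;
  ibvp_init_u : forall x, x \in `[0, 1] -> u 0 x = u0 x;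
  ibvp_bc : forall t, t \in `[0, T] -> u t 0 = 0 /\ u t 1 = 0
}.

(* Sh is finite-dimensional, so differentiability of t |-> zetah t as a curve
   in Sh is the same as differentiability in t at every x in [0, 1]. *)
Record semidiscrete_solution (R : realType) (r k : nat) (s : seq R)
    (T eps mu beta : R) (b zeta0 u0 : R -> R) (zetah uh : R -> R -> R) : Prop :=
  SemidiscreteSolution {
  sd_zeta_in : forall t, t \in `[0, T] -> Sh r k s (zetah t);
  sd_u_in : forall t, t \in `[0, T] -> Sh0 r k s (uh t);
  sd_zeta_derivable : forall t x, t \in `[0, T] -> x \in `[0, 1] ->
    derivable_on `[0, T] (fun t' => zetah t' x) t;
  sd_u_derivable : forall t x, t \in `[0, T] -> x \in `[0, 1] ->
    derivable_on `[0, T] (fun t' => uh t' x) t;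
  sd_mass : forall t phi, t \in `[0, T] -> Sh r k s phi ->
    ip (Dt T zetah t) phi
      + eps * ip (derive1 (fun x => zetah t x * uh t x)) phi
      + ip (derive1 (fun x => eta_b beta b x * uh t x)) phi = 0;
  sd_momentum : forall t chi, t \in `[0, T] -> Sh0 r k s chi ->
    form_a mu (Dt T uh t) chi
      + ip (derive1 (zetah t)) chi
      + eps * ip (fun x => uh t x * derive1 (uh t) x) chi = 0;
  sd_init_zeta : is_L2_proj (Sh r k s) zeta0 (zetah 0);
  sd_init_u : is_elliptic_proj mu (Sh0 r k s) u0 (uh 0)
}.

(* Main.v *)
(* Write zeta_h = P zeta + theta and u_h = R u + xi, with P the L^2 and R the elliptic
   projection; then theta(0) = xi(0) = 0, and the time derivatives of the projection errors
   drop out of the equations for (theta, xi), since they are orthogonal to the finite element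
   spaces.  Testing with (theta, xi) and adding, the dangerous terms theta_x xi and
   theta_x u theta combine into exact derivatives, and what remains is at most
   K (|theta|^2 + a(xi, xi)) + O(h^(2r - 2)) as long as |theta|_inf <= 1.  By the inverse
   inequality |theta|_inf^2 <= C |theta|^2 / h, Gronwall's lemma keeps this true for small
   h because 2 (r - 1) > 1.  To have existence up to time T as well, the part of the vector
   field that is quadratic in (theta, xi) is damped where |theta|^2 + a(xi, xi) exceeds a
   multiple of h: the damped system is globally Lipschitz, obeys the same energy estimate,
   and therefore never leaves the region where there is no damping.
   The projection errors come from a quasi-interpolant into maximally smooth splines,
   obtained by integrating the L^2 projection of the derivative onto splines of lower
   degree; its error estimate is a discrete Poincare inequality iterated by duality. *)
Require Import Defs.
From mathcomp Require Import all_boot all_order all_algebra.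
From mathcomp Require Import all_classical all_reals all_analysis.
From mathcomp Require Import measurable_realfun.
From mathcomp Require Import ring lra zify.

Import Order.TTheory GRing.Theory Num.Theory.
Import numFieldNormedType.Exports.

Set Implicit Arguments.
Unset Strict Implicit.
Unset Printing Implicit Defensive.

Local Open Scope classical_set_scope.
Local Open Scope ring_scope.

(** * Derivatives relative to a set, Gronwall's lemma *)

Section Calculus.
Context {R : realType}.
Implicit Types (f g F G : R -> R) (A : set R) (a b x y d : R).

(** The obstacle is the mass equation. It gives no smoothing, so the energy controls theta in L^2
    only, and estimating theta_x by the inverse inequality would cost a factor 1/h. Every theta_x
    has to disappear, whereas xi_x is under control because mu > 0. The exact derivatives integrate
    to zero thanks to the boundary values of the velocities; none is asked of theta. Products of
    third degree in theta and xi would still spoil Gronwall's argument. The only one that survives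
    the cancellation, theta^2 xi_x, carries the damping factor l, and l |theta|_inf <= 1. The
    cancellation itself is not disturbed by damping, because the coefficients of the exact
    derivative may depend on l. The multiple of h at which damping sets in is the one up to which
    the inverse inequality guarantees |theta|_inf <= 1. In coordinates with respect to one family
    orthonormal for (., .) + a(., .), the mass matrix is the identity and the energy is the squared
    Euclidean norm. Integrals of piecewise continuous functions are handled through their
    antiderivatives, which reduces estimates to monotonicity. *)

Definition has_deriv A f x d :=
  forall e, 0 < e ->
    \forall y \near x, A y -> `|f y - f x - d * (y - x)| <= e * `|y - x|.

(** [has_deriv] is the bridge between the limits of difference quotients over a set in the statement
    and the two-sided [is_derive]. Being multiplied out by y - x, it need not exclude y = x and is
    stable under shrinking the set. *)
Lemma has_derivT f x d : is_derive x 1 f d <-> has_deriv setT f x d.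
Proof.
have E : (forall h, (f (h *: 1 + x) = f (h + x))) by move=> h; rewrite /GRing.scale/= mulr1.
split=> [[df <-] e e0|H].
  have H0 : h^-1 *: ((f \o shift x) (h *: 1) - f x) @[h --> 0^'] --> 'D_1 f x by exact: df.
  move/cvgrPdist_le : H0 => /(_ e e0) H.
  have : \forall h \near (0:R), `|f (h + x) - f x - 'D_1 f x * h| <= e * `|h|.
    move: H; rewrite -[X in X -> _]/(\forall h \near 0^', _) /dnbhs near_withinE.
    apply: filterS => h /=; rewrite E.
    have [->|h0] := eqVneq h 0; first by rewrite add0r subrr mulr0 subr0 normr0 mulr0.
    move=> /(_ isT); rewrite /GRing.scale/= => H.
    rewrite -ler_pdivrMr ?normr_gt0// -normfV -normrM distrC in H *.
    by move: H; congr (`|_| <= _); field.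
  move=> /nbhs_ballP[r /= r0 rH]; apply/nbhs_ballP; exists r => //= y yr _.
  have := rH (y - x); rewrite subrK; apply.
  by rewrite /ball/= sub0r normrN; move: yr; rewrite /ball/= distrC.
have : h^-1 *: ((f \o shift x) (h *: 1) - f x) @[h --> 0^'] --> d.
  apply/cvgrPdist_le => e e0.
  have /nbhs_ballP[r /= r0 rH] := H _ e0.
  rewrite /dnbhs near_withinE; apply/nbhs_ballP; exists r => //= h hr h0.
  rewrite E.
  have := rH (h + x); rewrite addrK => /(_ _ Logic.I) K.
  have : `|f (h + x) - f x - d * h| <= e * `|h|.
    apply: K; rewrite /ball/= distrC addrK.
    by move: hr; rewrite /ball/= sub0r normrN.
  rewrite -ler_pdivrMr ?normr_gt0// -normfV -normrM distrC.
  congr (`|_| <= _); rewrite /GRing.scale/=; field.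
  exact: h0.
move=> cv; apply: DeriveDef; first by apply/cvg_ex; exists d.
exact: cvg_lim cv.
Qed.

Lemma has_derivS A B f x d : B `<=` A -> has_deriv A f x d -> has_deriv B f x d.
Proof. by move=> BA H e e0; apply: filterS (H _ e0) => y yA /BA; exact: yA. Qed.

Lemma has_deriv_near A B f x d : (\forall y \near x, B y -> A y) ->
  has_deriv A f x d -> has_deriv B f x d.
Proof.
move=> BA H e e0; apply: filterS2 BA (H _ e0) => y yA yB /yA; exact: yB.
Qed.

Lemma has_deriv_eq A f g x d : A x -> (forall y, A y -> f y = g y) ->
  has_deriv A f x d -> has_deriv A g x d.
Proof.
by move=> Ax fg H e e0; apply: filterS (H _ e0) => y yA Ay; rewrite -!fg//; exact: yA.
Qed.

Lemma near_itvoo a b x : x \in `]a, b[ -> \forall y \near x, y \in `]a, b[.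
Proof. exact: near_in_itvoo. Qed.

Lemma has_deriv_is_derive a b f x d : x \in `]a, b[ ->
  has_deriv `[a, b] f x d -> is_derive x 1 f d.
Proof.
move=> xab H; apply/has_derivT; apply: has_deriv_near H.
apply: filterS (near_itvoo xab) => y yab _; exact: subset_itv_oo_cc.
Qed.

Lemma is_derive_has_deriv A f x d : is_derive x 1 f d -> has_deriv A f x d.
Proof. by move=> /has_derivT; apply: has_derivS. Qed.

(** Properness is what makes [lim] in [deriv_on] return the limit. A nondegenerate interval always
    leaves room on one side of x: towards b if x < b, otherwise towards a. *)
Lemma dnbhs_proper_cc a b x : a < b -> x \in `[a, b] ->
  ProperFilter (within `[a, b] x^').
Proof.
move=> ab xab; apply: Build_ProperFilter_ex.
move=> P; rewrite /dnbhs/within/= => /nbhs_ballP[r /= r0 rP].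
move: xab; rewrite in_itv/= => /andP[ax xb].
have [xb'|bx] := ltP x b.
  pose y := Num.min b (x + r / 2).
  have xy : x < y by rewrite lt_min xb' ltrDl divr_gt0.
  have yr : y - x < r.
    rewrite ltrBlDr gt_min; apply/orP; right.
    by rewrite addrC ltrD2r ltr_pdivrMr// ltr_pMr// ltr1n.
  exists y; apply: rP => /=.
  - by rewrite /ball/= distrC gtr0_norm ?subr_gt0.
  - by rewrite gt_eqF.
  - by rewrite in_itv/= ge_min lexx/= andbT (le_trans ax)// ltW.
pose y := Num.max a (x - r / 2).
have yx : y < x by rewrite gt_max (lt_le_trans ab bx)/= ltrBlDr ltrDl divr_gt0.
have yr : x - y < r.
  rewrite ltrBlDr -ltrBlDl lt_max; apply/orP; right.
  by rewrite ltrD2l ltrN2 ltr_pdivrMr// ltr_pMr// ltr1n.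
exists y; apply: rP => /=.
- by rewrite /ball/= gtr0_norm ?subr_gt0.
- by rewrite lt_eqF.
- by rewrite in_itv/= le_max lexx/= (le_trans _ xb)// ltW.
Qed.

Lemma has_deriv_cvg A f x d :
  has_deriv A f x d <-> diff_quot f x @ within A x^' --> d.
Proof.
split=> [H|/cvgrPdist_le H e e0].
  apply/cvgrPdist_le => e e0; have := H _ e0.
  rewrite near_withinE /dnbhs near_withinE; apply: filterS => y yA yx Ay.
  have := yA Ay; rewrite -ler_pdivrMr ?normr_gt0 ?subr_eq0// -normfV -normrM distrC.
  by congr (`|_| <= _); rewrite /diff_quot; field; rewrite subr_eq0.
have := H _ e0; rewrite near_withinE /dnbhs near_withinE; apply: filterS => y yA Ay.
have [->|yx] := eqVneq y x; first by rewrite !subrr mulr0 subr0 normr0 mulr0.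
have := yA yx Ay; rewrite -ler_pdivrMr ?normr_gt0 ?subr_eq0// -normfV -normrM distrC.
by congr (`|_| <= _); rewrite /diff_quot; field; rewrite subr_eq0.
Qed.

Lemma has_derivP a b f x d : a < b -> x \in `[a, b] ->
  (derivable_on `[a, b] f x /\ deriv_on `[a, b] f x = d) <->
  has_deriv `[a, b] f x d.
Proof.
move=> ab xab; have PF := dnbhs_proper_cc ab xab.
split=> [[/cvg_ex[l fl] <-]|/has_deriv_cvg H].
  by apply/has_deriv_cvg; rewrite /deriv_on (cvg_lim _ fl).
split; first by apply/cvg_ex; exists d.
exact: cvg_lim H.
Qed.

Lemma derivable_on_has_deriv a b f x : a < b -> x \in `[a, b] ->
  derivable_on `[a, b] f x -> has_deriv `[a, b] f x (deriv_on `[a, b] f x).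
Proof. by move=> ab xab H; apply/has_derivP. Qed.

Lemma has_deriv_lin A f g x c d1 d2 : has_deriv A f x d1 -> has_deriv A g x d2 ->
  has_deriv A (fun y => c * f y + g y) x (c * d1 + d2).
Proof.
move=> Hf Hg e e0.
have e1 : 0 < e / 2 / (`|c| + 1) by rewrite !divr_gt0// ltr_wpDl.
have e2 : 0 < e / 2 by rewrite divr_gt0.
apply: filterS2 (Hf _ e1) (Hg _ e2) => y yf yg Ay.
have -> : c * f y + g y - (c * f x + g x) - (c * d1 + d2) * (y - x) =
  c * (f y - f x - d1 * (y - x)) + (g y - g x - d2 * (y - x)) by ring.
apply: le_trans (ler_normD _ _) _.
rewrite [e]splitr mulrDl lerD ?yg// normrM.
apply: le_trans (ler_wpM2l (normr_ge0 _) (yf Ay)) _.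
rewrite mulrA ler_wpM2r// mulrCA ler_piMr ?(ltW e2)//.
by rewrite ler_pdivrMr ?mul1r ?lerDl// ltr_wpDl.
Qed.

Lemma has_deriv_cst A x c : has_deriv A (fun=> c) x 0.
Proof.
move=> e e0; near=> y => _.
by rewrite mul0r subr0 subrr normr0 mulr_ge0// ltW.
Unshelve. all: by end_near. Qed.

Lemma has_deriv_cont A f x d : A x -> has_deriv A f x d ->
  f @ within A (nbhs x) --> f x.
Proof.
move=> Ax H; apply/cvgrPdist_le => e e0.
have K : 0 < `|d| + 1 by rewrite ltr_wpDl.
have := H _ ltr01; rewrite !near_withinE => H1.
have : \forall y \near x, `|y - x| <= e / (`|d| + 1).
  apply/nbhs_ballP; exists (e / (`|d| + 1)); first by rewrite /= divr_gt0.
  by move=> y; rewrite /ball/= distrC => /ltW.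
apply: filterS2 H1 => y H1 H2 Ay.
have := H1 Ay; rewrite mul1r => H3.
rewrite distrC.
have -> : f y - f x = (f y - f x - d * (y - x)) + d * (y - x) by ring.
apply: le_trans (ler_normD _ _) _.
apply: le_trans (lerD H3 (lexx _)) _.
rewrite normrM -{1}[`|y - x|]mul1r -mulrDl addrC.
by move: H2; rewrite ler_pdivlMr// mulrC.
Qed.

End Calculus.

(** * Retraction onto an interval, antiderivatives, Gronwall's lemma *)

Section Clamp.
Context {R : realType}.
Implicit Types (f g F G : R -> R) (A : set R) (a b c x y d : R).

(** The retraction of the line onto [a, b]. Composing with it turns continuity within [a, b] into
    continuity on the whole line. *)
Definition clamp a b x : R := Num.max a (Num.min x b).

Lemma clamp_in a b x : a <= b -> clamp a b x \in `[a, b].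
Proof.
by move=> ab; rewrite /clamp in_itv/= le_max lexx/= ge_max ab ge_min lexx orbT.
Qed.

Lemma clamp_id a b x : x \in `[a, b] -> clamp a b x = x.
Proof.
by rewrite in_itv/= /clamp => /andP[ax xb]; rewrite min_l// max_r.
Qed.

Lemma clamp_lt a b x : a <= b -> x <= a -> clamp a b x = a.
Proof. by move=> ab xa; rewrite /clamp max_l// ge_min xa. Qed.

Lemma clamp_gt a b x : a <= b -> b <= x -> clamp a b x = b.
Proof. by move=> ab xb; rewrite /clamp min_r// max_r. Qed.

Lemma clamp_dist a b x y : `|clamp a b x - clamp a b y| <= `|x - y|.
Proof.
wlog xy : x y / x <= y.
  by move=> H; have [/H//|/ltW/H] := leP x y; rewrite distrC [`|y - x|]distrC.
have Hxy : clamp a b x <= clamp a b y.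
  rewrite /clamp; case: (leP x b) => ?; case: (leP y b) => ?;
    [case: (leP a x); case: (leP a y) | case: (leP a x); case: (leP a b) |
     case: (leP a b); case: (leP a y) | case: (leP a b)] => *; lra.
rewrite distrC ger0_norm ?subr_ge0// [`|x - y|]distrC ger0_norm ?subr_ge0//.
rewrite /clamp; case: (leP x b) => ?; case: (leP y b) => ?;
    [case: (leP a x); case: (leP a y) | case: (leP a x); case: (leP a b) |
     case: (leP a b); case: (leP a y) | case: (leP a b)] => *; lra.
Qed.

Lemma clamp_continuous a b : continuous (clamp a b).
Proof.
move=> x; apply/cvgrPdist_le => e e0; apply/nbhs_ballP; exists e => //= y.
by rewrite /ball/= => H; apply: le_trans (clamp_dist _ _ _ _) (ltW H).
Qed.

Lemma within_clamp a b f : a <= b -> {within `[a, b], continuous f} ->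
  continuous (f \o clamp a b).
Proof.
move=> ab /subspace_continuousP cf x; apply/cvgrPdist_le => e e0.
have := cf _ (clamp_in x ab) => /cvgrPdist_le/(_ _ e0).
rewrite near_withinE => /nbhs_ballP[r /= r0 rH].
apply/nbhs_ballP; exists r => //= y yr; apply: rH; last exact: clamp_in.
by apply: le_lt_trans (clamp_dist _ _ _ _) yr.
Qed.

Lemma continuous_within A f : continuous f -> {within A, continuous f}.
Proof. by move=> cf; apply: continuous_subspaceT. Qed.

Lemma withinM A f g : {within A, continuous f} -> {within A, continuous g} ->
  {within A, continuous (fun x => f x * g x)}.
Proof.
move=> /subspace_continuousP cf /subspace_continuousP cg.
by apply/subspace_continuousP => x Ax; apply: cvgM; [exact: cf|exact: cg].
Qed.

Lemma withinD A f g : {within A, continuous f} -> {within A, continuous g} ->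
  {within A, continuous (fun x => f x + g x)}.
Proof.
move=> /subspace_continuousP cf /subspace_continuousP cg.
by apply/subspace_continuousP => x Ax; apply: cvgD; [exact: cf|exact: cg].
Qed.

Lemma withinB A f g : {within A, continuous f} -> {within A, continuous g} ->
  {within A, continuous (fun x => f x - g x)}.
Proof.
move=> /subspace_continuousP cf /subspace_continuousP cg.
by apply/subspace_continuousP => x Ax; apply: cvgB; [exact: cf|exact: cg].
Qed.

Lemma within_cst A c : {within A, continuous (fun _ : R => c)}.
Proof. by apply: continuous_within => x; exact: cvg_cst. Qed.

Lemma withinZ A c f : {within A, continuous f} -> {within A, continuous (fun x => c * f x)}.
Proof. by apply: withinM; exact: within_cst. Qed.

(* Extending by constants keeps a two-sided derivative at the end points. *)
Lemma antiderivative a b g : a <= b -> (forall x, x \in `[a, b] -> {for x, continuous g}) ->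
  exists2 G, (forall x, x \in `[a, b] -> is_derive x 1 G (g x)) & G a = 0.
Proof.
move=> ab cg.
have cg' : continuous (g \o clamp a b).
  move=> x; apply: continuous_comp; first exact: clamp_continuous.
  exact/cg/clamp_in.
set mu := @lebesgue_measure R.
(* Starting the integral at a - 1 puts a itself into the interior, so that the derivative there is
   two-sided. *)
pose H x := \int[mu]_(t in `[a - 1, x]) (g \o clamp a b) t.
have dH x : x \in `[a, b] -> is_derive x 1 H (g x).
  rewrite in_itv/= => /andP[ax xb].
  have [] := @continuous_FTC1_closed R (g \o clamp a b) (a - 1) x (b + 1).
  - by rewrite (le_lt_trans xb)// ltrDl.
  - apply: continuous_compact_integrable; first exact: segment_compact.
    exact: continuous_within.
  - by rewrite ltrBlDr (le_lt_trans ax)// ltrDl.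
  - exact: cg'.
  rewrite derive1E => H1 H2; apply: DeriveDef => //.
  by rewrite H2 /= clamp_id// in_itv/= ax.
exists (fun x => H x - H a); last by rewrite subrr.
move=> x xab; have := dH x xab => ?.
by apply: is_derive_eq; rewrite subr0.
Qed.

Lemma ndecr_cc a b f (df : R -> R) : {within `[a, b], continuous f} ->
  (forall x : R, x \in `]a, b[ -> is_derive x 1 f (df x)) ->
  (forall x : R, x \in `]a, b[ -> 0 <= df x) ->
  forall x y : R, x \in `[a, b] -> y \in `[a, b] -> x <= y -> f x <= f y.
Proof.
move=> cf Df Df0 x y xab yab xy.
apply: (@ger0_derive1_le_cc R f a b) => //.
- by move=> z /Df[].
- by move=> z zab; rewrite derive1E; have [_ ->] := Df _ zab; exact: Df0.
Qed.

Lemma is_derive_unique f x d d' : is_derive x 1 f d -> is_derive x 1 f d' -> d = d'.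
Proof. by move=> [_ <-] [_ <-]. Qed.

Lemma is_derive_derive1 f x d : is_derive x 1 f d -> derive1 f x = d.
Proof. by move=> [_ <-]; rewrite derive1E. Qed.

Lemma derivable_is_derive1 f x : derivable f x 1 -> is_derive x 1 f (derive1 f x).
Proof. by move=> df; apply: DeriveDef => //; rewrite derive1E. Qed.

(** The function D s - exp (- K s) E(s) is nondecreasing, since its derivative is at least D (1 -
    exp (- K s)) >= 0. Only the derivative inside the interval is involved. *)
Lemma gronwall (T K D : R) (E e : R -> R) : 0 < T -> 0 <= K -> 0 <= D ->
  {within `[0, T], continuous E} ->
  (forall t : R, t \in `]0, T[ -> is_derive t 1 E (e t)) ->
  (forall t : R, t \in `]0, T[ -> e t <= K * E t + D) -> E 0 = 0 ->
  forall t : R, t \in `[0, T] -> E t <= D * T * expR (K * T).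
Proof.
move=> T0 K0 D0 cE dE eE E0 t tT.
pose G (s : R) := D * s - expR (- K * s) * E s.
pose dG (s : R) : R := D - (- K * expR (- K * s) * E s + expR (- K * s) * e s).
have dexp (s : R) : is_derive s 1 (fun s : R => expR (- K * s)) (- K * expR (- K * s)).
  have : is_derive s 1 (fun s : R => - K * s) (- K).
    by apply: is_derive_eq; rewrite /GRing.scale/= mulr1.
  move=> h; apply: is_derive_eq.
  rewrite /GRing.scale/=; ring.
have dGs s : s \in `]0, T[ -> is_derive s 1 G (dG s).
  move=> sT; have := dE _ sT; have := dexp s => h1 h2.
  apply: is_derive_eq; rewrite /dG /GRing.scale/=; ring.
have cG : {within `[0, T], continuous G}.
  apply: withinB.
    by apply: continuous_within => s; apply: cvgM; [exact: cvg_cst|exact: cvg_id].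
  apply: withinM => //; apply: continuous_within => s.
  apply: (@continuous_comp _ _ _ (fun s => - K * s) expR).
    by apply: cvgM; [exact: cvg_cst|exact: cvg_id].
  exact: continuous_expR.
have := @ndecr_cc _ _ G dG cG dGs _ 0 t _ tT.
have t0 : 0 <= t by move: tT; rewrite in_itv/= => /andP[].
have tT' : t <= T by move: tT; rewrite in_itv/= => /andP[].
rewrite in_itv/= lexx (ltW T0) t0 /G E0 !mulr0 subr0 => H.
have {}H : 0 <= D * t - expR (- K * t) * E t.
  apply: H => // s sT; rewrite /dG.
  have := eE _ sT; have := expR_gt0 (- K * s) => h1 h2.
  have : expR (- K * s) <= 1.
    rewrite -expR0 ler_expR mulNr oppr_le0 mulr_ge0//.
    by move: sT; rewrite in_itv/= => /andP[/ltW].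
  nra.
have eK : expR (- K * t) * expR (K * t) = 1.
  by rewrite -expRD mulNr addNr expR0.
have eT : expR (K * t) <= expR (K * T) by rewrite ler_expR ler_wpM2l.
have [Et|Et] := leP (E t) 0.
  by rewrite (le_trans Et)// !mulr_ge0// ?expR_ge0// ltW.
have -> : E t = expR (- K * t) * E t * expR (K * t).
  by rewrite mulrAC eK mul1r.
apply: (@le_trans _ _ (expR (- K * t) * E t * expR (K * T))).
  by rewrite ler_wpM2l// mulr_ge0 ?expR_ge0// ltW.
rewrite ler_wpM2r ?expR_ge0//.
have DT : D * t <= D * T by rewrite ler_wpM2l.
by move: H; rewrite subr_ge0 => /le_trans; apply.
Qed.

End Clamp.

(** * Piecewise continuous functions and their integrals *)

Lemma cvg_fsum (R : realType) (J X : Type) (r : seq J) (F : set_system X) (FF : Filter F) (h : J -> X -> R) (l : J -> R) :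
  (forall j, h j @ F --> l j) -> (fun z : X => \sum_(j <- r) h j z) @ F --> \sum_(j <- r) l j.
Proof.
move=> cv; elim: r => [|j r IH].
  by rewrite big_nil; under eq_fun do rewrite big_nil; exact: cvg_cst.
by rewrite big_cons; under eq_fun do rewrite big_cons; exact: cvgD.
Qed.

Section Partition.
Context {R : realType}.
Variable s : seq R.
Hypothesis sP : itv_partition 0 1 s.
Implicit Types (f g F G : R -> R) (x y : R) (i j k : nat).
Local Notation nd := (node s).

Lemma node0 : nd 0 = 0. Proof. by []. Qed.

Lemma node_size : nd (size s) = 1.
Proof.
rewrite /node; case: sP => _ /eqP <-.
by rewrite (last_nth 0); case: (s) => [//|a l] /=; apply: set_nth_default.
Qed.

Lemma node_lt i : (i < size s)%N -> nd i < nd i.+1.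
Proof.
move=> si; case: sP => p _; rewrite /node /=.
have /(pathP 1)/(_ i si) := p; done.
Qed.

Lemma node_le i j : (i <= j)%N -> (j <= size s)%N -> nd i <= nd j.
Proof.
elim: j => [|j IH]; first by rewrite leqn0 => /eqP->.
rewrite leq_eqVlt => /predU1P[-> //|]; rewrite ltnS => ij js.
by rewrite (le_trans (IH ij (ltnW js)))// ltW// node_lt.
Qed.

Lemma node_ge0 i : (i <= size s)%N -> 0 <= nd i.
Proof. by move=> h; rewrite -node0 node_le. Qed.

Lemma node_le1 i : (i <= size s)%N -> nd i <= 1.
Proof. by move=> h; rewrite -node_size node_le. Qed.

Lemma size_gt0 : (0 < size s)%N.
Proof.
case: s sP => //= -[_ /eqP/esym/eqP]; by rewrite oner_eq0.
Qed.

Lemma cell01 i x : (i < size s)%N -> x \in `]nd i, nd i.+1[ -> x \in `]0, 1[.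
Proof.
move=> si; rewrite !in_itv/= => /andP[h1 h2].
by rewrite (le_lt_trans _ h1) ?node_ge0 1?ltnW// (lt_le_trans h2)// node_le1.
Qed.

Lemma ccell01 i x : (i < size s)%N -> x \in `[nd i, nd i.+1] -> x \in `[0, 1].
Proof.
move=> si; rewrite !in_itv/= => /andP[h1 h2].
by rewrite (le_trans _ h1) ?node_ge0 1?ltnW//= (le_trans h2)// node_le1.
Qed.

Lemma ccell_cover x : x \in `[0, 1] ->
  exists2 i, (i < size s)%N & x \in `[nd i, nd i.+1].
Proof.
rewrite in_itv/= => /andP[x0 x1].
have : x <= nd (size s) by rewrite node_size.
have := leqnn (size s); have := size_gt0.
move: {1 2 4}(size s) => n; elim: n => // n IH _ ns xn.
have [xn'|xn'] := leP (nd n) x; first by exists n => //; rewrite in_itv/= xn'.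
case: n IH ns xn xn' => [|n] IH ns xn xn'.
  by move: xn'; rewrite node0 ltNge x0.
by apply: IH => //; [exact: ltnW|exact: ltW].
Qed.

Lemma cell_length_gt0 i : (i < size s)%N -> 0 < cell_length s i.
Proof. by move=> si; rewrite subr_gt0 node_lt. Qed.

Lemma cell_le_mesh i : (i < size s)%N -> cell_length s i <= mesh s.
Proof.
move=> si; rewrite /mesh.
exact: (@le_bigmax _ _ _ 0 (fun i : 'I_(size s) => cell_length s i) (Ordinal si)).
Qed.

Lemma mesh_gt0 : 0 < mesh s.
Proof. exact: lt_le_trans (cell_length_gt0 size_gt0) (cell_le_mesh size_gt0). Qed.

Lemma mesh_le1 : mesh s <= 1.
Proof.
apply/bigmax_leP; split=> // i _; rewrite /cell_length lerBlDr.
by rewrite (le_trans (node_le1 _))// ?lerDl ?node_ge0// ltnW.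
Qed.

(* Coinciding on each open cell with a function continuous on the whole line
   is stable under pointwise algebra and insensitive to the values at nodes. *)
Definition PC f := forall i, (i < size s)%N ->
  exists2 g, continuous g & {in `]nd i, nd i.+1[, f =1 g}.

Definition eqc f g := forall i, (i < size s)%N -> {in `]nd i, nd i.+1[, f =1 g}.

(** F is a primitive of f in the sense needed for piecewise functions: continuity across the nodes
    makes the fundamental theorem hold on [0, 1] as a whole, while f stays free at the nodes. *)
Definition PD F f := {within `[0, 1], continuous F} /\
  forall i x, (i < size s)%N -> x \in `]nd i, nd i.+1[ -> is_derive x 1 F (f x).

Lemma PC_eqc f g : eqc f g -> PC f -> PC g.
Proof.
move=> fg cf i si; have [h ch fh] := cf i si.
by exists h => // x xi; rewrite -(fg i si)// fh.
Qed.

Lemma PC_continuous f : continuous f -> PC f.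
Proof. by move=> cf i si; exists f. Qed.

Lemma PC_cst c : PC (fun=> c).
Proof. by apply: PC_continuous => x; exact: cvg_cst. Qed.

Lemma PC_within f : {within `[0, 1], continuous f} -> PC f.
Proof.
move=> cf i si; exists (f \o clamp 0 1); first exact: within_clamp.
by move=> x xi /=; rewrite clamp_id//; apply: subset_itv_oo_cc; exact: cell01 xi.
Qed.

Lemma PCD f g : PC f -> PC g -> PC (fun x => f x + g x).
Proof.
move=> cf cg i si; have [h ch fh] := cf i si; have [k ck gk] := cg i si.
exists (fun x => h x + k x); first by move=> x; apply: cvgD; [exact: ch|exact: ck].
by move=> x xi; rewrite fh// gk.
Qed.

Lemma PCM f g : PC f -> PC g -> PC (fun x => f x * g x).
Proof.
move=> cf cg i si; have [h ch fh] := cf i si; have [k ck gk] := cg i si.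
exists (fun x => h x * k x); first by move=> x; apply: cvgM; [exact: ch|exact: ck].
by move=> x xi; rewrite fh// gk.
Qed.

Lemma PCZ c f : PC f -> PC (fun x => c * f x).
Proof. by apply: PCM; exact: PC_cst. Qed.

Lemma PCN f : PC f -> PC (fun x => - f x).
Proof. by move=> cf; apply: PC_eqc (PCZ (-1) cf) => i si x _; rewrite mulN1r. Qed.

Lemma PCB f g : PC f -> PC g -> PC (fun x => f x - g x).
Proof. by move=> cf cg; apply: PCD => //; exact: PCN. Qed.

Lemma PC_abs f : PC f -> PC (fun x => `|f x|).
Proof.
move=> cf i si; have [h ch fh] := cf i si.
exists (fun x => `|h x|); first by move=> x; apply: cvg_norm; exact: ch.
by move=> x xi; rewrite fh.
Qed.

Lemma PCX f n : PC f -> PC (fun x => f x ^+ n).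
Proof.
move=> cf; elim: n => [|n IH]; first exact: PC_cst.
by apply: PC_eqc (PCM cf IH) => i si x _; rewrite exprS.
Qed.

Lemma PC_sum (I : Type) (r : seq I) (c : I -> R) (f : I -> R -> R) :
  (forall j : I, PC (f j)) -> PC (fun x => \sum_(j <- r) c j * f j x).
Proof.
move=> cf; elim: r => [|i r IH].
  by apply: PC_eqc (PC_cst 0) => i si x _; rewrite big_nil.
by apply: PC_eqc (PCD (PCZ (c i) (cf i)) IH) => j sj x _; rewrite big_cons.
Qed.

(** Cell i lies entirely on one side of cell j, so the clamp is constantly an end point of cell j
    there. This is what makes the pieces of a glued primitive locally constant off their own
    cell. *)
Lemma clamp_other_cell i j x y : (j < size s)%N -> (i < size s)%N -> i != j ->
  x \in `]nd i, nd i.+1[ -> y \in `]nd i, nd i.+1[ ->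
  clamp (nd j) (nd j.+1) x = clamp (nd j) (nd j.+1) y.
Proof.
move=> sj si; rewrite !in_itv/= neq_ltn => /orP[ij|ji] /andP[y1 y2] /andP[x1 x2].
  have ij' : nd i.+1 <= nd j by apply: node_le => //; exact: ltnW.
  have jj := ltW (node_lt sj).
  by rewrite (clamp_lt jj (le_trans (ltW y2) ij')) (clamp_lt jj (le_trans (ltW x2) ij')).
have ij' : nd j.+1 <= nd i by apply: node_le => //; exact: ltnW.
have jj := ltW (node_lt sj).
by rewrite (clamp_gt jj (le_trans ij' (ltW y1))) (clamp_gt jj (le_trans ij' (ltW x1))).
Qed.

(* Gluing: the summand of cell i is constant outside that cell. *)
Lemma PC_antider f : PC f -> exists2 F, PD F f & F 0 = 0.
Proof.
move=> cf.
have H i : exists G, (i < size s)%N ->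
    (forall x : R, x \in `]nd i, nd i.+1[ -> is_derive x 1 G (f x)) /\
    {within `[nd i, nd i.+1], continuous G}.
  have [si|si] := boolP (i < size s)%N; last by exists (fun=> 0).
  have [g cg fg] := cf i si.
  have [G dG _] := @antiderivative _ (nd i) (nd i.+1) g (ltW (node_lt si)) (fun x _ => cg x).
  exists G => _; split=> [x xi|].
    by rewrite fg//; apply: dG; exact: subset_itv_oo_cc.
  apply: derivable_within_continuous => x xi; exact: (@ex_derive _ _ _ _ _ _ _ (dG x xi)).
pose G i := sval (cid (H i)).
have GP i : (i < size s)%N -> (forall x : R, x \in `]nd i, nd i.+1[ -> is_derive x 1 (G i) (f x)) /\
    {within `[nd i, nd i.+1], continuous (G i)} by exact: (svalP (cid (H i))).
pose cl i x := G i (clamp (nd i) (nd i.+1) x).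
pose F x := \sum_(i < size s) (cl i x - cl i 0).
exists F; last by rewrite /F big1// => i _; rewrite subrr.
split.
  apply: continuous_within; rewrite /F => x.
  apply: cvg_fsum => i; apply: cvgB; last exact: cvg_cst.
  have := within_clamp (ltW (node_lt (ltn_ord i))) (GP i (ltn_ord i)).2; exact.
move=> i x si xi.
pose c := F x - cl i x.
apply: (@near_eq_is_derive _ _ _ (fun y => G i y + c)); last first.
  have := (GP i si).1 x xi => h.
  by apply: is_derive_eq; rewrite addr0.
near=> y.
have yi : y \in `]nd i, nd i.+1[ by near: y; exact: near_itvoo.
have Gy : G i y = cl i y by rewrite /cl clamp_id//; exact: subset_itv_oo_cc.
suff FF : F y - F x = cl i y - cl i x by rewrite /c Gy -[RHS](subrK (F x)) FF; ring.
rewrite /F -sumrB (bigD1 (Ordinal si))//= big1 ?addr0; first by ring.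
move=> j ji; suff -> : cl j y = cl j x by rewrite subrr.
by rewrite /cl (clamp_other_cell _ si _ yi xi)// eq_sym.
Unshelve. all: by end_near. Qed.

(** The mean value theorem gives monotonicity on each closed cell, and continuity at the nodes
    chains the cells together. Positivity of integrals rests on this. *)
Lemma PD_ndecr F f : PD F f -> (forall i x, (i < size s)%N -> x \in `]nd i, nd i.+1[ -> 0 <= f x) ->
  forall x y, x \in `[0, 1] -> y \in `[0, 1] -> x <= y -> F x <= F y.
Proof.
move=> [cF dF] f0.
have H n : (n <= size s)%N -> forall x y, 0 <= x -> x <= y -> y <= nd n -> F x <= F y.
  elim: n => [|n IH] ns x y x0 xy yn.
    by have -> : y = x by move: yn; rewrite node0; lra.
  have C : forall x y, nd n <= x -> x <= y -> y <= nd n.+1 -> F x <= F y.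
    move=> {x0 xy yn} {}x {}y nx xy yn.
    apply: (@ndecr_cc R (nd n) (nd n.+1) F f) => //.
    - apply: continuous_subspaceW cF => z; exact: ccell01.
    - by move=> z; exact: dF.
    - by move=> z; exact: f0.
    - by rewrite in_itv/= nx (le_trans xy).
    - by rewrite in_itv/= yn (le_trans nx).
  have [yn'|yn'] := leP y (nd n); first by apply: IH => //; exact: ltnW.
  have [xn|xn] := leP (nd n) x; first exact: C.
  apply: (@le_trans _ _ (F (nd n))); first by apply: IH => //; [exact: ltnW|exact: ltW].
  by apply: C => //; exact: ltW.
move=> x y; rewrite !in_itv/= => /andP[x0 x1] /andP[y0 y1] xy.
by apply: (H (size s)) => //; rewrite node_size.
Qed.

Lemma PDD F f G g : PD F f -> PD G g -> PD (fun x => F x + G x) (fun x => f x + g x).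
Proof.
move=> [cF dF] [cG dG]; split; first exact: withinD.
by move=> i x si xi; have := dF _ _ si xi; have := dG _ _ si xi => h1 h2; apply: is_deriveD.
Qed.

Lemma PDZ c F f : PD F f -> PD (fun x => c * F x) (fun x => c * f x).
Proof.
move=> [cF dF]; split; first exact: withinZ.
by move=> i x si xi; have := dF _ _ si xi => h1; apply: is_derive_eq; rewrite /GRing.scale.
Qed.

Lemma PDM F f G g : PD F f -> PD G g -> PD (fun x => F x * G x) (fun x => f x * G x + F x * g x).
Proof.
move=> [cF dF] [cG dG]; split; first exact: withinM.
move=> i x si xi; have := dF _ _ si xi; have := dG _ _ si xi => h1 h2.
by apply: is_derive_eq; rewrite /GRing.scale/=; ring.
Qed.

Lemma PDB F f G g : PD F f -> PD G g -> PD (fun x => F x - G x) (fun x => f x - g x).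
Proof.
move=> [cF dF] [cG dG]; split; first exact: withinB.
by move=> i x si xi; have := dF _ _ si xi; have := dG _ _ si xi => h1 h2; apply: is_deriveB.
Qed.

Lemma PD_eqc F f g : eqc f g -> PD F f -> PD F g.
Proof. move=> fg [cF dF]; split=> // i x si xi; rewrite -(fg i si)//; exact: (dF i). Qed.

Lemma PD_cst c : PD (fun=> c) (fun=> 0).
Proof. by split=> [|i x si xi]; [exact: within_cst|exact: is_derive_cst]. Qed.

Lemma PD_eq01 F G f : {in `[0, 1], F =1 G} -> PD F f -> PD G f.
Proof.
move=> FG [cF dF]; split.
  move: cF; apply: subspace_eq_continuous => x; rewrite inE => ?; exact: FG.
move=> i x si xi; apply: near_eq_is_derive (dF i x si xi).
near=> y; apply: FG; apply: subset_itv_oo_cc; apply: (cell01 si).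
by near: y; exact: near_itvoo.
Unshelve. all: by end_near. Qed.

Lemma PD_derive1 F f : PD F f -> eqc (derive1 F) f.
Proof. by move=> [_ dF] i si x xi; apply: is_derive_derive1; exact: (dF i). Qed.

Lemma PD_PC F f : PD F f -> PC F.
Proof. by move=> [cF _]; exact: PC_within. Qed.

End Partition.

(** * Integrals over ]0, 1[ by means of antiderivatives *)

Section Integral.
Context {R : realType}.
Implicit Types (f g F G v w : R -> R) (a b x y : R) (i j k : nat) (s : seq R).
Local Notation mu := (@lebesgue_measure R).

Definition Int f : R := \int[mu]_(x in `]0, 1[) f x.

Lemma integrable_set1 (a : R) f : mu.-integrable [set a] (EFin \o f).
Proof.
apply/integrableP; split; first exact: measurable_fun_set1.
by rewrite integral_set1 ltry.
Qed.

Lemma integrable_setU d (X : measurableType d) (nu : {measure set X -> \bar R})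
    (A B : set X) (f : X -> \bar R) :
  measurable A -> measurable B -> [disjoint A & B] ->
  nu.-integrable A f -> nu.-integrable B f -> nu.-integrable (A `|` B) f.
Proof.
move=> mA mB AB /integrableP[mfA iA] /integrableP[mfB iB]; apply/integrableP.
split; first by apply/measurable_funU.
rewrite ge0_integral_setU//; first by rewrite lte_add_pinfty.
by apply: measurableT_comp => //; apply/measurable_funU.
Qed.

(** The fundamental theorem cell by cell, accumulated over ]0, node n]. Together with [PC_antider]
    it turns linearity and positivity of the integral into statements on antiderivatives, so that no
    integrability argument is needed after this lemma. *)
Lemma PD_Int s F f : itv_partition 0 1 s -> PC s f -> PD s F f -> Int f = F 1 - F 0.
Proof.
move=> sP cf [cF dF].
have H n : (n <= size s)%N -> mu.-integrable `]0, node s n] (EFin \o f) /\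
    \int[mu]_(x in `]0, node s n]) f x = F (node s n) - F 0.
  elim: n => [|n IH] ns.
    rewrite node0 set_itv_ge ?bnd_simp ?ltxx// Rintegral_set0 subrr; split=> //.
    exact: integrable_set0.
  have [i1 I1] := IH (ltnW ns); have [g cg fg] := cf n ns.
  set a := node s n in i1 I1 fg *; set b := node s n.+1 in fg *.
  have ab : a < b := node_lt sP ns.
  have ig : mu.-integrable `[a, b] (EFin \o g).
    apply: continuous_compact_integrable; first exact: segment_compact.
    exact: continuous_within.
  have igoo : mu.-integrable `]a, b[ (EFin \o g).
    by apply: integrableS ig => //; exact: subset_itv_oo_cc.
  have igoc : mu.-integrable `]a, b] (EFin \o g).
    by apply: integrableS ig => //; exact: subset_itv_oc_cc.
  have ifoo : mu.-integrable `]a, b[ (EFin \o f).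
    apply: eq_integrable igoo => // x; rewrite inE/= => xab.
    by rewrite fg.
  have Eb : [set` `]a, b]] = [set` `]a, b[] `|` [set b].
    by rewrite setUitv1// bnd_simp.
  (* The value of f at the node b is arbitrary, so the end point is joined as a separate null
     set. *)
  have ifoc : mu.-integrable `]a, b] (EFin \o f).
    rewrite Eb; apply: integrable_setU => //; last exact: integrable_set1.
    by apply/disj_setPS => x /= []; rewrite in_itv/= => /andP[_ /[swap] ->]; rewrite ltxx.
  have a0 : 0 <= a by rewrite node_ge0// ltnW.
  have E0 : [set` `]0, b]] = [set` `]0, a]] `|` [set` `]a, b]].
    by rewrite -itv_bndbnd_setU// bnd_simp// ltW.
  have disj : [disjoint `]0, a]%classic & `]a, b]%classic].
    by apply/disj_setPS => x /= []; rewrite !in_itv/= => /andP[_ h1] /andP[h2 _]; move: (lt_le_trans h2 h1); rewrite ltxx.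
  have i2 : mu.-integrable `]0, b] (EFin \o f).
    by rewrite E0; apply: integrable_setU.
  split=> //; rewrite E0 Rintegral_setU//; last by rewrite -E0.
  rewrite I1 -Rintegral_itv_bndo_bndc//.
  have -> : \int[mu]_(x in `]a, b[) f x = \int[mu]_(x in `]a, b[) g x.
    by apply: eq_Rintegral => x; rewrite inE/= => xab; rewrite fg.
  rewrite Rintegral_itv_bndo_bndc// Rintegral_itv_obnd_cbnd//.
  rewrite /Rintegral (@continuous_FTC2 R g F a b)//=; first by ring.
  - exact: continuous_within.
  - have /(continuous_within_itvP _ ab)[h1 h2 h3] : {within `[a, b], continuous F}.
      by apply: continuous_subspaceW cF => x; exact: (ccell01 sP ns).
    by split=> // x xab; have [] := dF n x ns xab.
  - move=> x xab; rewrite -fg//; apply: is_derive_derive1; exact: dF xab.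
have [i1] := H _ (leqnn _); rewrite node_size// => I1.
rewrite -I1 /Int Rintegral_itv_bndo_bndc//.
by apply: integrableS i1 => //; rewrite node_size//; exact: subset_itv_oo_oc.
Qed.

Section WithPartition.
Variable s : seq R.
Hypothesis sP : itv_partition 0 1 s.
Local Notation PC := (PC s).
Local Notation PD := (PD s).
Local Notation eqc := (eqc s).

Lemma Int_eqc f g : PC f -> eqc f g -> Int f = Int g.
Proof.
move=> cf fg; have [F dF _] := PC_antider sP cf.
by rewrite (PD_Int sP cf dF) (PD_Int sP (PC_eqc fg cf) (PD_eqc fg dF)).
Qed.

Lemma IntD f g : PC f -> PC g -> Int (fun x => f x + g x) = Int f + Int g.
Proof.
move=> cf cg; have [F dF F0] := PC_antider sP cf; have [G dG G0] := PC_antider sP cg.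
by rewrite (PD_Int sP (PCD cf cg) (PDD dF dG)) (PD_Int sP cf dF) (PD_Int sP cg dG); ring.
Qed.

Lemma IntZ c f : PC f -> Int (fun x => c * f x) = c * Int f.
Proof.
move=> cf; have [F dF F0] := PC_antider sP cf.
by rewrite (PD_Int sP (PCZ c cf) (PDZ c dF)) (PD_Int sP cf dF); ring.
Qed.

Lemma IntB f g : PC f -> PC g -> Int (fun x => f x - g x) = Int f - Int g.
Proof.
move=> cf cg; rewrite -[- Int g]mulN1r -IntZ// -IntD//; last exact: PCZ.
by congr Int; apply/funext => x; rewrite mulN1r.
Qed.

Lemma Int_ge0 f : PC f -> (forall i x, (i < size s)%N -> x \in `]node s i, node s i.+1[ -> 0 <= f x) -> 0 <= Int f.
Proof.
move=> cf f0; have [F dF F0] := PC_antider sP cf.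
rewrite (PD_Int sP cf dF) subr_ge0.
by apply: (PD_ndecr sP dF) => //; rewrite in_itv/= ?lexx ?ler01.
Qed.

Lemma le_Int f g : PC f -> PC g ->
  (forall i x, (i < size s)%N -> x \in `]node s i, node s i.+1[ -> f x <= g x) -> Int f <= Int g.
Proof.
move=> cf cg fg; rewrite -subr_ge0 -IntB//; apply: Int_ge0; first exact: PCB.
by move=> i x si xi; rewrite subr_ge0; exact: fg xi.
Qed.

Lemma Int_cst c : Int (fun=> c) = c.
Proof.
have h : PD (fun x => c * x) (fun=> c).
  split; first by apply: continuous_within => x; apply: cvgM; [exact: cvg_cst|exact: cvg_id].
  by move=> i x _ _; apply: is_derive_eq; rewrite /GRing.scale/= mulr1.
by rewrite (PD_Int sP (@PC_cst R s c) h) mulr1 mulr0 subr0.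
Qed.

Lemma Int_sum (I : Type) (r : seq I) (c : I -> R) (f : I -> R -> R) :
  (forall j : I, PC (f j)) -> Int (fun x => \sum_(j <- r) c j * f j x) = \sum_(j <- r) c j * Int (f j).
Proof.
move=> cf; elim: r => [|i r IH].
  by rewrite big_nil -[RHS](Int_cst 0); congr Int; apply/funext => x; rewrite big_nil.
rewrite big_cons -IH -IntZ// -IntD//; [|exact: PCZ|exact: PC_sum].
by congr Int; apply/funext => x; rewrite big_cons.
Qed.

(* An antiderivative of |f| dominates the variation of F. *)
Lemma PD_le_Int_abs F f x y : PD F f -> PC f -> x \in `[0, 1] -> y \in `[0, 1] ->
  `|F x - F y| <= Int (fun z => `|f z|).
Proof.
move=> dF cf xI yI.
wlog xy : x y xI yI / x <= y.
  by move=> W; have [/W->//|/ltW/W] := leP x y; rewrite distrC => ->.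
have [G dG G0] := PC_antider sP (PC_abs cf).
have dG' := PDD dG (PDZ 1 dF); have dG'' := PDD dG (PDZ (-1) dF).
have h1 := PD_ndecr sP dG' _ xI yI xy; have h2 := PD_ndecr sP dG'' _ xI yI xy.
have h3 := PD_ndecr sP dG; rewrite (PD_Int sP (PC_abs cf) dG).
have I0 : (0 : R) \in `[0, 1] by rewrite in_itv/= lexx ler01.
have I1 : (1 : R) \in `[0, 1] by rewrite in_itv/= lexx ler01.
have {}h3 := fun a b => h3 (fun i z _ _ => normr_ge0 (f z)) a b.
have h4 := h3 _ _ I0 xI; have h5 := h3 _ _ yI I1.
have {}h1 : G x + 1 * F x <= G y + 1 * F y.
  by apply: h1 => i z _ _; have := ler_norm (- f z); rewrite normrN; lra.
have {}h2 : G x + -1 * F x <= G y + -1 * F y.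
  by apply: h2 => i z _ _; have := ler_norm (f z); lra.
move: xI yI; rewrite !in_itv/= => /andP[x0 x1] /andP[y0 y1].
have {}h4 := h4 x0; have {}h5 := h5 y1.
by rewrite ler_norml; lra.
Qed.

(* A nonnegative integrand with zero integral has a constant antiderivative. *)
Lemma Int_eq0 f : PC f -> (forall i x, (i < size s)%N -> x \in `]node s i, node s i.+1[ -> 0 <= f x) ->
  Int f = 0 -> eqc f (fun=> 0).
Proof.
move=> cf f0 If0 i si x xi; have [F dF F0] := PC_antider sP cf.
have I0 : (0 : R) \in `[0, 1] by rewrite in_itv/= lexx ler01.
have I1 : (1 : R) \in `[0, 1] by rewrite in_itv/= lexx ler01.
have Fc y : y \in `[0, 1] -> F y = F 0.
  move=> yI; have := yI; rewrite in_itv/= => /andP[y0 y1].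
  have h1 := PD_ndecr sP dF f0 I0 yI y0.
  have h2 := PD_ndecr sP dF f0 yI I1 y1.
  by move: If0; rewrite (PD_Int sP cf dF); lra.
have [_ dF'] := dF; have h := dF' _ _ si xi.
have h' : is_derive x 1 F 0.
  apply: near_eq_is_derive (is_derive_cst (F 0) x 1).
  near=> y; rewrite Fc//; apply: subset_itv_oo_cc; apply: (cell01 sP si).
  by near: y; exact: near_itvoo.
exact: is_derive_unique h h'.
Unshelve. all: by end_near. Qed.

Lemma oo_cc_eq a b f g : a < b -> {within `[a, b], continuous f} -> {within `[a, b], continuous g} ->
  {in `]a, b[, f =1 g} -> {in `[a, b], f =1 g}.
Proof.
move=> ab /(continuous_within_itvP _ ab)[_ fa fb] /(continuous_within_itvP _ ab)[_ ga gb] fg x.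
rewrite in_itv/= !le_eqVlt => /andP[/predU1P[<-|xa] /predU1P[|xb]].
- by move=> E; move: ab; rewrite E ltxx.
- suff h : f x @[x --> a^'+] --> g a by exact: (cvg_unique _ fa h).
  apply: cvg_trans ga; apply: near_eq_cvg.
  near=> z; rewrite fg// in_itv/=; apply/andP; split; near: z.
    exact: nbhs_right_gt.
  exact: nbhs_right_lt.
- move=> ->.
  suff h : f x @[x --> b^'-] --> g b by exact: (cvg_unique _ fb h).
  apply: cvg_trans gb; apply: near_eq_cvg.
  near=> z; rewrite fg// in_itv/=; apply/andP; split; near: z.
    exact: nbhs_left_gt.
  exact: nbhs_left_lt.
- by apply: fg; rewrite in_itv/= xa.
Unshelve. all: by end_near. Qed.

Lemma eqc_within f g : {within `[0, 1], continuous f} -> {within `[0, 1], continuous g} ->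
  eqc f g -> {in `[0, 1], f =1 g}.
Proof.
move=> cf cg fg x xI.
have [i si xi] := ccell_cover sP xI.
have C (h : R -> R) : {within `[0, 1], continuous h} -> {within `[node s i, node s i.+1], continuous h}.
  by apply: continuous_subspaceW => z; exact: ccell01.
exact: (oo_cc_eq (node_lt sP si) (C _ cf) (C _ cg) (fg i si)).
Qed.

End WithPartition.
End Integral.

(** * Semi-inner products and orthogonal projection *)

Section SemiInnerProduct.
Context {R : realType}.
Implicit Types (f g h v w : R -> R) (W V : set (R -> R)) (c : R).

Definition subspace_fun W := W (fun=> 0) /\
  forall c f g, W f -> W g -> W (fun x => c * f x + g x).

(** Only semidefinite: functions are total, and two of them that differ at nodes or outside [0, 1]
    are at distance zero. Projections are therefore formulated with null vectors in place of
    equalities. *)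
Record sip W (B : (R -> R) -> (R -> R) -> R) : Prop := Sip {
  sip_W : subspace_fun W;
  sip_sym : forall f g, W f -> W g -> B f g = B g f;
  sip_lin : forall c f g h, W f -> W g -> W h ->
    B (fun x => c * f x + g x) h = c * B f h + B g h;
  sip_ge0 : forall f, W f -> 0 <= B f f
}.

Lemma sub_lin W c f g h : subspace_fun W -> W f -> W g ->
  (forall x, h x = c * f x + g x) -> W h.
Proof. by move=> [_ L] Wf Wg E; have := L c f g Wf Wg; rewrite (_ : (fun x => _) = h)//; apply/funext => x; rewrite E. Qed.

Lemma subZ W c f : subspace_fun W -> W f -> W (fun x => c * f x).
Proof. by move=> WW Wf; apply: (sub_lin (c := c) WW Wf WW.1) => x; rewrite addr0. Qed.

Lemma subB W f g : subspace_fun W -> W f -> W g -> W (fun x => f x - g x).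
Proof. by move=> WW Wf Wg; apply: (sub_lin (c := -1) WW Wg Wf) => x; ring. Qed.

Lemma sub_sum W n (c : nat -> R) (phi : nat -> R -> R) : subspace_fun W ->
  (forall i, (i < n)%N -> W (phi i)) -> W (fun x => \sum_(i < n) c i * phi i x).
Proof.
move=> WW; elim: n => [|n IH] Wp.
  by have := WW.1; congr W; apply/funext => x; rewrite big_ord0.
have := WW.2 (c n) _ _ (Wp n (ltnSn n)) (IH (fun i hi => Wp i (ltnW hi))).
by congr W; apply/funext => x; rewrite big_ord_recr addrC.
Qed.

Section Theory.
Variables (W : set (R -> R)) (B : (R -> R) -> (R -> R) -> R).
Hypothesis SB : sip W B.
Let WW := sip_W SB.

Lemma sip_eq f g h : (forall x, f x = g x) -> B f h = B g h.
Proof. by move=> /funext->. Qed.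

Lemma sip0 h : W h -> B (fun=> 0) h = 0.
Proof.
move=> Wh; have := sip_lin SB 1 WW.1 WW.1 Wh.
rewrite (sip_eq (g := fun=> 0)); last by move=> x; rewrite mulr0 addr0.
by rewrite mul1r; lra.
Qed.

Lemma sipD f g h : W f -> W g -> W h -> B (fun x => f x + g x) h = B f h + B g h.
Proof.
move=> Wf Wg Wh; rewrite -[B f h]mul1r -(sip_lin SB)//.
by apply: sip_eq => x; rewrite mul1r.
Qed.

Lemma sipZ c f h : W f -> W h -> B (fun x => c * f x) h = c * B f h.
Proof.
move=> Wf Wh; rewrite -[RHS]addr0 -(sip0 Wh) -(sip_lin SB)//; last exact: WW.1.
by apply: sip_eq => x; rewrite addr0.
Qed.

Lemma sipB f g h : W f -> W g -> W h -> B (fun x => f x - g x) h = B f h - B g h.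
Proof.
move=> Wf Wg Wh; rewrite addrC -[- B g h]mulN1r -(sip_lin SB)//.
by apply: sip_eq => x; ring.
Qed.

Lemma sip_sum n (c : nat -> R) (phi : nat -> R -> R) h :
  (forall i, (i < n)%N -> W (phi i)) -> W h ->
  B (fun x => \sum_(i < n) c i * phi i x) h = \sum_(i < n) c i * B (phi i) h.
Proof.
move=> Wp Wh; elim: n Wp => [|n IH] Wp.
  by rewrite [RHS]big_ord0 -[RHS](sip0 Wh); apply: sip_eq => x; rewrite big_ord0.
rewrite big_ord_recr/= -IH; last by move=> i /ltnW/Wp.
rewrite addrC -(sip_lin SB)//; first by apply: sip_eq => x; rewrite big_ord_recr addrC.
  exact: Wp.
by apply: (sub_sum (W := W)) => // i /ltnW/Wp.
Qed.

Lemma sip_sqr c f g : W f -> W g ->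
  B (fun x => c * f x + g x) (fun x => c * f x + g x) = c ^+ 2 * B f f + 2 * c * B f g + B g g.
Proof.
move=> Wf Wg; have Wfg : W (fun x => c * f x + g x) by apply: WW.2.
rewrite (sip_lin SB)// (sip_sym SB Wf Wfg) (sip_sym SB Wg Wfg) !(sip_lin SB)//.
by rewrite (sip_sym SB Wg Wf); ring.
Qed.

Lemma cauchy_schwarz f g : W f -> W g -> B f g ^+ 2 <= B f f * B g g.
Proof.
move=> Wf Wg.
have H c : 0 <= c ^+ 2 * B f f + 2 * c * B f g + B g g.
  by rewrite -sip_sqr//; apply: (sip_ge0 SB); apply: WW.2.
have f0 := sip_ge0 SB Wf; have g0 := sip_ge0 SB Wg.
move: f0; rewrite le_eqVlt => /predU1P[f0|f0].
  (* When B f f = 0 the quadratic is affine in c, and this c would give it the value -1 unless B f g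
     = 0. *)
  have := H (- (B g g + 1) / (2 * B f g)); rewrite -f0 !mulr0 add0r mul0r.
  have [->|fg0] := eqVneq (B f g) 0; first by rewrite expr0n.
  have -> : 2 * (- (B g g + 1) / (2 * B f g)) * B f g = - (B g g + 1) by field.
  lra.
have := H (- B f g / B f f).
have -> : (- B f g / B f f) ^+ 2 * B f f + 2 * (- B f g / B f f) * B f g + B g g =
  (B f f * B g g - B f g ^+ 2) / B f f by field; rewrite gt_eqF.
by rewrite pmulr_lge0 ?invr_gt0// subr_ge0.
Qed.

Lemma sip_null f g : W f -> W g -> B f f = 0 -> B f g = 0.
Proof.
move=> Wf Wg f0; have := cauchy_schwarz Wf Wg; rewrite f0 mul0r => h.
by apply/eqP; rewrite -sqrf_eq0; apply/eqP; apply: le_anti; rewrite h sqr_ge0.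
Qed.

Section Basis.
Variable V : set (R -> R).
Hypotheses (VV : subspace_fun V) (VW : V `<=` W).

Definition ortho_family n (phi : nat -> R -> R) :=
  (forall i, (i < n)%N -> V (phi i)) /\
  (forall i j, (i < n)%N -> (j < n)%N -> B (phi i) (phi j) = (i == j)%:R).

Definition ortho_proj n (phi : nat -> R -> R) v : R -> R := fun x => \sum_(i < n) B v (phi i) * phi i x.

(** Completeness of the family up to null vectors, which is all that a semi-inner product can
    detect. *)
Definition spanning n (phi : nat -> R -> R) := forall v, V v ->
  B (fun x => v x - ortho_proj n phi v x) (fun x => v x - ortho_proj n phi v x) = 0.

Lemma comb_V n (c : nat -> R) phi : ortho_family n phi -> V (fun x => \sum_(i < n) c i * phi i x).
Proof. by move=> [Vp _]; exact: (sub_sum (W := V)). Qed.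

Lemma proj_V n phi v : ortho_family n phi -> V (ortho_proj n phi v).
Proof. exact: (comb_V (fun i => B v (phi i))). Qed.

Lemma comb_coord n (c : nat -> R) phi j : ortho_family n phi -> (j < n)%N ->
  B (fun x => \sum_(i < n) c i * phi i x) (phi j) = c j.
Proof.
move=> [Vp on] jn; rewrite sip_sum; [|by move=> i /Vp/VW|exact/VW/Vp].
rewrite (bigD1 (Ordinal jn))//= on// eqxx mulr1 big1 ?addr0// => i ij.
by rewrite on// (_ : (i == j :> nat) = false) ?mulr0//; apply/negbTE.
Qed.

Lemma comb_norm n (c : nat -> R) phi : ortho_family n phi ->
  B (fun x => \sum_(i < n) c i * phi i x) (fun x => \sum_(i < n) c i * phi i x) = \sum_(i < n) c i ^+ 2.
Proof.
move=> on; have Vc := comb_V c on; rewrite sip_sum; [|by move=> i /on.1/VW|exact: VW].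
apply: eq_bigr => i _; rewrite (sip_sym SB)//; [|exact/VW/on.1|exact: VW].
by rewrite comb_coord// expr2.
Qed.

Lemma proj_orth_basis n phi v j : ortho_family n phi -> W v -> (j < n)%N ->
  B (fun x => v x - ortho_proj n phi v x) (phi j) = 0.
Proof.
move=> on Wv jn; rewrite sipB//; [|exact/VW/proj_V|exact/VW/on.1].
by rewrite /ortho_proj (comb_coord (fun i => B v (phi i)))// subrr.
Qed.

(** w is the sum of a null remainder, orthogonal to everything by the Cauchy-Schwarz inequality, and
    of a combination of the basis, to which the residual of v is orthogonal by construction. *)
Lemma proj_orth n phi v w : ortho_family n phi -> spanning n phi -> W v -> V w ->
  B (fun x => v x - ortho_proj n phi v x) w = 0.
Proof.
move=> on cp Wv Vw.
have Wr : W (fun x => v x - ortho_proj n phi v x) by apply: subB => //; exact/VW/proj_V.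
have Ws : W (fun x => w x - ortho_proj n phi w x).
  by apply: subB => //; [exact: VW|exact/VW/proj_V].
have h := sip_null Ws Wr (cp w Vw).
have : B (fun x => (w x - ortho_proj n phi w x) + ortho_proj n phi w x) (fun x => v x - ortho_proj n phi v x) = 0.
  rewrite sipD//; last exact/VW/proj_V.
  rewrite h add0r /ortho_proj (sip_sum (fun i => B w (phi i)) (phi := phi))//; last by move=> i /on.1/VW.
  rewrite big1// => i _; rewrite (sip_sym SB (VW (on.1 _ (ltn_ord i))))//.
  by rewrite proj_orth_basis// mulr0.
rewrite (sip_eq (g := w)); last by move=> x; rewrite subrK.
by rewrite (sip_sym SB)//; exact: VW.
Qed.

Lemma orth_best v p w : W v -> V p -> (forall z, V z -> B (fun x => v x - p x) z = 0) -> V w ->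
  B (fun x => v x - p x) (fun x => v x - p x) <= B (fun x => v x - w x) (fun x => v x - w x).
Proof.
move=> Wv Vp orth Vw.
have Wr : W (fun x => v x - p x) by apply: subB => //; exact: VW.
have Vz : V (fun x => p x - w x) by apply: subB.
have := sip_sqr 1 Wr (VW Vz); rewrite (orth _ Vz).
rewrite (_ : (fun x => _) = (fun x => v x - w x)); last by apply/funext => x; ring.
by move=> ->; have := sip_ge0 SB (VW Vz); rewrite expr1n; lra.
Qed.

(** A dimension bound modulo null vectors that avoids quotient spaces and bases; linear dependence
    of piecewise polynomials comes out in exactly this form. *)
Definition dim_le N := forall phi : nat -> R -> R, (forall i, (i <= N)%N -> V (phi i)) ->
  exists2 a : nat -> R, (exists2 i, (i <= N)%N & a i != 0) &
    B (fun x => \sum_(i < N.+1) a i * phi i x) (fun x => \sum_(i < N.+1) a i * phi i x) = 0.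

(* Otherwise Gram-Schmidt would produce arbitrarily large orthonormal families. *)
Lemma orthonormal_basis N : dim_le N ->
  exists n phi, ortho_family n phi /\ spanning n phi.
Proof.
move=> dim; apply: contrapT => nex.
suff /(_ N.+1)[phi on] : forall n, exists phi, ortho_family n phi.
  have [a [i iN ai] ] := dim phi (fun i => on.1 i).
  rewrite comb_norm// => /eqP; rewrite psumr_eq0; last by move=> ? _; exact: sqr_ge0.
  by move=> /allP/(_ (Ordinal (iN : (i < N.+1)%N))); rewrite mem_index_enum /= sqrf_eq0 (negbTE ai) => /(_ isT).
elim=> [|n [phi on]]; first by exists (fun _ _ => 0).
have ncp : ~ spanning n phi by move=> cp; apply: nex; exists n, phi.
move/existsNP: ncp => [v /not_implyP[Vv wn]].
set w := fun x => v x - ortho_proj n phi v x in wn.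
have Vw : V w by apply: subB => //; exact: proj_V.
have w0 : 0 < B w w by rewrite lt_neqAle (sip_ge0 SB (VW Vw)) andbT eq_sym; apply/eqP.
set c := (Num.sqrt (B w w))^-1.
have c2 : c ^+ 2 * B w w = 1.
  by rewrite /c exprVn sqr_sqrtr ?(ltW w0)// mulVf// gt_eqF.
have wphi j : (j < n)%N -> B w (phi j) = 0 by move=> jn; apply: proj_orth_basis => //; exact: VW.
have Ww := VW Vw.
have Wc : W (fun x => c * w x) by exact: subZ.
exists (fun i => if i == n then (fun x => c * w x) else phi i); split=> [i|i j].
  by rewrite ltnS leq_eqVlt; case: eqVneq => [_ _|_ /= /on.1//]; exact: subZ.
have E : B (fun x => c * w x) (fun x => c * w x) = 1.
  by rewrite sipZ// (sip_sym SB Ww Wc) sipZ// mulrA -expr2.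
have F k : (k < n)%N -> B (fun x => c * w x) (phi k) = 0.
  by move=> kn; rewrite sipZ ?wphi ?mulr0//; exact/VW/on.1.
rewrite !ltnS (leq_eqVlt i) (leq_eqVlt j); case: (eqVneq i n) => [->|i_n] /=; case: (eqVneq j n) => [->|j_n] /=.
- by rewrite E.
- by move=> _ jn; rewrite F// (_ : (n == j) = false)//; apply/negbTE; rewrite eq_sym.
- by move=> i_ _; rewrite (sip_sym SB)// ?F// ?(negbTE i_n)//; exact/VW/on.1.
- exact: on.2.
Qed.

End Basis.
End Theory.
End SemiInnerProduct.

(** * The L^2 product, the form a, and spaces of piecewise polynomials *)

Section Products.
Context {R : realType}.
Variable s : seq R.
Hypothesis sP : itv_partition 0 1 s.
Implicit Types (f g h v w : R -> R) (c : R).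
Local Notation PC := (PC s).
Local Notation PD := (PD s).
Local Notation eqc := (eqc s).

(** Continuous, piecewise C^1 functions: the domain on which [derive1] stands for the weak
    derivative and the form a is a semi-inner product. *)
Definition PC1 f := PD f (derive1 f) /\ PC (derive1 f).

Lemma PD_PC1 F f : PD F f -> PC f -> PC1 F.
Proof.
move=> dF cf; have e := PD_derive1 dF.
have e' : eqc f (derive1 F) by move=> i si x xi; rewrite (e i si).
by split; [exact: PD_eqc e' dF|exact: PC_eqc e' cf].
Qed.

Lemma PC1_PC f : PC1 f -> PC f.
Proof. by move=> [[cf _] _]; exact: PC_within. Qed.

Lemma PC1_lin c f g : PC1 f -> PC1 g -> PD (fun x => c * f x + g x) (fun x => c * derive1 f x + derive1 g x).
Proof. by move=> [df _] [dg _]; exact: PDD (PDZ c df) dg. Qed.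

Lemma sub_PC : subspace_fun PC.
Proof.
split=> [|c f g cf cg]; first exact: PC_cst.
by apply: PCD => //; exact: PCZ.
Qed.

Lemma sub_PC1 : subspace_fun PC1.
Proof.
split=> [|c f g cf cg]; first by apply: PD_PC1 (PD_cst _ _) (@PC_cst _ s 0).
by apply: (PD_PC1 (PC1_lin c cf cg)); apply: PCD; [apply: PCZ; exact: cf.2|exact: cg.2].
Qed.

Lemma sip_ip : sip PC (@ip R).
Proof.
split; first exact: sub_PC.
- by move=> f g _ _; rewrite /ip; congr Rintegral; apply/funext => x; rewrite mulrC.
- move=> c f g h cf cg ch; rewrite /ip -!/(Int _).
  rewrite -(IntZ sP); last exact: PCM.
  rewrite -(IntD sP); [|by apply: PCZ; exact: PCM|exact: PCM].
  by congr Int; apply/funext => x; ring.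
- move=> f cf; apply: (Int_ge0 sP); first exact: PCM.
  by move=> i x _ _; rewrite -expr2 sqr_ge0.
Qed.

Lemma ip_eqc f g f' g' : PC f -> PC g -> eqc f f' -> eqc g g' -> ip f g = ip f' g'.
Proof.
move=> cf cg ff gg; apply: (Int_eqc sP); first exact: PCM.
by move=> i si x xi; rewrite (ff i si)// (gg i si).
Qed.

Lemma sip_form_a mu : 0 < mu -> sip PC1 (form_a mu).
Proof.
move=> mu0; have S := sip_ip; split; first exact: sub_PC1.
- move=> f g cf cg; rewrite /form_a (sip_sym S (PC1_PC cf) (PC1_PC cg)).
  by rewrite (sip_sym S cf.2 cg.2).
- move=> c f g h cf cg ch; rewrite /form_a (sip_lin S c (PC1_PC cf) (PC1_PC cg) (PC1_PC ch)).
  have e := PD_derive1 (PC1_lin c cf cg).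
  (* [derive1] is additive only off the nodes, where both functions are differentiable; the integral
     does not see the difference. *)
  have -> : ip (derive1 (fun x => c * f x + g x)) (derive1 h) =
      ip (fun x => c * derive1 f x + derive1 g x) (derive1 h).
    apply: ip_eqc => //; [|exact: ch.2].
    by have [_] := sub_PC1.2 c f g cf cg.
  by rewrite (sip_lin S c cf.2 cg.2 ch.2) !mulrDr addrACA (mulrCA (mu / 3)).
- move=> f cf; rewrite /form_a addr_ge0 ?mulr_ge0 ?divr_ge0 ?(ltW mu0)//.
    by apply: (sip_ge0 S); exact: PC1_PC.
  by apply: (sip_ge0 S); exact: cf.2.
Qed.

Definition PP r f := forall i, (i < size s)%N -> exists p : {poly R}, (size p <= r)%N /\
  forall x, x \in `]node s i, node s i.+1[ -> f x = p.[x].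

Lemma PP_PC r f : PP r f -> PC f.
Proof.
move=> Hf i si; have [p [_ fp]] := Hf i si.
by exists (horner p); [exact: continuous_horner|move=> x /fp].
Qed.

Lemma sub_PP r : subspace_fun (PP r).
Proof.
split=> [i si|c f g Hf Hg i si].
  by exists 0; rewrite size_poly0; split=> // x _; rewrite horner0.
have [p [sp fp]] := Hf i si; have [q [sq fq]] := Hg i si.
exists (c *: p + q); split.
  rewrite (leq_trans (size_polyD _ _))// geq_max sq andbT.
  exact: leq_trans (size_scale_leq _ _) sp.
by move=> x xi; rewrite hornerD hornerZ fp// fq.
Qed.

(** There are r coefficients on each cell, so the coefficient matrix of the given functions has one
    more row than columns, and a nonzero vector of its left kernel is a dependence. Column j holds
    the coefficient j mod r on cell j div r. *)
Lemma PP_dependent r (phi : nat -> R -> R) : (forall i, (i <= size s * r)%N -> PP r (phi i)) ->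
  exists2 a : nat -> R, (exists2 i, (i <= size s * r)%N & a i != 0) &
    eqc (fun x => \sum_(i < (size s * r).+1) a i * phi i x) (fun=> 0).
Proof.
move=> Hp; set N := (size s * r)%N in Hp *.
have H i k : exists p : {poly R}, (i <= N)%N -> (k < size s)%N -> (size p <= r)%N /\
  forall x, x \in `]node s k, node s k.+1[ -> phi i x = p.[x].
  have [iN|iN] := boolP (i <= N)%N; last by exists 0.
  have [sk|sk] := boolP (k < size s)%N; last by exists 0.
  by have [p pP] := Hp i iN k sk; exists p.
pose p i k := sval (cid (H i k)).
have pP i k : (i <= N)%N -> (k < size s)%N -> (size (p i k) <= r)%N /\
  forall x, x \in `]node s k, node s k.+1[ -> phi i x = (p i k).[x] by exact: (svalP (cid (H i k))).
pose A := \matrix_(i < N.+1, j < N) (p i (j %/ r)%N)`_(j %% r)%N.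
have : kermx A != 0.
  rewrite -mxrank_eq0 mxrank_ker subn_eq0 -ltnNge.
  by rewrite ltnS rank_leq_col.
move=> /rowV0Pn[a /sub_kermxP aA a0].
have [i ai] : exists i, a 0 i != 0.
  apply: contrapT => /forallNP E; move/eqP: a0; apply; apply/rowP => i; rewrite mxE.
  by apply/eqP; apply: contrapT => /negP; exact: E.
exists (fun i => a 0 (inord i)).
  by exists i; [rewrite -ltnS ltn_ord|rewrite inord_val].
move=> k sk x xk.
have Z : \sum_(i < N.+1) a 0 i *: p i k = 0.
  apply/polyP => l; rewrite coef0 coef_sum.
  have [lr|lr] := ltnP l r; last first.
    rewrite big1// => j _; rewrite coefZ nth_default ?mulr0//.
    by apply: leq_trans lr; have [] := pP j k (ltn_ord j) sk.
  have jN : (k * r + l < N)%N.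
    rewrite /N; apply: (@leq_trans (k * r + r)); first by rewrite ltn_add2l.
    by rewrite addnC -mulSn leq_mul2r sk orbT.
  have := congr1 (fun M : 'rV_N => M 0 (Ordinal jN)) aA; rewrite !mxE => E0; rewrite -[RHS]E0.
  apply: eq_bigr => j _; rewrite coefZ mxE /= divnMDl ?(leq_ltn_trans _ lr)// divn_small// addn0.
  by rewrite modnMDl modn_small.
have := congr1 (fun q : {poly R} => q.[x]) Z; rewrite horner0 horner_sum => E0; rewrite -[RHS]E0.
by apply: eq_bigr => j _; rewrite inord_val hornerZ; have [_ ->] := pP j k (ltn_ord j) sk.
Qed.

(** Serves both the L^2 product and the form a; the last hypothesis translates vanishing off the
    nodes into nullity for the product at hand. *)
Lemma PP_basis (V W : set (R -> R)) B r : sip W B -> subspace_fun V -> V `<=` W -> V `<=` PP r ->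
  (forall f, V f -> eqc f (fun=> 0) -> B f f = 0) ->
  exists n phi, ortho_family B V n phi /\ spanning B V n phi.
Proof.
move=> SB VV VW VP null; apply: (orthonormal_basis SB VV VW (N := (size s * r)%N)) => phi Vp.
have [a a0 az] := PP_dependent (fun i hi => VP _ (Vp i hi)).
by exists a => //; apply: null => //; apply: (sub_sum (W := V)).
Qed.

End Products.

(** * Splines and quasi-interpolation *)

Section SmoothnessClasses.
Context {R : realType}.
Implicit Types (f g h v w : R -> R) (c x y : R) (m : nat).
Local Notation C01 := (C_on (`[0, 1] : set R)).

Lemma C_on_cont m f : C01 m f -> {within `[0, 1], continuous f}.
Proof. by case: m => [|m] []. Qed.

Lemma C_on_deriv m f : C01 m.+1 f -> forall x, x \in `[0, 1] -> has_deriv `[0, 1] f x (deriv_on `[0, 1] f x).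
Proof. by move=> [_ [df _]] x xI; apply: derivable_on_has_deriv => //; exact: df. Qed.

(** Stability of C^m under equality on [0, 1] is a hypothesis here because [C_on_eq] is itself
    proved by induction from this lemma. [C_on_cons] is the version without it. *)
Lemma C_onS m f g : {within `[0, 1], continuous f} ->
  (forall x, x \in `[0, 1] -> has_deriv `[0, 1] f x (g x)) -> C01 m g -> 
  (forall h, C01 m g -> {in `[0, 1], g =1 h} -> C01 m h) -> C01 m.+1 f.
Proof.
move=> cf df cg eqg; split=> //; split=> [x xI|].
  by have [] := (has_derivP f (g x) ltr01 xI).2 (df x xI).
apply: eqg => // x xI; by have [_ ->] := (has_derivP f (g x) ltr01 xI).2 (df x xI).
Qed.

Lemma C_on_eq m f g : {in `[0, 1], f =1 g} -> C01 m f -> C01 m g.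
Proof.
elim: m f g => [|m IH] f g fg cf.
  split=> //; have [+ _] := cf; apply: subspace_eq_continuous => x; rewrite inE => ?; exact: fg.
have df := C_on_deriv cf; have [c0 [_ cd]] := cf.
apply: (C_onS (g := deriv_on `[0, 1] f)) => //; last by move=> h _ /IH; apply.
  move: c0; apply: subspace_eq_continuous => x; rewrite inE => ?; exact: fg.
by move=> x xI; apply: has_deriv_eq (df x xI) => // y yI; exact: fg.
Qed.

Lemma C_on_cons m f g : {within `[0, 1], continuous f} ->
  (forall x, x \in `[0, 1] -> has_deriv `[0, 1] f x (g x)) -> C01 m g -> C01 m.+1 f.
Proof. by move=> cf df cg; apply: (C_onS cf df cg) => h ch /C_on_eq; apply. Qed.

Lemma C_on_lin m c f g : C01 m f -> C01 m g -> C01 m (fun x => c * f x + g x).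
Proof.
elim: m f g => [|m IH] f g cf cg.
  by split=> //; apply: withinD; [apply: withinZ; exact: cf.1|exact: cg.1].
apply: (C_on_cons (g := fun x => c * deriv_on `[0, 1] f x + deriv_on `[0, 1] g x)).
- by apply: withinD; [apply: withinZ; exact: cf.1|exact: cg.1].
- by move=> x xI; apply: has_deriv_lin; [exact: (C_on_deriv cf)|exact: (C_on_deriv cg)].
- by apply: IH; [exact: cf.2.2|exact: cg.2.2].
Qed.

Lemma C_on0 m : C01 m (fun=> 0).
Proof.
elim: m => [|m IH]; first by split=> //; exact: within_cst.
by apply: (C_on_cons (g := fun=> 0)) => //; [exact: within_cst|move=> x _; exact: has_deriv_cst].
Qed.

Lemma C_on_pred m f : C01 m.+1 f -> C01 m f.
Proof.
elim: m f => [|m IH] f cf; first by split=> //; exact: cf.1.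
apply: (C_on_cons (g := deriv_on `[0, 1] f)); [exact: cf.1|exact: (C_on_deriv cf)|].
by apply: IH; exact: cf.2.2.
Qed.

Lemma C_on_le m n f : (m <= n)%N -> C01 n f -> C01 m f.
Proof.
elim: n => [|n IH]; first by rewrite leqn0 => /eqP->.
by rewrite leq_eqVlt => /predU1P[->//|mn /C_on_pred]; exact: IH.
Qed.

End SmoothnessClasses.

(** * Maximally smooth splines and their approximation power *)

Section Splines.
Context {R : realType}.
Variable s : seq R.
Hypothesis sP : itv_partition 0 1 s.
Implicit Types (f g h v w : R -> R) (a b c x y : R).
Local Notation nd := (node s).
Local Notation PC := (PC s).
Local Notation PD := (PD s).
Local Notation PC1 := (PC1 s).
Local Notation eqc := (eqc s).
Local Notation Si := (sip_ip sP).

Lemma in01_0 : (0 : R) \in `[0, 1]. Proof. by rewrite in_itv/= lexx ler01. Qed.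
Lemma in01_1 : (1 : R) \in `[0, 1]. Proof. by rewrite in_itv/= lexx ler01. Qed.

Lemma PD_const F : PD F (fun=> 0) -> {in `[0, 1], forall x, F x = F 0}.
Proof.
move=> dF x xI.
have x0 : 0 <= x by move: xI; rewrite in_itv/= => /andP[].
have h1 := PD_ndecr sP dF (fun i z _ _ => lexx 0) in01_0 xI x0.
have dF' : PD (fun x => -1 * F x) (fun x => -1 * 0) by exact: PDZ.
have h2 := PD_ndecr sP dF' _ in01_0 xI x0.
apply: le_anti; rewrite h1 andbT.
have : -1 * F 0 <= -1 * F x by apply: h2 => i z _ _; rewrite mulr0.
by rewrite !mulN1r lerN2.
Qed.

Lemma PD_const_eq F G f : PD F f -> PD G f -> {in `[0, 1], forall x, F x = G x + (F 0 - G 0)}.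
Proof.
move=> dF dG x xI.
have d : PD (fun x => F x + -1 * G x) (fun=> 0).
  have := PDD dF (PDZ (-1) dG); apply: PD_eqc => i si y _.
  by rewrite mulN1r subrr.
by have := PD_const d xI; lra.
Qed.

(** v differs by a constant from an antiderivative of the continuous g, hence is differentiable at
    the nodes too. The smoothness of splines across nodes comes from here. *)
Lemma PD_has_deriv v g : {within `[0, 1], continuous g} -> PD v g ->
  forall x, x \in `[0, 1] -> has_deriv `[0, 1] v x (g x).
Proof.
move=> cg dv x xI.
have cg' := within_clamp ler01 cg.
have [G dG _] := @antiderivative R 0 1 (g \o clamp 0 1) ler01 (fun x _ => cg' x).
have dG' : PD G g.
  split.
    apply: derivable_within_continuous => z zI; exact: (@ex_derive _ _ _ _ _ _ _ (dG z zI)).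
  move=> i z si zi; have zI : z \in `[0, 1] by apply: subset_itv_oo_cc; exact: cell01 zi.
  by have := dG z zI; rewrite /= clamp_id.
have := has_deriv_lin 1 (is_derive_has_deriv `[0, 1] (dG x xI)) (has_deriv_cst `[0, 1] x (v 0 - G 0)).
rewrite /= clamp_id// mul1r addr0; apply: has_deriv_eq => // y yI.
by rewrite (PD_const_eq dv dG' yI) mul1r.
Qed.

Lemma telescope_le c (A B : R -> R) :
  (forall i, (i < size s)%N -> A (nd i.+1) - A (nd i) <= c * (B (nd i.+1) - B (nd i))) ->
  A 1 - A 0 <= c * (B 1 - B 0).
Proof.
move=> H; have : forall n, (n <= size s)%N -> A (nd n) - A 0 <= c * (B (nd n) - B 0).
  elim=> [|n IH] ns; first by rewrite node0 !subrr mulr0.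
  have := IH (ltnW ns); have := H n ns.
  by rewrite !mulrBr; lra.
by move=> /(_ _ (leqnn _)); rewrite node_size.
Qed.

(* With h = mesh s and q = x - x_{i+1} on cell i, the derivative of
   4 h^2 B - A + 2 q W^2, for A' = W^2 and B' = w^2, is
   (W + 2 q w)^2 + 4 (h^2 - q^2) w^2 >= 0. *)
Lemma poincare W w : PD W w -> PC w -> (forall i, (i < size s)%N -> W (nd i) = 0) ->
  ip W W <= (2 * mesh s) ^+ 2 * ip w w.
Proof.
move=> dW cw W0; have cW := PD_PC sP dW.
have [A dA A0] := PC_antider sP (PCM cW cW).
have [B dB B0] := PC_antider sP (PCM cw cw).
rewrite [ip W W](PD_Int sP (PCM cW cW) dA) [ip w w](PD_Int sP (PCM cw cw) dB).
apply: telescope_le => i si.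
set a := nd i; set b := nd i.+1; have ab : a < b := node_lt sP si.
pose E x := ((2 * mesh s) ^+ 2 * B x - A x) + 2 * ((x - b) * (W x * W x)).
pose dE x := ((2 * mesh s) ^+ 2 * (w x * w x) - W x * W x) +
  2 * (W x * W x + (x - b) * (w x * W x + W x * w x)).
have sub (F : R -> R) : {within `[0, 1], continuous F} -> {within `[a, b], continuous F}.
  by apply: continuous_subspaceW => z; exact: ccell01.
have cE : {within `[a, b], continuous E}.
  apply: withinD.
    by apply: withinB; [apply: withinZ; apply: sub; exact: dB.1|apply: sub; exact: dA.1].
  apply: withinZ; apply: withinM.
    by apply: continuous_within => x; apply: cvgB; [exact: cvg_id|exact: cvg_cst].
  by apply: withinM; apply: sub; exact: dW.1.
have dEE x : x \in `]a, b[ -> is_derive x 1 E (dE x).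
  move=> xi; have := dA.2 i x si xi; have := dB.2 i x si xi; have := dW.2 i x si xi => h1 h2 h3.
  apply: is_derive_eq; rewrite /dE /GRing.scale/=.
  move: (W x) (w x) (mesh s) => p q r; ring.
have E0 x : x \in `]a, b[ -> 0 <= dE x.
  rewrite in_itv/= => /andP[x1 x2].
  have l1 := cell_le_mesh si; rewrite /cell_length -/a -/b in l1.
  have -> : dE x = (W x + 2 * (x - b) * w x) ^+ 2 + 4 * ((mesh s) ^+ 2 - (x - b) ^+ 2) * w x ^+ 2.
    by rewrite /dE; move: (W x) (w x) (mesh s) => p q r; ring.
  rewrite addr_ge0 ?sqr_ge0// mulr_ge0 ?sqr_ge0// mulr_ge0// subr_ge0.
  by rewrite -[(x - b) ^+ 2]sqrrN lerXn2r ?nnegrE; lra.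
have aI : a \in `[a, b] by rewrite in_itv/= lexx ltW.
have bI : b \in `[a, b] by rewrite in_itv/= lexx andbT ltW.
have := ndecr_cc cE dEE E0 aI bI (ltW ab).
(* Both boundary terms vanish: W at the left node by hypothesis, the weight x - b at the right
   one. *)
rewrite /E W0// subrr !(mulr0, mul0r, addr0).
by move: (A a) (A b) (B a) (B b) (mesh s) => *; lra.
Qed.

Lemma ibp W w Z z : PD W w -> PD Z z -> PC w -> PC z -> W 0 * Z 0 = W 1 * Z 1 ->
  ip w Z = - ip W z.
Proof.
move=> dW dZ cw cz E.
have cW := PD_PC sP dW; have cZ := PD_PC sP dZ.
have := PD_Int sP (PCD (PCM cw cZ) (PCM cW cz)) (PDM dW dZ).
rewrite (IntD sP (PCM cw cZ) (PCM cW cz)) -E subrr => /eqP.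
by rewrite addr_eq0 => /eqP.
Qed.

(** Splines of degree p and of class C^(p-1), piecewise constants for p = 0. They are generated by
    integration because the approximation argument passes from a function to its primitive in the
    same way. *)
Fixpoint spline_space (p : nat) : set (R -> R) :=
  if p is p'.+1 then [set v | exists2 g, spline_space p' g & PD v g] else PP s 1.

Local Notation X := spline_space.

Lemma sub_spline p : subspace_fun (X p).
Proof.
elim: p => [|p [IH0 IH]]; first exact: sub_PP.
split; first by exists (fun=> 0) => //; exact: PD_cst.
move=> c f g [f' Xf df] [g' Xg dg].
exists (fun x => c * f' x + g' x); first exact: IH.
exact: PDD (PDZ c df) dg.
Qed.

Lemma poly_antiderivative (q : {poly R}) :
  exists Q : {poly R}, (size Q <= (size q).+1)%N /\ Q^`() = q.
Proof.
exists (\poly_(i < (size q).+1) (q`_i.-1 / i%:R)); split; first exact: size_poly.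
apply/polyP => i; rewrite coef_deriv coef_poly ltnS.
have [iq|iq] := ltnP i (size q).
  by rewrite -[LHS]mulr_natr /= divfK// pnatr_eq0.
by rewrite mul0rn nth_default.
Qed.

Lemma spline_PP p : X p `<=` PP s p.+1.
Proof.
elim: p => [//|p IH] v [g /IH Pg [cv dv]] i si.
have [q [sq gq]] := Pg i si; have [Q [sQ dQ]] := poly_antiderivative q.
have ab := node_lt sP si.
pose m := (nd i + nd i.+1) / 2.
have mi : m \in `]nd i, nd i.+1[ by rewrite in_itv/= /m; lra.
exists (Q + (v m - Q.[m])%:P); split.
  rewrite (leq_trans (size_polyD _ _))// geq_max (leq_trans sQ) ?ltnS//=.
  exact: leq_trans (size_polyC_leq1 _) _.
move=> x xi; rewrite hornerD hornerC.
pose F y := v y - Q.[y].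
have dF y : y \in `]nd i, nd i.+1[ -> is_derive y 1 F 0.
  move=> yi; have := dv i y si yi => h1.
  have h2 : is_derive y 1 (horner Q) (g y).
    by rewrite gq// -dQ derivE; apply: derivable_is_derive1; exact: derivable_horner.
  by apply: is_derive_eq; rewrite subrr.
suff : F x = F m by rewrite /F; lra.
have C y z : y \in `]nd i, nd i.+1[ -> z \in `]nd i, nd i.+1[ -> y <= z -> F y = F z.
  move=> yi zi yz.
  have sub u : u \in `[y, z] -> u \in `]nd i, nd i.+1[.
    move: yi zi; rewrite !in_itv/= => /andP[y1 _] /andP[_ z2] /andP[u1 u2].
    by rewrite (lt_le_trans y1 u1) (le_lt_trans u2 z2).
  have [u _] := @MVT_segment R F (fun=> 0) y z yz (fun u hu => dF u (sub u (subset_itv_oo_cc hu)))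
     (derivable_within_continuous (fun u hu => @ex_derive _ _ _ _ _ _ _ (dF u (sub u hu)))).
  by rewrite mul0r => /eqP; rewrite subr_eq0 => /eqP.
by have [/C->//|/ltW/C->//] := leP x m.
Qed.

Lemma spline_PC p : X p `<=` PC.
Proof. by move=> f /spline_PP/PP_PC. Qed.

Lemma spline_basis p : exists n phi, ortho_family (@ip R) (X p) n phi /\ spanning (@ip R) (X p) n phi.
Proof.
apply: (PP_basis (r := p.+1) Si (@sub_spline p) (@spline_PC p) (@spline_PP p)).
move=> f Xf f0; rewrite (ip_eqc sP (spline_PC Xf) (spline_PC Xf) f0 f0).
by rewrite (sip0 Si)//; exact: PC_cst.
Qed.

Lemma spline_proj p v : PC v -> exists2 g, X p g & forall w, X p w -> ip (fun x => v x - g x) w = 0.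
Proof.
move=> cv; have [n [phi [on cp]]] := spline_basis p.
exists (ortho_proj (@ip R) n phi v); first exact: (proj_V (V := X p) (@sub_spline p)).
by move=> w Xw; apply: (proj_orth Si (@sub_spline p) (@spline_PC p) on cp cv Xw).
Qed.

Lemma cst_spline p c : X p (fun=> c).
Proof.
case: p => [|p].
  move=> i si; exists c%:P; split; first exact: size_polyC_leq1.
  by move=> x _; rewrite hornerC.
by exists (fun=> 0); [exact: (@sub_spline p).1|exact: PD_cst].
Qed.

(** Constants are splines, so w has mean zero and its primitive returns to 0. This removes the
    boundary terms in the integrations by parts below. *)
Lemma orth_end p W w : PD W w -> PC w -> (forall g, X p g -> ip w g = 0) -> W 0 = 0 -> W 1 = 0.
Proof.
move=> dW cw orth W0.
have := orth _ (cst_spline p 1); rewrite /ip -/(Int _).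
rewrite -(Int_eqc sP cw); last by move=> i si x xi; rewrite mulr1.
by rewrite (PD_Int sP cw dW) W0 subr0.
Qed.

Lemma step_fun i : (i < size s)%N -> exists2 chi, X 0 chi &
  forall j x, (j < size s)%N -> x \in `]nd j, nd j.+1[ -> chi x = (j == i)%:R.
Proof.
move=> si; pose chi x : R := if x \in `]nd i, nd i.+1[ then 1 else 0.
have H j x : (j < size s)%N -> x \in `]nd j, nd j.+1[ -> chi x = (j == i)%:R.
  move=> sj xj; rewrite /chi; have [ji|ji] := eqVneq j i; first by rewrite -ji xj.
  case: ifPn => // xi.
  have jj := subset_itv_oo_cc xi.
  have y0 : (nd j + x) / 2 \in `]nd j, nd j.+1[.
    by move: xj; rewrite !in_itv/=; lra.
  have := clamp_other_cell sP si sj ji xj y0; rewrite clamp_id//.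
  move: xj xi y0; rewrite /clamp !in_itv/= => xj xi y0.
  have h := node_lt sP si.
  by case: (leP ((nd j + x) / 2) (nd i.+1)) => ?; case: leP => ? ?; lra.
exists chi => // j sj; exists ((j == i)%:R)%:P; split; first exact: size_polyC_leq1.
by move=> x xj; rewrite hornerC; exact: H.
Qed.

(** Testing with the indicator of a cell shows that w has mean zero there, so W takes the same value
    at consecutive nodes. The primitive of w times the indicator is W composed with the clamp to
    that cell. *)
Lemma orth0_node W w i : PD W w -> PC w -> (forall g, X 0 g -> ip w g = 0) -> W 0 = 0 ->
  (i < size s)%N -> W (nd i) = 0.
Proof.
move=> dW cw orth W0.
have H j : (j < size s)%N -> W (nd j.+1) = W (nd j).
  move=> sj; have [chi Xc chiE] := step_fun sj.
  have cc := spline_PC Xc.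
  have jj := node_lt sP sj.
  pose F x := W (clamp (nd j) (nd j.+1) x).
  have sub : {within `[nd j, nd j.+1], continuous W}.
    by move: dW.1; apply: continuous_subspaceW => z; exact: ccell01.
  have dF : PD F (fun x => w x * chi x).
    split; first by apply: continuous_within; exact: within_clamp (ltW jj) sub.
    move=> k x sk xk; rewrite (chiE k)//; have [kj|kj] := eqVneq k j.
      rewrite mulr1; apply: near_eq_is_derive (dW.2 k x sk xk).
      near=> y; rewrite /F clamp_id//; apply: subset_itv_oo_cc; rewrite -kj.
      by near: y; exact: near_itvoo.
    rewrite mulr0; apply: near_eq_is_derive (is_derive_cst (F x) x 1).
    near=> y; rewrite /F /=; congr W; apply: (clamp_other_cell sP sj sk kj xk).
    by near: y; exact: near_itvoo.
  have := PD_Int sP (PCM cw cc) dF; rewrite -[LHS]/(ip w chi) orth// /F.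
  rewrite (clamp_gt (ltW jj) (node_le1 sP sj)) (clamp_lt (ltW jj) (node_ge0 sP (ltnW sj))).
  by move/esym/eqP; rewrite subr_eq0 => /eqP.
elim: i => [|i IH] si; first by rewrite node0.
by rewrite H ?IH//; exact: ltnW.
Unshelve. all: by end_near. Qed.

(** Duality arguments bound the square of a quantity by a multiple of the quantity itself; this
    divides it out. *)
Lemma le_of_sqr (u a b : R) : 0 <= u -> 0 <= a -> 0 <= b -> u ^+ 2 <= a * (b * u) -> u <= a * b.
Proof.
rewrite le_eqVlt => /predU1P[<-|u0] a0 b0; first by rewrite mulr_ge0.
by rewrite mulrA expr2 ler_pM2r.
Qed.

Local Notation M := ((2 * mesh s) ^+ 2).
Let M0 : 0 <= M. Proof. exact: sqr_ge0. Qed.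

(* Duality: |Kw|^2 = -(w, KKw - Kg) for any g in X p, K being integration from
   0, so the bound for X p passes on to X p.+1. *)
Lemma spline_poincare p W w : PD W w -> PC w -> (forall g, X p g -> ip w g = 0) -> W 0 = 0 ->
  ip W W <= M * ip w w.
Proof.
elim: p W w => [|p IH] W w dW cw orth W0.
  by apply: poincare => // i si; exact: (orth0_node dW cw orth W0 si).
have W1 := orth_end dW cw orth W0.
have cW := PD_PC sP dW.
have [g Xg og] := spline_proj p cW.
have cg := spline_PC Xg.
have [Z dZ Z0] := PC_antider sP cW; have [G dG G0] := PC_antider sP cg.
have XG : X p.+1 G by exists g.
have cG := spline_PC XG; have cZ := PD_PC sP dZ.
have E1 : ip W W = - ip w (fun x => Z x - G x).
  have -> : ip w (fun x => Z x - G x) = ip w Z - ip w G.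
    have cZG : PC (fun x => Z x - G x) by exact: PCB.
    by rewrite (sip_sym Si cw cZG) (sipB Si cZ cG cw) (sip_sym Si cZ cw) (sip_sym Si cG cw).
  by rewrite (orth _ XG) subr0 (ibp dW dZ cw cW) ?opprK// W0 W1 !mul0r.
have ce : PC (fun x => W x - g x) by exact: PCB.
(* The induction hypothesis bounds |Z - G|^2 by M |W - g|^2, and |W - g| <= |W| follows by comparing
   the projection g with the spline 0. *)
have I1 := IH _ _ (PDB dZ dG) ce og; rewrite Z0 G0 subrr in I1.
have {}I1 := I1 erefl.
have I2 := orth_best Si (@sub_spline p) (@spline_PC p) cW Xg og (@sub_spline p).1.
have W00 : (fun x => W x - 0) = W by apply/funext => x; rewrite subr0.
rewrite W00 in I2.
have CS := cauchy_schwarz Si cw (PCB cZ cG).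
rewrite [X in _ <= X]mulrC; apply: le_of_sqr; [exact: (sip_ge0 Si)|exact: (sip_ge0 Si)|exact: M0|].
rewrite E1 sqrrN; apply: le_trans CS _; rewrite ler_wpM2l ?(sip_ge0 Si)//.
by apply: le_trans I1 _; rewrite -E1 ler_wpM2l.
Qed.

(** Each derivative gains one factor M. Let v' be approximated by g1, let G be a primitive of g1 and
    W one of v - g. Orthogonality and integration by parts give |v - g|^2 = - (W, v' - g1), while
    |W|^2 <= M |v - g|^2 by [spline_poincare]. In the base case g1 is replaced by 0. *)
Lemma spline_approx p (vs : nat -> R -> R) :
  (forall j, (j <= p)%N -> PD (vs j) (vs j.+1)) -> PC (vs p.+1) ->
  exists g, [/\ X p g, forall w, X p w -> ip (fun x => vs 0%N x - g x) w = 0 &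
    ip (fun x => vs 0%N x - g x) (fun x => vs 0%N x - g x) <= M ^+ p.+1 * ip (vs p.+1) (vs p.+1)].
Proof.
elim: p vs => [|p IH] vs dv cv.
  have c0 := PD_PC sP (dv 0%N isT).
  have [g Xg og] := spline_proj 0 c0; exists g; split=> //.
  have cg := spline_PC Xg; have cw := PCB c0 cg.
  have [W dW W0] := PC_antider sP cw.
  have W1 := orth_end dW cw og W0; have cW := PD_PC sP dW.
  have E : ip (fun x => vs 0%N x - g x) (fun x => vs 0%N x - g x) = - ip W (vs 1%N).
    rewrite {2}(_ : (fun x => vs 0%N x - g x) = (fun x => vs 0%N x + -1 * g x)); last first.
      by apply/funext => x; rewrite mulN1r.
    have cg' : PC (fun x => -1 * g x) by exact: PCZ.
    rewrite (sip_sym Si cw (PCD c0 cg')) (sipD Si c0 cg' cw) (sipZ Si _ cg cw).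
    rewrite (sip_sym Si cg cw) og// mulr0 addr0 (sip_sym Si c0 cw).
    by rewrite (ibp dW (dv 0%N isT) cw cv)// W0 W1 !mul0r.
  rewrite expr1 [X in _ <= X]mulrC.
  apply: le_of_sqr; [exact: (sip_ge0 Si)|exact: (sip_ge0 Si)|exact: M0|].
  rewrite {1}E sqrrN mulrC; apply: le_trans (cauchy_schwarz Si cW cv) _.
  by rewrite ler_wpM2r ?(sip_ge0 Si)//; exact: (spline_poincare dW cw og W0).
have c0 := PD_PC sP (dv 0%N isT).
have [g1 [Xg1 og1 I1]] := IH (fun j => vs j.+1) (fun j jp => dv j.+1 jp) cv.
have cg1 := spline_PC Xg1.
have [G dG G0] := PC_antider sP cg1.
have XG : X p.+1 G by exists g1.
have [g Xg og] := spline_proj p.+1 c0; exists g; split=> //.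
have cg := spline_PC Xg; have cw := PCB c0 cg; have cG := spline_PC XG.
have [W dW W0] := PC_antider sP cw.
have W1 := orth_end dW cw og W0; have cW := PD_PC sP dW.
have c1 := PD_PC sP (dv 1%N isT).
have E : ip (fun x => vs 0%N x - g x) (fun x => vs 0%N x - g x) =
    - ip W (fun x => vs 1%N x - g1 x).
  (* In the second factor g may be exchanged for G, since both belong to the space to which v - g is
     orthogonal. *)
  rewrite -[RHS](_ : ip (fun x => vs 0%N x - g x) (fun x => vs 0%N x - G x) = _); last first.
    rewrite (ibp dW (PDB (dv 0%N isT) dG) cw (PCB c1 cg1)) ?opprK// W0 W1 !mul0r//.
  have H z : PC z -> ip (fun x => vs 0%N x - g x) (fun x => vs 0%N x - z x) =
     ip (fun x => vs 0%N x - g x) (vs 0%N) - ip (fun x => vs 0%N x - g x) z.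
    by move=> cz; rewrite (sip_sym Si cw (PCB c0 cz)) (sipB Si c0 cz cw) (sip_sym Si c0 cw) (sip_sym Si cz cw).
  by rewrite (H g cg) (H G cG) (og g Xg) (og G XG).
rewrite exprS -mulrA.
apply: (@le_trans _ _ (M * ip (fun x => vs 1%N x - g1 x) (fun x => vs 1%N x - g1 x))); last first.
  by rewrite ler_wpM2l.
rewrite [X in _ <= X]mulrC.
apply: le_of_sqr; [exact: (sip_ge0 Si)|exact: (sip_ge0 Si (PCB c1 cg1))|exact: M0|].
rewrite {1}E sqrrN mulrC; apply: le_trans (cauchy_schwarz Si cW (PCB c1 cg1)) _.
rewrite ler_wpM2r ?(sip_ge0 Si (PCB c1 cg1))//.
exact: (spline_poincare dW cw og W0).
Qed.

Lemma spline_C_on p v : X p.+1 v -> C_on `[0, 1] p v.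
Proof.
elim: p v => [|p IH] v [g Xg dv]; first by split=> //; exact: dv.1.
have cg := IH g Xg.
apply: (C_on_cons dv.1 _ cg) => x xI; apply: (PD_has_deriv _ dv) => //.
exact: C_on_cont cg.
Qed.

(** Splines of degree r - 1 are of class C^(r-2) and so belong to S_h for every admissible k: one
    construction serves all of them. *)
Lemma spline_Sh r k : (2 <= r)%N -> (k <= r - 2)%N -> X (r - 1) `<=` Sh r k s.
Proof.
case: r => [|[|r]]// _; rewrite !subSS !subn0 => kr v Xv; split.
  by apply: C_on_le kr _; exact: spline_C_on.
move=> i si; have [p [sp vp]] := spline_PP Xv si.
exists p; split=> // x xi; apply: (@oo_cc_eq R (nd i) (nd i.+1) v (horner p)) => //.
- exact: node_lt.
- have cv := C_on_cont (spline_C_on Xv).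
  by apply: continuous_subspaceW cv => z; exact: ccell01.
- by apply: continuous_within; exact: continuous_horner.
Qed.

Lemma sub_Sh r k : subspace_fun (Sh r k s).
Proof.
split.
  split=> [|i si]; first exact: C_on0.
  by exists 0; rewrite size_poly0; split=> // x _; rewrite horner0.
move=> c f g [cf Pf] [cg Pg]; split=> [|i si]; first exact: C_on_lin.
have [p [sp fp]] := Pf i si; have [q [sq fq]] := Pg i si.
exists (c *: p + q); split.
  rewrite (leq_trans (size_polyD _ _))// geq_max sq andbT.
  exact: leq_trans (size_scale_leq _ _) sp.
by move=> x xi; rewrite hornerD hornerZ fp// fq.
Qed.

Lemma sub_Sh0 r k : subspace_fun (Sh0 r k s).
Proof.
have [S0 SL] := sub_Sh r k; split; first by split.
move=> c f g [Sf f0 f1] [Sg g0 g1]; split; first exact: SL.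
  by rewrite f0 g0 mulr0 addr0.
by rewrite f1 g1 mulr0 addr0.
Qed.

Lemma Sh_PP r k : Sh r k s `<=` PP s r.
Proof.
move=> f [_ Pf] i si; have [p [sp fp]] := Pf i si; exists p; split=> // x xi.
by apply: fp; exact: subset_itv_oo_cc.
Qed.

Lemma Sh_PC1 r k : Sh r k s `<=` PC1.
Proof.
move=> f Sf; have [cf Pf] := Sf.
have D i : (i < size s)%N -> exists2 p : {poly R}, forall x, x \in `]nd i, nd i.+1[ -> f x = p.[x] &
    forall x, x \in `]nd i, nd i.+1[ -> is_derive x 1 f (p^`()).[x].
  move=> si; have [p [_ fp]] := Sh_PP Sf si; exists p => // x xi.
  apply: (@near_eq_is_derive _ _ _ (horner p)).
    by near=> y; rewrite fp//; near: y; exact: near_itvoo.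
split.
  split; first exact: C_on_cont cf.
  by move=> i x si xi; have [p _ dp] := D i si; rewrite (is_derive_derive1 (dp x xi)); exact: dp.
move=> i si; have [p _ dp] := D i si; exists (horner p^`()); first exact: continuous_horner.
by move=> x xi; rewrite (is_derive_derive1 (dp x xi)).
Unshelve. all: by end_near. Qed.

Lemma Sh_cont r k f : Sh r k s f -> {within `[0, 1], continuous f}.
Proof. by move=> [/C_on_cont]. Qed.

(** Q' is the L^2 projection of v' onto splines of degree r - 2. As v' - Q' has mean zero, the value
    at 1 is exact as soon as the one at 0 is; hence functions vanishing at both ends get an
    interpolant in S_{h,0}. The last bound is [spline_poincare] for the primitive v - Q of v' -
    Q'. *)
Lemma quasi_interpolation r k (vs : nat -> R -> R) : (2 <= r)%N -> (k <= r - 2)%N ->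
  (forall j, (j < r)%N -> PD (vs j) (vs j.+1)) -> PC (vs r) ->
  exists Q, [/\ Sh r k s Q, Q 0 = vs 0%N 0 & Q 1 = vs 0%N 1] /\
    ip (fun x => vs 1%N x - derive1 Q x) (fun x => vs 1%N x - derive1 Q x) <=
      M ^+ (r - 1) * ip (vs r) (vs r) /\
    ip (fun x => vs 0%N x - Q x) (fun x => vs 0%N x - Q x) <=
      M * ip (fun x => vs 1%N x - derive1 Q x) (fun x => vs 1%N x - derive1 Q x).
Proof.
case: r => [|[|r]]// _; rewrite !subSS !subn0 => kr dv cv.
have [q [Xq oq Iq]] := @spline_approx r (fun j => vs j.+1) (fun j jr => dv j.+1 jr) cv.
have cq := spline_PC Xq.
have [Q0 dQ0 Q00] := PC_antider sP cq.
pose Q x := vs 0%N 0 + Q0 x.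
have dQ : PD Q q by apply: PD_eqc (PDD (PD_cst s (vs 0%N 0)) dQ0) => i si x xi; rewrite add0r.
have XQ : X r.+1 Q by exists q.
have c1 : PC (vs 1%N) := PD_PC sP (dv 1%N isT).
have d0 := dv 0%N isT.
have dW := PDB d0 dQ.
have W0 : vs 0%N 0 - Q 0 = 0 by rewrite /Q Q00; lra.
have W1 := orth_end dW (PCB c1 cq) oq W0.
have qQ : eqc q (derive1 Q) by move=> i si x xi; rewrite (PD_derive1 dQ si xi).
have e1 : ip (fun x => vs 1%N x - derive1 Q x) (fun x => vs 1%N x - derive1 Q x) =
    ip (fun x => vs 1%N x - q x) (fun x => vs 1%N x - q x).
  have e : eqc (fun x => vs 1%N x - q x) (fun x => vs 1%N x - derive1 Q x).
    by move=> i si x xi; rewrite (qQ i si).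
  by rewrite (ip_eqc sP (PCB c1 cq) (PCB c1 cq) e e).
exists Q; split; first split.
- by apply: (@spline_Sh r.+2 k); rewrite ?subSS ?subn0.
- by move: W0; lra.
- by move: W1; lra.
by rewrite e1; split => //; exact: (spline_poincare dW (PCB c1 cq) oq W0).
Qed.

End Splines.

(** * Inverse inequality *)

Section InverseInequality.
Context {R : realType}.
Implicit Types (f g h v w : R -> R) (a b c x y : R) (p q : {poly R}).

Lemma within_bounded a b f : {within `[a, b], continuous f} ->
  exists2 M, 0 <= M & forall x, x \in `[a, b] -> `|f x| <= M.
Proof.
move=> cf; have /compact_bounded[N [_ NM]] := continuous_compact cf (@segment_compact R a b).
exists (Num.max 0 (N + 1)); first by rewrite le_max lexx.
move=> x xab; apply: (NM (Num.max 0 (N + 1))); last by exists x.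
by rewrite lt_max [X in _ || X]ltrDl ltr01 orbT.
Qed.

Lemma poly_eq0_itv p : (forall x, x \in `[0, 1] -> p.[x] = 0) -> p = 0.
Proof.
move=> p0; apply/eqP; apply: contraT => pn0.
pose rs := [seq (i.+1%:R : R)^-1 | i <- iota 0 (size p)].
have : (size rs < size p)%N.
  apply: max_poly_roots => //.
    apply/allP => x /mapP[i _ ->]; rewrite /root p0// in_itv/= invr_ge0 ler0n/=.
    by rewrite invf_le1 ?ltr0n// ler1n.
  rewrite map_inj_uniq ?iota_uniq// => i j /invr_inj/eqP; rewrite eqr_nat => /eqP[].
  by [].
by rewrite size_map size_iota ltnn.
Qed.

Lemma sqr_sum_le n (a b : 'I_n -> R) (A C : R) : \sum_(i < n) a i ^+ 2 = A ->
  (forall i, `|b i| <= C) -> (\sum_(i < n) a i * b i) ^+ 2 <= (C * n%:R) ^+ 2 * A.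
Proof.
move=> EA bC.
have A0 : 0 <= A by rewrite -EA sumr_ge0// => i _; exact: sqr_ge0.
have aA i : `|a i| <= Num.sqrt A.
  rewrite -sqrtr_sqr ler_wsqrtr// -EA (bigD1 i)//= lerDl sumr_ge0// => j _; exact: sqr_ge0.
have : `|\sum_(i < n) a i * b i| <= \sum_(i < n) (Num.sqrt A * C).
  apply: le_trans (ler_norm_sum _ _ _) _; apply: ler_sum => i _.
  by rewrite normrM ler_pM.
rewrite sumr_const card_ord -[X in _ <= X]mulr_natr => H.
rewrite -real_normK ?num_real//; apply: (@le_trans _ _ ((Num.sqrt A * C * n%:R) ^+ 2)).
  by rewrite lerXn2r ?nnegrE//; apply: le_trans H.
by rewrite -(mulrA (Num.sqrt A)) exprMn sqr_sqrtr// mulrC.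
Qed.

Local Notation s0 := [:: (1 : R)].
Let s0P : itv_partition 0 1 s0. Proof. exact: itv_partition1 ltr01. Qed.

(** Equivalence of norms on a finite-dimensional space: p is expanded in an L^2-orthonormal basis,
    and the finitely many basis polynomials and their derivatives are bounded on [0, 1]. The
    reference interval is treated as the partition [s0] with a single cell. *)
Lemma poly_inverse r : exists2 C, 0 <= C & forall p, (size p <= r)%N -> forall y, y \in `[0, 1] ->
  p.[y] ^+ 2 <= C * ip (horner p) (horner p) /\ (p^`()).[y] ^+ 2 <= C * ip (horner p) (horner p).
Proof.
pose V : set (R -> R) := [set f | exists2 p : {poly R}, (size p <= r)%N & f = horner p].
have VV : subspace_fun V.
  split; first by exists 0; rewrite ?size_poly0//; apply/funext => x; rewrite horner0.
  move=> c _ _ [p sp ->] [q sq ->]; exists (c *: p + q).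
    rewrite (leq_trans (size_polyD _ _))// geq_max sq andbT.
    exact: leq_trans (size_scale_leq _ _) sp.
  by apply/funext => x; rewrite hornerD hornerZ.
have VPC : V `<=` PC s0 by move=> _ [p _ ->]; apply: PC_continuous; exact: continuous_horner.
have VPP : V `<=` PP s0 r by move=> _ [p sp ->] i _; exists p.
have Si := sip_ip s0P.
have [n [phi [on sp]]] : exists n phi, ortho_family (@ip R) V n phi /\ spanning (@ip R) V n phi.
  apply: (PP_basis (r := r) Si VV VPC VPP) => f Vf f0.
  rewrite (ip_eqc s0P (VPC _ Vf) (VPC _ Vf) f0 f0) (sip0 Si)//; exact: PC_cst.
have H (i : 'I_n) : exists q, phi i = horner q.
  by have [q _ ->] := on.1 i (ltn_ord i); exists q.
pose Q i := sval (cid (H i)).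
have QE i : phi (nat_of_ord i) = horner (Q i) by exact: (svalP (cid (H i))).
have B q : exists2 M, 0 <= M & forall x, x \in `[0, 1] -> `|q.[x]| <= M.
  by apply: within_bounded; apply: continuous_within; exact: continuous_horner.
have [C C0 CP] : exists2 C, 0 <= C & forall (i : 'I_n) x, x \in `[0, 1] ->
    `|(Q i).[x]| <= C /\ `|(Q i)^`().[x]| <= C.
  pose F i := sval (cid2 (B (Q i))) + sval (cid2 (B (Q i)^`())).
  have F1 i : 0 <= sval (cid2 (B (Q i))) by case: cid2.
  have F2 i : 0 <= sval (cid2 (B (Q i)^`())) by case: cid2.
  exists (\sum_(i < n) F i); first by apply: sumr_ge0 => i _; rewrite addr_ge0.
  move=> i x xI; have Fi : F i <= \sum_(i < n) F i.
    by rewrite (bigD1 i)//= lerDl sumr_ge0// => j _; rewrite addr_ge0.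
  split; apply: le_trans Fi; rewrite /F.
    apply: (@le_trans _ _ (sval (cid2 (B (Q i))))); last by rewrite lerDl.
    by case: cid2 => /= m _; apply.
  apply: (@le_trans _ _ (sval (cid2 (B (Q i)^`())))); last by rewrite lerDr.
  by case: cid2 => /= m _; apply.
exists ((C * n%:R) ^+ 2); first exact: sqr_ge0.
move=> p szp y yI; have Vp : V (horner p) by exists p.
pose a (i : 'I_n) := ip (horner p) (phi i).
pose P := \sum_(i < n) a i *: Q i.
have PE x : P.[x] = ortho_proj (@ip R) n phi (horner p) x.
  rewrite /P horner_sum /ortho_proj; apply: eq_bigr => i _.
  by rewrite hornerZ -[(Q i).[x]]/(horner (Q i) x) -QE.
(* [spanning] only says that the residual is null; being a polynomial, it then vanishes on [0, 1]
   and therefore identically. The identity of polynomials is what allows the expansion to be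
   differentiated. *)
have pP : p = P.
  apply/eqP; rewrite -subr_eq0; apply/eqP; apply: poly_eq0_itv.
  have cd : PC s0 (fun x => p.[x] - ortho_proj (@ip R) n phi (horner p) x).
    by apply: PCB; [exact: VPC|apply: VPC; exact: (proj_V (V := V) VV)].
  have := sp _ Vp => /(Int_eq0 s0P (PCM cd cd)) E.
  have {}E : eqc s0 (fun x => (p - P).[x]) (fun=> 0).
    move=> i si x xi; have := E (fun _ _ _ _ => sqr_ge0 _) i si x xi => /eqP.
    by rewrite mulf_eq0 orbb hornerD hornerN PE => /eqP.
  apply: (eqc_within s0P) E; last exact: within_cst.
  by apply: continuous_within; exact: continuous_horner.
have nP : \sum_(i < n) a i ^+ 2 = ip (horner p) (horner p).
  rewrite -(comb_norm Si VV VPC (fun i => ip (horner p) (phi i)) on).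
  have -> : (fun x => \sum_(i < n) ip (horner p) (phi i) * phi i x) = horner p => //.
  by apply/funext => x; rewrite [in RHS]pP PE.
split.
  have -> : p.[y] = \sum_(i < n) a i * (Q i).[y].
    by rewrite {1}pP horner_sum; apply: eq_bigr => i _; rewrite hornerZ.
  by apply: sqr_sum_le => // i; have [] := CP i y yI.
have -> : (p^`()).[y] = \sum_(i < n) a i * ((Q i)^`()).[y].
  by rewrite {1}pP linear_sum horner_sum; apply: eq_bigr => i _; rewrite /= derivZ hornerZ.
by apply: sqr_sum_le => // i; have [] := CP i y yI.
Qed.

(** Change of variables to the reference cell, read off a primitive A of p^2. Expressing the result
    by increments of A lets the cells be summed by telescoping later. *)
Lemma scaled_poly_norm (s : seq R) p (A : R -> R) i : itv_partition 0 1 s -> (i < size s)%N ->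
  {within `[0, 1], continuous A} ->
  (forall x, x \in `]node s i, node s i.+1[ -> is_derive x 1 A (p.[x] * p.[x])) ->
  let q := p \Po (cell_length s i *: 'X + (node s i)%:P) in
  ip (horner q) (horner q) = (A (node s i.+1) - A (node s i)) / cell_length s i.
Proof.
move=> sP si cA dA; set a := node s i; set b := node s i.+1; set l := cell_length s i => q.
have l0 : 0 < l := cell_length_gt0 sP si.
have bE : b = a + l by rewrite /l /cell_length -/a -/b; ring.
pose L y := l * y + a.
pose G y := l^-1 * A (L y).
have LI y : y \in `[0, 1] -> L y \in `[a, b].
  rewrite !in_itv/= bE /L => /andP[y0 y1].
  by rewrite lerDr mulr_ge0 ?(ltW l0)//= addrC lerD2l ler_piMr// ltW.
have Lo y : y \in `]0, 1[ -> L y \in `]a, b[.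
  rewrite !in_itv/= bE /L => /andP[y0 y1].
  by rewrite ltrDr mulr_gt0//= addrC ltrD2l gtr_pMr.
have qE y : q.[y] = p.[L y].
  by rewrite /q horner_comp !hornerE.
have dL y : is_derive y 1 L l.
  by apply: is_derive_eq; rewrite /GRing.scale/= addr0 mulr1.
have dG : PD s0 G (fun y => q.[y] * q.[y]).
  split.
    apply: withinZ.
    have cc := within_clamp (ltW (node_lt sP si)) (continuous_subspaceW (fun z => ccell01 sP si) cA).
    have : {within `[0, 1], continuous (fun y => (A \o clamp a b) (L y))}.
      apply: continuous_within => y.
      apply: (@continuous_comp _ _ _ L (A \o clamp a b)); last exact: cc.
      by apply: cvgD; [apply: cvgM; [exact: cvg_cst|exact: cvg_id]|exact: cvg_cst].
    apply: subspace_eq_continuous => y; rewrite inE/= => yI.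
    by change (A (clamp a b (L y)) = A (L y)); rewrite (clamp_id (LI y yI)).
  move=> j y; rewrite /= ltnS leqn0 => /eqP-> yI.
  have d1 := dA _ (Lo y yI).
  have d2 : is_derive y 1 (A \o L) (p.[L y] * p.[L y] * l).
    exact: is_derive1_comp.
  apply: is_derive_eq; rewrite /GRing.scale/= -qE; field.
  by rewrite gt_eqF.
have cq : PC s0 (horner q) by apply: PC_continuous; exact: continuous_horner.
rewrite /ip -/(Int _) (PD_Int s0P (PCM cq cq) dG) /G /L mulr1 mulr0 add0r -/a.
by rewrite (addrC l) -bE; field; rewrite gt_eqF.
Qed.

(** Scaling a cell of length l to [0, 1] costs a factor 1 / l in v^2 and two more in the square of
    v'; quasiuniformity bounds 1 / l by qu0 / h. The first bound needs one cell only, the second is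
    summed over all cells. *)
Lemma inverse_inequality r : exists2 C, 0 <= C &
  forall (s : seq R) (qu0 : R) v, itv_partition 0 1 s -> quasiuniform qu0 s -> PP s r v -> PC1 s v ->
   (forall i x, (i < size s)%N -> x \in `]node s i, node s i.+1[ ->
      v x ^+ 2 <= C * qu0 / mesh s * ip v v) /\
   ip (derive1 v) (derive1 v) <= C * qu0 ^+ 2 / mesh s ^+ 2 * ip v v.
Proof.
have [C C0 CP] := poly_inverse r; exists C => // s qu0 v sP qu Pv Cv.
have cv := PC1_PC sP Cv.
have [A dA A0] := PC_antider sP (PCM cv cv).
have h0 := mesh_gt0 sP.
have Ev : ip v v = A 1 - A 0 by exact: (PD_Int sP (PCM cv cv) dA).
have L i : (i < size s)%N -> exists2 p, (forall x, x \in `]node s i, node s i.+1[ -> v x = p.[x]) &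
   forall x, x \in `]node s i, node s i.+1[ ->
     p.[x] ^+ 2 <= C * ((A (node s i.+1) - A (node s i)) / cell_length s i) /\
     (cell_length s i * (p^`()).[x]) ^+ 2 <= C * ((A (node s i.+1) - A (node s i)) / cell_length s i).
  move=> si; have [p [sp vp]] := Pv i si; exists p => // x xi.
  have l0 := cell_length_gt0 sP si; set l := cell_length s i in l0 *.
  pose a := node s i; pose y := (x - a) / l.
  have yI : y \in `[0, 1].
    move: xi; rewrite !in_itv/= => /andP[x1 x2]; rewrite /y divr_ge0 ?(ltW l0) ?subr_ge0 ?(ltW x1)//=.
    by rewrite ler_pdivrMr// mul1r /l /cell_length lerD2r ltW.
  have yx : l * y + a = x by rewrite /y; field; rewrite gt_eqF.
  have dA' z : z \in `]node s i, node s i.+1[ -> is_derive z 1 A (p.[z] * p.[z]).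
    by move=> zi; rewrite -vp//; exact: (dA.2 i).
  have := @scaled_poly_norm s p A i sP si dA.1 dA'; rewrite -/l -/a => /= E.
  rewrite -E; set q := p \Po _.
  have sq : (size q <= r)%N.
    rewrite /q; apply: leq_trans sp; have [->|p0] := eqVneq p 0; first by rewrite comp_poly0 size_poly0.
    have : (size q).-1 = ((size p).-1 * (size (l *: 'X + a%:P : {poly R})%R).-1)%N by rewrite size_comp_poly.
    rewrite size_addl ?size_scale ?size_polyX ?(leq_ltn_trans (size_polyC_leq1 _))// ?gt_eqF//.
    rewrite muln1; have : (0 < size p)%N by rewrite size_poly_gt0.
    by rewrite -/q; move: (size q) (size p) => m n; lia.
  have Ly : (l *: 'X + a%:P : {poly R}).[y] = x by rewrite hornerD hornerZ hornerX hornerC.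
  have qy : q.[y] = p.[x] by rewrite /q horner_comp Ly.
  have qy' : (q^`()).[y] = l * (p^`()).[x].
    rewrite /q deriv_comp hornerM horner_comp Ly derivD derivZ derivX derivC addr0.
    by rewrite hornerZ hornerC mulr1 mulrC.
  have [h1 h2] := CP q sq y yI.
  by rewrite -qy -qy'.
have dA0 i : (i < size s)%N -> 0 <= A (node s i.+1) - A (node s i).
  move=> si; rewrite subr_ge0; apply: (PD_ndecr sP dA).
  - by move=> j x _ _; rewrite -expr2 sqr_ge0.
  - by apply: (ccell01 sP si); rewrite in_itv/= lexx ltW// node_lt.
  - by apply: (ccell01 sP si); rewrite in_itv/= lexx ltW// node_lt.
  - exact: ltW (node_lt sP si).
have qu0_gt0 : 0 < qu0.
  have := qu 0%N (size_gt0 sP); have := cell_length_gt0 sP (size_gt0 sP).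
  move: h0 => h0 l0 hl; have : 0 < qu0 * cell_length s 0 by apply: lt_le_trans hl.
  by rewrite pmulr_lgt0.
have il i : (i < size s)%N -> (cell_length s i)^-1 <= qu0 / mesh s.
  move=> si; rewrite ler_pdivlMr// mulrC ler_pdivrMr ?(cell_length_gt0 sP)//.
  exact: qu.
split.
  move=> i x si xi; have [p vp Lp] := L i si; rewrite vp//.
  apply: le_trans (Lp x xi).1 _.
  rewrite -!mulrA ler_wpM2l// Ev mulrC mulrA.
  apply: ler_pM => //; [by rewrite invr_ge0 ltW// cell_length_gt0|exact: dA0|exact: il|].
  have I0 := ccell01 sP si; have aI : node s i \in `[0, 1] by apply: I0; rewrite in_itv/= lexx ltW// node_lt.
  have bI : node s i.+1 \in `[0, 1] by apply: I0; rewrite in_itv/= lexx ltW// node_lt.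
  have nd := PD_ndecr sP dA (fun i x _ _ => eq_ind _ (fun z => 0 <= z) (sqr_ge0 (v x)) _ (expr2 (v x))).
  have := nd _ _ in01_0 aI; have := nd _ _ bI in01_1.
  rewrite (node_ge0 sP (ltnW si)) (node_le1 sP si) => /(_ isT) + /(_ isT).
  by lra.
have [G dG G0] := PC_antider sP (PCM Cv.2 Cv.2).
rewrite Ev [X in X <= _](PD_Int sP (PCM Cv.2 Cv.2) dG).
apply: (telescope_le sP) => i si.
have [p vp Lp] := L i si; have l0 := cell_length_gt0 sP si.
set l := cell_length s i in l0 Lp *; set D := A (node s i.+1) - A (node s i) in Lp *.
have D0 : 0 <= D := dA0 i si.
have il' : l^-1 <= qu0 / mesh s := il i si.
pose K := C * (D / l) / l ^+ 2.
have K0 : 0 <= K by rewrite /K !mulr_ge0 ?invr_ge0 ?sqr_ge0 ?(ltW l0).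
(* The increment of G over the cell is the square of v' at a single point z times the length, so
   that the pointwise bound suffices. *)
have [z zi Gz] := @MVT R G (fun x => derive1 v x * derive1 v x) _ _ (node_lt sP si)
   (fun x xi => dG.2 i x si xi) (continuous_subspaceW (fun z => ccell01 sP si) dG.1).
rewrite Gz -/(cell_length s i) -/l.
have -> : derive1 v z = (p^`()).[z].
  apply: is_derive_derive1; apply: (@near_eq_is_derive _ _ _ (horner p)).
  by near=> y; rewrite vp//; near: y; exact: near_itvoo.
have := (Lp z zi).2; rewrite exprMn => H.
have H2 : (p^`()).[z] * (p^`()).[z] <= C * (D / l) / l ^+ 2.
  by rewrite ler_pdivlMr ?exprn_gt0// -expr2 mulrC.
apply: (@le_trans _ _ (C * (D / l) / l ^+ 2 * l)); first by rewrite ler_wpM2r// ltW.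
have -> : C * (D / l) / l ^+ 2 * l = C * D * (l^-1) ^+ 2 by field; rewrite gt_eqF.
have -> : C * qu0 ^+ 2 / mesh s ^+ 2 * D = C * D * (qu0 / mesh s) ^+ 2 by field; rewrite gt_eqF.
rewrite ler_wpM2l ?mulr_ge0// lerXn2r ?nnegrE ?invr_ge0 ?(ltW l0)//.
by rewrite divr_ge0// ltW.
Unshelve. all: by end_near. Qed.

End InverseInequality.

(** * Picard iteration and damped quadratic systems *)

Section Curves.
Context {R : realType}.
Implicit Types (f g : R -> R) (a b c x t T D L K : R).

Lemma is_derive_fsum (J : Type) (r : seq J) (h : J -> R -> R) (dh : J -> R) x :
  (forall j, is_derive x 1 (h j) (dh j)) ->
  is_derive x 1 (fun x => \sum_(j <- r) h j x) (\sum_(j <- r) dh j).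
Proof.
move=> dd; elim: r => [|j r IH].
  rewrite big_nil (_ : (fun x => _) = cst 0); first exact: is_derive_cst.
  by apply/funext => y; rewrite big_nil.
rewrite big_cons (_ : (fun x => _) = (fun x => h j x + \sum_(j <- r) h j x)).
  by have := dd j => ?; apply: is_deriveD.
by apply/funext => y; rewrite big_cons.
Qed.

Lemma within_fsum (J : Type) (r : seq J) A (h : J -> R -> R) :
  (forall j, {within A, continuous (h j)}) -> {within A, continuous (fun x => \sum_(j <- r) h j x)}.
Proof.
move=> ch; apply/subspace_continuousP => x Ax.
by apply: cvg_fsum => j; have /subspace_continuousP := ch j; apply.
Qed.

(** B - f and B + f are nondecreasing. This replaces the usual estimates of integrals in the Picard
    iteration. *)
Lemma derive_le_bound T f df B dB : {within `[0, T], continuous f} -> {within `[0, T], continuous B} ->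
  (forall t, t \in `]0, T[ -> is_derive t 1 f (df t)) ->
  (forall t, t \in `]0, T[ -> is_derive t 1 B (dB t)) ->
  (forall t, t \in `]0, T[ -> `|df t| <= dB t) -> `|f 0| <= B 0 ->
  forall t, t \in `[0, T] -> `|f t| <= B t.
Proof.
move=> cf cB Df DB le f0 t tI.
have t0 : 0 <= t by move: tI; rewrite in_itv/= => /andP[].
have I0 : 0 \in `[0, T] by move: tI; rewrite !in_itv/= lexx => /andP[h1 h2]; rewrite (le_trans h1).
have h1 : (fun t => B t - f t) 0 <= (fun t => B t - f t) t.
  apply: (ndecr_cc (df := fun t => dB t - df t) (withinB cB cf) _ _ I0 tI t0) => s sI.
    by have := Df s sI; have := DB s sI => ? ?; exact: is_deriveB.
  by have := le s sI; rewrite ler_norml => /andP[_]; rewrite subr_ge0.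
have h2 : (fun t => B t + f t) 0 <= (fun t => B t + f t) t.
  apply: (ndecr_cc (df := fun t => dB t + df t) (withinD cB cf) _ _ I0 tI t0) => s sI.
    by have := Df s sI; have := DB s sI => ? ?; exact: is_deriveD.
  by have := le s sI; rewrite ler_norml => /andP[+ _]; rewrite -subr_ge0 opprK addrC.
by move: f0 h1 h2; rewrite /= !ler_norml; move: (f 0) (f t) (B 0) (B t) => *; lra.
Qed.

Lemma pow2_small c e : 0 <= c -> 0 < e -> exists n : nat, c / 2 ^+ n <= e.
Proof.
move=> c0 e0; have h := archi_boundP (divr_ge0 c0 (ltW e0)).
exists (Num.bound (c / e)); rewrite ler_pdivrMr ?exprn_gt0//.
rewrite mulrC -ler_pdivrMr// (le_trans (ltW h))// -natrX ler_nat.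
by rewrite ltnW// ltn_expl.
Qed.

Lemma derivable_for_continuous f x d : is_derive x 1 f d -> {for x, continuous f}.
Proof. by move=> [df _]; apply: differentiable_continuous; exact/derivable1_diffP. Qed.

Lemma for_within T f : (forall t, t \in `[0, T] -> {for t, continuous f}) ->
  {within `[0, T], continuous f}.
Proof.
move=> cf; apply/subspace_continuousP => x xI; apply: cvg_within_filter.
exact: cf.
Qed.

End Curves.

(** * Global existence for Lipschitz systems *)

Section Picard.
Context {R : realType} {I : finType}.
Implicit Types (t : R) (y z : R -> I -> R).
Variables (T L : R) (F : R -> (I -> R) -> I -> R) (y0 : I -> R).
Hypotheses (T0 : 0 < T) (L0 : 0 <= L).
Hypothesis lipF : forall t (x y : I -> R) (D : R), t \in `[0, T] -> (forall j, `|x j - y j| <= D) ->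
  forall i, `|F t x i - F t y i| <= L * D.
Let cont (y : R -> I -> R) := forall j t, t \in `[0, T] -> {for t, continuous (fun t => y t j)}.
Hypothesis contF : forall y, cont y -> cont (fun t => F t (y t)).

Lemma picard_step y : cont y -> exists z : R -> I -> R,
  (forall i t, t \in `[0, T] -> is_derive t 1 (fun t => z t i) (F t (y t) i)) /\ z 0 = y0.
Proof.
move=> cy; have H i : exists G : R -> R, (forall t, t \in `[0, T] -> is_derive t 1 G (F t (y t) i)) /\ G 0 = 0.
  by have [G dG G0] := antiderivative (ltW T0) (@contF y cy i); exists G.
exists (fun t i => sval (cid (H i)) t + y0 i); split=> [i t tT|].
  by case: cid => /= G [dG _]; have := dG t tT => ?; apply: is_derive_eq; rewrite addr0.
by apply/funext => i; case: cid => /= G [_ ->]; rewrite add0r.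
Qed.

Lemma picard_compare y1 y2 z1 z2 (e : R) :
  (forall i t, t \in `[0, T] -> is_derive t 1 (fun t => z1 t i) (F t (y1 t) i)) ->
  (forall i t, t \in `[0, T] -> is_derive t 1 (fun t => z2 t i) (F t (y2 t) i)) ->
  z1 0 = z2 0 -> (forall t j, t \in `[0, T] -> `|y1 t j - y2 t j| <= e) ->
  forall i t, t \in `[0, T] -> `|z1 t i - z2 t i| <= L * e * t.
Proof.
move=> d1 d2 z0 ye i; have ooc t : t \in `]0, T[ -> t \in `[0, T] by apply: subset_itv_oo_cc.
have c1 : {within `[0, T], continuous (fun t => z1 t i)}.
  by apply: for_within => t tT; exact: derivable_for_continuous (d1 i t tT).
have c2 : {within `[0, T], continuous (fun t => z2 t i)}.
  by apply: for_within => t tT; exact: derivable_for_continuous (d2 i t tT).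
have dB r : r \in `]0, T[ -> is_derive r 1 (fun t => L * e * t) (L * e).
  by move=> _; apply: is_derive_eq; rewrite /GRing.scale/= mulr1.
have cB : {within `[0, T], continuous (fun t => L * e * t)}.
  by apply: withinM; [exact: within_cst|apply: continuous_within => r; exact: cvg_id].
have df r : r \in `]0, T[ -> is_derive r 1 (fun t => z1 t i - z2 t i) (F r (y1 r) i - F r (y2 r) i).
  by move=> /ooc rT; have := d1 i r rT; have := d2 i r rT => ? ?; exact: is_deriveB.
apply: (derive_le_bound (withinB c1 c2) cB df dB).
  by move=> r /ooc rT; apply: lipF => // j; exact: ye.
by rewrite z0 subrr normr0 mulr0.
Qed.

(** In the weight exp (2 L t) each iteration halves the distance of consecutive iterates, so the
    iterates converge on all of [0, T], however large L T may be. *)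
Lemma picard : exists y : R -> I -> R,
  (forall i t, t \in `[0, T] -> is_derive t 1 (fun t => y t i) (F t (y t) i)) /\ y 0 = y0.
Proof.
have H y : exists z : R -> I -> R, cont y ->
    (forall i t, t \in `[0, T] -> is_derive t 1 (fun t => z t i) (F t (y t) i)) /\ z 0 = y0.
  have [cy|ncy] := pselect (cont y); first by have [z zP] := picard_step cy; exists z.
  by exists y => /ncy.
pose step y := sval (cid (H y)).
have stepP y : cont y -> (forall i t, t \in `[0, T] -> is_derive t 1 (fun t => step y t i) (F t (y t) i))
    /\ step y 0 = y0 by exact: (svalP (cid (H y))).
have stepc y : cont y -> cont (step y).
  by move=> cy j t tT; exact: derivable_for_continuous ((stepP y cy).1 j t tT).
pose Y n := iter n step (fun _ => y0).
have cY n : cont (Y n).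
  elim: n => [|n IH]; first by move=> j t _; exact: cvg_cst.
  exact: stepc.
have YS n : (forall i t, t \in `[0, T] -> is_derive t 1 (fun t => Y n.+1 t i) (F t (Y n t) i)) /\ Y n.+1 0 = y0.
  exact: stepP _ (cY n).
have Y00 n : Y n 0 = y0 by case: n => [//|n]; exact: (YS n).2.
clearbody Y; have cYw n i : {within `[0, T], continuous (fun t => Y n t i)}.
  by apply: for_within => t tT; exact: cY.
have [M M0 MP] : exists2 M, 0 <= M & forall i t, t \in `[0, T] -> `|Y 1%N t i - Y 0%N t i| <= M.
  have B i := within_bounded (withinB (cYw 1%N i) (cYw 0%N i)).
  exists (\sum_i sval (cid2 (B i))); first by apply: sumr_ge0 => i _; case: cid2.
  move=> i t tT; rewrite (bigD1 i)//=; apply: le_trans (_ : sval (cid2 (B i)) <= _).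
    by case: cid2 => /= m _; apply.
  by rewrite lerDl sumr_ge0// => j _; case: cid2.
(* With this rate the derivative of [Bd n.+1] is exactly L times [Bd n], the Lipschitz bound for the
   next difference. *)
pose K := 2 * L.
pose Bd (n : nat) (t : R) : R := M / 2 ^+ n * expR (K * t).
have dBd n t : is_derive t 1 (Bd n) (K * Bd n t).
  have h : is_derive t 1 (fun t : R => K * t) K by apply: is_derive_eq; rewrite /GRing.scale/= mulr1.
  apply: is_derive_eq; rewrite /Bd /GRing.scale/=; ring.
have cBd n : {within `[0, T], continuous (Bd n)}.
  by apply: for_within => t _; exact: derivable_for_continuous (dBd n t).
have Bd0 n t : 0 <= Bd n t by rewrite /Bd mulr_ge0 ?expR_ge0// divr_ge0.
have ooc t : t \in `]0, T[ -> t \in `[0, T] by apply: subset_itv_oo_cc.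
have dYn n i t : t \in `[0, T] -> `|Y n.+1 t i - Y n t i| <= Bd n t.
  elim: n i t => [|n IH] i t tT.
    apply: le_trans (MP i t tT) _; rewrite /Bd expr0 divr1 ler_peMr// -expR0 ler_expR mulr_ge0//.
      by rewrite mulr_ge0.
    by move: tT; rewrite in_itv/= => /andP[].
  apply: (derive_le_bound (df := fun t => F t (Y n.+1 t) i - F t (Y n t) i)
    (withinB (cYw n.+2 i) (cYw n.+1 i)) (cBd n.+1) _ (fun t _ => dBd n.+1 t) _ _ tT).
  - move=> r /ooc rT; have := (YS n.+1).1 i r rT; have := (YS n).1 i r rT => h1 h2.
    exact: is_deriveB.
  - move=> r /ooc rT; apply: le_trans (lipF rT (fun j => IH j r rT) i) _.
    have -> : K * Bd n.+1 r = L * Bd n r by rewrite /K /Bd exprS; field; rewrite expf_neq0.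
    by [].
  - by rewrite !Y00 subrr normr0; exact: Bd0.
pose C := 2 * M * expR (K * T).
have C0 : 0 <= C by rewrite /C !mulr_ge0// expR_ge0.
have Bdn n t : t \in `[0, T] -> Bd n t <= C / 2 ^+ n.+1.
  rewrite in_itv/= => /andP[t0 tT].
  have -> : C / 2 ^+ n.+1 = M / 2 ^+ n * expR (K * T) by rewrite /C exprS; field; rewrite expf_neq0.
  by rewrite /Bd ler_wpM2l ?divr_ge0// ler_expR ler_wpM2l// /K mulr_ge0.
have Ymn n m i t : t \in `[0, T] -> `|Y (n + m)%N t i - Y n t i| <= C / 2 ^+ n - C / 2 ^+ (n + m).
  move=> tT; elim: m => [|m IH]; first by rewrite addn0 !subrr normr0.
  rewrite addnS; have h := le_trans (dYn (n + m)%N i t tT) (Bdn _ t tT).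
  have e : C / 2 ^+ (n + m) = C / 2 ^+ (n + m).+1 + C / 2 ^+ (n + m).+1.
    by rewrite exprS; field; rewrite expf_neq0.
  have -> : Y (n + m).+1 t i - Y n t i = (Y (n + m).+1 t i - Y (n + m)%N t i) + (Y (n + m)%N t i - Y n t i) by ring.
  apply: le_trans (ler_normD _ _) _; move: IH h; rewrite e.
  move: (C / _) (C / _) => p q; lra.
have Ymn' n m i t : t \in `[0, T] -> `|Y (n + m)%N t i - Y n t i| <= C / 2 ^+ n.
  move=> tT; apply: le_trans (Ymn n m i t tT) _.
  by rewrite gerBl divr_ge0.
have lim_ex i t : exists l, t \in `[0, T] -> forall n, `|l - Y n t i| <= C / 2 ^+ n.
  have [tT|ntT] := boolP (t \in `[0, T]); last by exists 0.
  have cau : cauchy ((fun n => Y n t i) @ \oo).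
    apply/cauchy_ballP => e e0.
    have [n nP] := pow2_small C0 (divr_gt0 e0 (ltr0n _ 4) : 0 < e / 4).
    exists ([set x | exists2 k, (n <= k)%N & x = Y k t i], [set x | exists2 k, (n <= k)%N & x = Y k t i]) => /=.
      by split; exists n => // k nk; exists k.
    move=> [x x'] /= [[k nk ->] [k' nk' ->]].
    have h1 := Ymn' n (k - n)%N i t tT; have h2 := Ymn' n (k' - n)%N i t tT.
    rewrite subnKC// in h1; rewrite subnKC// in h2.
    rewrite /ball/=.
    have -> : Y k t i - Y k' t i = (Y k t i - Y n t i) - (Y k' t i - Y n t i) by ring.
    apply: le_lt_trans (ler_normB _ _) _; move: h1 h2 nP; move: (C / _) => q; lra.
  have /cvg_ex[/= l cl] : cvg ((fun n => Y n t i) @ \oo) by apply/cauchy_cvgP.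
  exists l => _ n; apply/ler_addgt0Pr => e e0.
  have /cvgrPdist_le/(_ e e0)[m _ mP] := cl.
  have h1 := mP (n + m)%N (leq_addl _ _); have h2 := Ymn' n m i t tT.
  have -> : l - Y n t i = (l - Y (n + m)%N t i) + (Y (n + m)%N t i - Y n t i) by ring.
  apply: le_trans (ler_normD _ _) _; move: h1 h2 => /=; move: (C / _) => q; lra.
(* Clamping the time extends the limit by constants and thus yields the two-sided continuity at 0
   and T that [picard_step] requires. *)
pose y t i := sval (cid (lim_ex i (clamp 0 T t))).
have yY i t n : t \in `[0, T] -> `|y t i - Y n t i| <= C / 2 ^+ n.
  by move=> tT; rewrite /y clamp_id//; case: cid => /= l; apply.
have cy0 i : {within `[0, T], continuous (fun t => y t i)}.
  apply/subspace_continuousP => t tT; apply/cvgrPdist_le => e e0.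
  have [n nP] := pow2_small C0 (divr_gt0 e0 (ltr0n _ 3) : 0 < e / 3).
  have /subspace_continuousP/(_ t tT)/cvgrPdist_le/(_ (e / 3) (divr_gt0 e0 (ltr0n _ 3))) := cYw n i.
  rewrite !near_withinE; apply: filterS => r rP rT.
  have h1 := yY i t n tT; have h2 := yY i r n rT; have h3 := rP rT.
  have -> : y t i - y r i = (y t i - Y n t i) + (Y n t i - Y n r i) - (y r i - Y n r i) by ring.
  apply: le_trans (ler_normB _ _) _; have := ler_normD (y t i - Y n t i) (Y n t i - Y n r i).
  by move: h1 h2 h3 nP; move: (C / _) => q; lra.
have cy : cont y.
  move=> i t tT; have := within_clamp (ltW T0) (cy0 i) (x := t).
  rewrite (_ : _ \o _ = fun t => y t i)//; apply/funext => r /=.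
  by rewrite /y clamp_id//; apply: clamp_in; exact: ltW.
have [z [dz z0]] := picard_step cy.
have cz i : {within `[0, T], continuous (fun t => z t i)}.
  by apply: for_within => t tT; exact: derivable_for_continuous (dz i t tT).
(* The iterate z of y stays as close to Y n.+1 as y does to Y n, up to the factor L T; letting n
   grow, z = y, and z is differentiable by construction. *)
have zy t : t \in `[0, T] -> z t = y t.
  move=> tT; apply/funext => i; apply/eqP; rewrite -subr_eq0 -normr_le0.
  apply/ler_addgt0Pr => e e0; rewrite add0r.
  have P1 : 0 < 1 + L * T by rewrite ltr_pwDl// mulr_ge0// ltW.
  have [n nP] := pow2_small C0 (divr_gt0 e0 P1).
  have h1 : `|Y n.+1 t i - z t i| <= L * (C / 2 ^+ n) * t.
    apply: (picard_compare (YS n).1 dz) => //; first by rewrite Y00 z0.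
    by move=> r j rT; rewrite distrC; exact: yY.
  have h2 := yY i t n.+1 tT.
  have -> : z t i - y t i = - (Y n.+1 t i - z t i) - (y t i - Y n.+1 t i) by ring.
  apply: le_trans (ler_normB _ _) _; rewrite normrN.
  have h3 : L * (C / 2 ^+ n) * t <= L * (C / 2 ^+ n) * T.
    by rewrite ler_wpM2l ?mulr_ge0 ?divr_ge0//; move: tT; rewrite in_itv/= => /andP[].
  have h4 : C / 2 ^+ n.+1 <= C / 2 ^+ n.
    by rewrite ler_wpM2l// lef_pV2 ?posrE ?exprn_gt0// ler_weXn2l// ler1n.
  have h5 : C / 2 ^+ n * (1 + L * T) <= e by rewrite -ler_pdivlMr.
  move: h1 h2 h3 h4 h5; move: (C / 2 ^+ n) (C / _) => p q; nra.
exists z; split=> // i t tT; rewrite zy//; exact: dz.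
Qed.

End Picard.

(** * Systems with quadratic nonlinearity *)

Section QuadraticODE.
Context {R : realType} {I : finType}.
Implicit Types (t D C : R) (x y z e : I -> R) (i j k : I).

Definition lip (g : (I -> R) -> R) C := forall x y D, (forall j, `|x j - y j| <= D) -> `|g x - g y| <= C * D.

Lemma lip_sum (g : I -> (I -> R) -> R) (C : I -> R) : (forall j, lip (g j) (C j)) ->
  lip (fun x => \sum_j g j x) (\sum_j C j).
Proof.
move=> lg x y D xy; rewrite -sumrB mulr_suml; apply: le_trans (ler_norm_sum _ _ _) _.
by apply: ler_sum => j _; exact: lg.
Qed.

Lemma lipD g1 g2 C1 C2 : lip g1 C1 -> lip g2 C2 -> lip (fun x => g1 x + g2 x) (C1 + C2).
Proof.
move=> l1 l2 x y D xy; rewrite mulrDl.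
have -> : g1 x + g2 x - (g1 y + g2 y) = (g1 x - g1 y) + (g2 x - g2 y) by ring.
by apply: le_trans (ler_normD _ _) _; apply: lerD; [exact: l1|exact: l2].
Qed.

Lemma lipZ c g C : lip g C -> lip (fun x => c * g x) (`|c| * C).
Proof.
by move=> l x y D xy; rewrite -mulrBr normrM -mulrA ler_wpM2l//; exact: l.
Qed.

Lemma lip_coord i : lip (fun x => x i) 1.
Proof. by move=> x y D xy; rewrite mul1r. Qed.

Definition sqn e : R := \sum_i e i ^+ 2.

Lemma sqn_ge0 e : 0 <= sqn e. Proof. by apply: sumr_ge0 => i _; exact: sqr_ge0. Qed.

Lemma coord_le_sqn e i : `|e i| <= Num.sqrt (sqn e).
Proof.
rewrite -sqrtr_sqr ler_wsqrtr// /sqn (bigD1 i)//= lerDl sumr_ge0// => j _; exact: sqr_ge0.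
Qed.

(** Equal to 1 while kappa |e|^2 <= 1 and decaying like 1 / |e|^2 beyond: just enough for damped
    quadratic terms to be globally Lipschitz, and for the bound [dampM], which the energy estimate
    exploits. *)
Definition damp kappa e : R := (Num.max 1 (kappa * sqn e))^-1.

Lemma damp_ge0 kappa e : 0 <= damp kappa e.
Proof. by rewrite invr_ge0 le_max ler01. Qed.

Lemma damp_le1 kappa e : damp kappa e <= 1.
Proof. by rewrite invf_le1 ?le_max ?lexx// lt_max ltr01. Qed.

Lemma dampM kappa e : damp kappa e * (kappa * sqn e) <= 1.
Proof.
rewrite /damp mulrC ler_pdivrMr ?lt_max ?ltr01// mul1r le_max lexx orbT//.
Qed.

Lemma damp_eq1 kappa e : kappa * sqn e <= 1 -> damp kappa e = 1.
Proof. by move=> h; rewrite /damp max_l// invr1. Qed.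

(** Let |x| <= |y| = u and let ax, ay be the damping factors, mx, my their reciprocals. The
    difference is (ax - ay) x_j x_k + ay (x_j x_k - y_j y_k). The second term is at most 2 D ay u.
    In the first, ax - ay = (my - mx) ax ay, where ax kappa |x|^2 <= 1 absorbs x_j x_k and my - mx
    is of order kappa D u. Both end in ay u, which is at most 1 + 1 / kappa. *)
Lemma lip_damped kappa j k : 0 < kappa ->
  lip (fun e => damp kappa e * (e j * e k)) (2 * (1 + kappa^-1) * (1 + #|I|%:R)).
Proof.
move=> k0 x y D xy.
wlog xley : x y xy / sqn x <= sqn y.
  move=> W; have [/W|/ltW/W] := leP (sqn x) (sqn y); first exact.
  by rewrite distrC; apply => l; rewrite distrC.
have D0 : 0 <= D by apply: le_trans (xy j).
set Sx := sqn x in xley; set Sy := sqn y in xley.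
have Sx0 : 0 <= Sx := sqn_ge0 x; have Sy0 : 0 <= Sy := sqn_ge0 y.
set u := Num.sqrt Sy; have u0 : 0 <= u := sqrtr_ge0 _.
have uE : u ^+ 2 = Sy by rewrite sqr_sqrtr.
have yu l : `|y l| <= u := coord_le_sqn y l.
have xu l : `|x l| <= u by apply: le_trans (coord_le_sqn x l) _; rewrite ler_wsqrtr.
set N : R := #|I|%:R; have N0 : 0 <= N := ler0n _ _.
set ay := damp kappa y; set ax := damp kappa x.
have ay0 : 0 <= ay := damp_ge0 _ _; have ax0 : 0 <= ax := damp_ge0 _ _.
have ay1 : ay <= 1 := damp_le1 _ _; have ayS : ay * (kappa * Sy) <= 1 := dampM _ _.
have axS : ax * (kappa * Sx) <= 1 := dampM _ _.
have auc : ay * u <= 1 + kappa^-1.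
  have ik : 0 < kappa^-1 by rewrite invr_gt0.
  have e1 : ay * Sy <= kappa^-1.
    by rewrite -[X in _ <= X]mul1r -(ler_pM2r k0) -[X in _ <= X]mulrA mulVf ?gt_eqF// mulr1 -mulrA (mulrC Sy).
  have e2 : u <= 1 + Sy by rewrite -uE; nra.
  apply: le_trans (_ : ay * (1 + Sy) <= _); first by rewrite ler_wpM2l.
  by rewrite mulrDr mulr1; exact: lerD.
have dxy : `|x j * x k - y j * y k| <= 2 * D * u.
  have -> : x j * x k - y j * y k = (x j - y j) * x k + y j * (x k - y k) by ring.
  apply: le_trans (ler_normD _ _) _; rewrite !normrM.
  have := ler_pM (normr_ge0 _) (normr_ge0 _) (xy j) (xu k).
  have := ler_pM (normr_ge0 _) (normr_ge0 _) (yu j) (xy k).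
  by move: (`|_| * _) (`|_| * _) => p q; nra.
have dS : Sy - Sx <= N * (2 * D * u).
  rewrite /Sx /Sy /sqn -sumrB.
  apply: le_trans (_ : \sum_(i : I) (2 * D * u) <= _); last first.
    by rewrite sumr_const -[X in X <= _]mulr_natl.
  apply: ler_sum => i _; have -> : y i ^+ 2 - x i ^+ 2 = (y i - x i) * (y i + x i) by ring.
  apply: le_trans (ler_norm _) _; rewrite normrM.
  have h := le_trans (ler_normD (y i) (x i)) (lerD (yu i) (xu i)).
  have := ler_pM (normr_ge0 _) (normr_ge0 _) (xy i) h; rewrite distrC.
  by move: (`|_| * _) => p; nra.
have dm : `|ax - ay| * `|x j * x k| <= ay * (N * (2 * D * u)).
  set mx := Num.max 1 (kappa * Sx); set my := Num.max 1 (kappa * Sy).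
  have mx0 : 0 < mx by rewrite lt_max ltr01.
  have my0 : 0 < my by rewrite lt_max ltr01.
  have mxy : mx <= my by rewrite /mx /my ge_max le_max lexx/= le_max ler_wpM2l ?orbT// ltW.
  have mm : my - mx <= kappa * (Sy - Sx).
    rewrite mulrBr /my /mx; have : kappa * Sx <= kappa * Sy by rewrite ler_wpM2l// ltW.
    move: (kappa * Sx) (kappa * Sy) => p q; case: (leP 1 p) => p1; case: (leP 1 q) => q1 pq.
    - by [].
    - by rewrite -subr_ge0; have := le_trans p1 pq; rewrite leNgt q1.
    - by rewrite lerD2l lerN2 ltW.
    - by rewrite subrr subr_ge0.
  have xx : `|x j * x k| <= Sx.
    rewrite normrM; have h1 := coord_le_sqn x j; have h2 := coord_le_sqn x k.
    apply: le_trans (ler_pM (normr_ge0 _) (normr_ge0 _) h1 h2) _.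
    by rewrite -expr2 sqr_sqrtr.
  have -> : ax - ay = (my - mx) * (ax * ay).
    by rewrite /ax /ay /damp -/Sx -/Sy -/mx -/my; field; rewrite !gt_eqF.
  rewrite normrM (ger0_norm (_ : 0 <= my - mx)) ?subr_ge0// (ger0_norm (_ : 0 <= ax * ay)) ?mulr_ge0//.
  apply: le_trans (_ : kappa * (Sy - Sx) * (ax * ay) * Sx <= _).
    by apply: ler_pM => //; rewrite ?mulr_ge0 ?subr_ge0// ler_wpM2r ?mulr_ge0.
  have -> : kappa * (Sy - Sx) * (ax * ay) * Sx = ay * ((Sy - Sx) * (ax * (kappa * Sx))) by ring.
  rewrite ler_wpM2l//; apply: le_trans dS.
  by rewrite ler_piMr// subr_ge0.
have -> : ax * (x j * x k) - ay * (y j * y k) = (ax - ay) * (x j * x k) + ay * (x j * x k - y j * y k) by ring.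
apply: le_trans (ler_normD _ _) _; rewrite !normrM -(normrM (x j)) (ger0_norm ay0).
have h1 : ay * `|x j * x k - y j * y k| <= ay * (2 * D * u) by rewrite ler_wpM2l.
have -> : 2 * (1 + kappa^-1) * (1 + N) * D = (1 + kappa^-1) * (2 * D * (1 + N)) by ring.
apply: le_trans (lerD dm h1) _.
have -> : ay * (N * (2 * D * u)) + ay * (2 * D * u) = (ay * u) * (2 * D * (1 + N)) by ring.
by rewrite ler_wpM2r// mulr_ge0 ?mulr_ge0// addr_ge0.
Qed.

Variables (T : R) (A : I -> I -> R) (B : I -> I -> I -> R).
Hypothesis T0 : 0 < T.

Definition quad e i : R := \sum_j \sum_k B i j k * (e j * e k).
Definition vfield y i : R := \sum_j A i j * y j + quad y i.

Section Truncation.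
Variables (Y dY : R -> I -> R) (K D kappa : R).
Hypotheses (K0 : 0 <= K) (D0 : 0 <= D) (k0 : 0 < kappa).
Hypothesis cY : forall i, {within `[0, T], continuous (fun t => Y t i)}.
Hypothesis dYP : forall i t, t \in `]0, T[ -> is_derive t 1 (fun t => Y t i) (dY t i).
Hypothesis energy : forall t e l, t \in `]0, T[ -> 0 <= l -> l <= 1 -> l * (kappa * sqn e) <= 1 ->
  \sum_i e i * (vfield (fun i => Y t i + e i) i - (1 - l) * quad e i - dY t i) <= K * sqn e + D.
Hypothesis small : kappa * (2 * D * T * expR (2 * K * T)) <= 1.

Let Yc t i := Y (clamp 0 T t) i.
Let diff t y i := y i - Yc t i.
(** Expanded at [Yc], the field [vfield] is affine in y plus [quad] of the deviation; the
    subtraction leaves the affine part alone and multiplies the quadratic part by [damp]. *)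
Let F t y i := vfield y i - (1 - damp kappa (diff t y)) * quad (diff t y) i.

Let cYc i : continuous (fun t => Yc t i).
Proof. exact: within_clamp (ltW T0) (@cY i). Qed.

Let Flip : exists2 L, 0 <= L & forall t, t \in `[0, T] -> forall i, lip (fun y => F t y i) L.
Proof.
have [M M0 MP] : exists2 M, 0 <= M & forall t i, `|Yc t i| <= M.
  have H i := within_bounded (@cY i).
  exists (\sum_i sval (cid2 (H i))); first by apply: sumr_ge0 => i _; case: cid2.
  move=> t i; rewrite (bigD1 i)//=; apply: le_trans (_ : sval (cid2 (H i)) <= _).
    by case: cid2 => /= m _; apply; apply: clamp_in; exact: ltW.
  by rewrite lerDl sumr_ge0// => j _; case: cid2.
set Lam := 2 * (1 + kappa^-1) * (1 + #|I|%:R).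
have Lam0 : 0 <= Lam by rewrite /Lam !mulr_ge0 ?addr_ge0// invr_ge0 ltW.
pose Li i := \sum_j `|A i j| * 1 + \sum_j \sum_k `|B i j k| * (2 * M + Lam).
have Li0 i : 0 <= Li i.
  apply: addr_ge0; apply: sumr_ge0 => j _; first by rewrite mulr1.
  by rewrite sumr_ge0// => k _; rewrite mulr_ge0// addr_ge0// mulr_ge0.
exists (\sum_i Li i); first by apply: sumr_ge0.
move=> t tT i.
have lipF : lip (fun y => F t y i) (Li i).
  (* The coefficient of [B i j k] after the expansion at [Yc]: an affine part with coefficients
     bounded by M, and a damped product of deviations. *)
  have lq j k : lip (fun y => Yc t j * y k + Yc t k * y j - Yc t j * Yc t k +
      damp kappa (diff t y) * (diff t y j * diff t y k)) (2 * M + Lam).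
    move=> x y d xy; have d0 : 0 <= d by apply: le_trans (xy j).
    have h := @lip_damped kappa j k k0 (diff t x) (diff t y) d.
    set p := damp kappa (diff t x) * _ in h *; set q := damp kappa (diff t y) * _ in h *.
    have {}h : `|p - q| <= Lam * d by apply: h => l; rewrite /diff opprB addrA subrK.
    have -> : Yc t j * x k + Yc t k * x j - Yc t j * Yc t k + p -
      (Yc t j * y k + Yc t k * y j - Yc t j * Yc t k + q) =
      Yc t j * (x k - y k) + Yc t k * (x j - y j) + (p - q) by ring.
    apply: le_trans (ler_normD _ _) _; rewrite mulrDl; apply: lerD => //.
    apply: le_trans (ler_normD _ _) _; rewrite !normrM.
    have h1 := ler_pM (normr_ge0 _) (normr_ge0 _) (MP t j) (xy k).
    have h2 := ler_pM (normr_ge0 _) (normr_ge0 _) (MP t k) (xy j).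
    have -> : 2 * M * d = M * d + M * d by ring.
    exact: lerD.
  have := lipD (lip_sum (fun j => lipZ (A i j) (lip_coord j))) (lip_sum (fun j => lip_sum (fun k => lipZ (B i j k) (lq j k)))).
  rewrite -/(Li i); congr lip; apply/funext => y.
  rewrite /F /vfield -[RHS]addrA; congr (_ + _).
  rewrite /quad mulr_sumr -sumrB; apply: eq_bigr => j _.
  rewrite mulr_sumr -sumrB; apply: eq_bigr => k _.
  by rewrite /diff; move: (damp _ _) => a; ring.
move=> x y d xy; have d0 : 0 <= d by apply: le_trans (xy i).
apply: le_trans (lipF x y d xy) _; rewrite ler_wpM2r// (bigD1 i)//= lerDl.
by rewrite sumr_ge0.
Qed.

Let max1_continuous (f : R -> R) (t : R) : {for t, continuous f} -> {for t, continuous (fun t => Num.max 1 (f t))}.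
Proof.
move=> cf; apply/cvgrPdist_le => e e0; have /cvgrPdist_le/(_ e e0) := cf.
apply: filterS => s; apply: le_trans.
move: (f t) (f s) => p q; case: (leP 1 p) => hp; case: (leP 1 q) => hq //.
- rewrite ger0_norm ?subr_ge0// ; apply: le_trans (ler_norm _); lra.
- by rewrite distrC ger0_norm ?subr_ge0// distrC; apply: le_trans (ler_norm _); lra.
- by rewrite subrr normr0.
Qed.

Let Fcont (y : R -> I -> R) : (forall j t, t \in `[0, T] -> {for t, continuous (fun t => y t j)}) ->
  forall j t, t \in `[0, T] -> {for t, continuous (fun t => F t (y t) j)}.
Proof.
move=> cy i t tT.
have ce j : {for t, continuous (fun t => diff t (y t) j)}.
  by apply: cvgB; [exact: cy|exact: cYc].
have cs : {for t, continuous (fun t => sqn (diff t (y t)))}.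
  apply: (@cvg_fsum R I R _ _ _ (fun i t => diff t (y t) i ^+ 2) (fun i => diff t (y t) i ^+ 2)) => j.
  by under eq_fun do rewrite expr2; rewrite expr2; apply: cvgM; exact: ce.
have cd : {for t, continuous (fun t => damp kappa (diff t (y t)))}.
  apply: cvgV; first by rewrite gt_eqF// lt_max ltr01.
  apply: (@max1_continuous (fun t => kappa * sqn (diff t (y t)))).
  by apply: cvgM => //; exact: cvg_cst.
have cq (z : R -> I -> R) : (forall j, {for t, continuous (fun t => z t j)}) ->
    {for t, continuous (fun t => quad (z t) i)}.
  move=> cz; apply: (@cvg_fsum R I R _ _ _ (fun j s => \sum_k B i j k * (z s j * z s k)) (fun j => \sum_k B i j k * (z t j * z t k))) => j.
  apply: (@cvg_fsum R I R _ _ _ (fun k s => B i j k * (z s j * z s k)) (fun k => B i j k * (z t j * z t k))) => k.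
  by apply: cvgM; [exact: cvg_cst|apply: cvgM; exact: cz].
apply: cvgB.
  apply: cvgD; last by apply: cq => j; exact: cy.
  apply: (@cvg_fsum R I R _ _ _ (fun j s => A i j * y s j) (fun j => A i j * y t j)) => j.
  by apply: cvgM; [exact: cvg_cst|exact: cy].
apply: cvgM; last exact: (cq (fun t => diff t (y t)) ce).
by apply: cvgB => //; exact: cvg_cst.
Qed.

(* Damping the quadratic part of the error keeps the energy estimate and makes
   the field globally Lipschitz; the estimate then shows that the damping
   factor equals 1 along the solution. *)
Lemma quadratic_ode_near : exists y : R -> I -> R,
  [/\ forall i t, t \in `[0, T] -> is_derive t 1 (fun t => y t i) (vfield (y t) i),
      y 0 = Y 0 &
      forall t, t \in `[0, T] -> sqn (fun i => y t i - Y t i) <= 2 * D * T * expR (2 * K * T)].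
Proof.
have [L L0 FL] := Flip.
have [y [dy y0]] := @picard R I T L F (Y 0) T0 L0 (fun t x y d tT h i => FL t tT i x y d h) Fcont.
pose E t := sqn (fun i => y t i - Y t i).
have Yc_id t : t \in `[0, T] -> Yc t = Y t by move=> tT; rewrite /Yc clamp_id.
have dfE t : t \in `[0, T] -> diff t (y t) = fun i => y t i - Y t i.
  by move=> tT; apply/funext => i; rewrite /diff Yc_id.
have ooc t : t \in `]0, T[ -> t \in `[0, T] by apply: subset_itv_oo_cc.
have cE : {within `[0, T], continuous E}.
  apply: (@within_fsum R I _ _ (fun i t => (y t i - Y t i) ^+ 2)) => i.
  have cyi : {within `[0, T], continuous (fun t => y t i)}.
    by apply: for_within => t tT; exact: derivable_for_continuous (dy i t tT).
  have cd := withinB cyi (@cY i).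
  by move: (withinM cd cd); congr (continuous (from_subspace _ _)); apply/funext => t; rewrite expr2.
pose dE t := \sum_i 2 * ((y t i - Y t i) * (F t (y t) i - dY t i)).
have dEP t : t \in `]0, T[ -> is_derive t 1 E (dE t).
  move=> tT; apply: is_derive_fsum => i.
  have h1 := dy i t (ooc t tT); have h2 := dYP i tT.
  have h3 : is_derive t 1 (fun t => y t i - Y t i) (F t (y t) i - dY t i) by exact: is_deriveB.
  rewrite (_ : (fun x : R => _) = (fun t => (y t i - Y t i) * (y t i - Y t i))); last first.
    by apply/funext => s; rewrite expr2.
  have h4 := is_deriveM h3 h3.
  by apply: (is_derive_eq h4); rewrite /GRing.scale/= -mulr2n mulr_natl.
have dEle t : t \in `]0, T[ -> dE t <= 2 * K * E t + 2 * D.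
  move=> tT; rewrite /dE -mulr_sumr.
  have tT' := ooc t tT; pose e i := y t i - Y t i.
  have l0 := damp_ge0 kappa e; have l1 := damp_le1 kappa e; have lM := dampM kappa e.
  have := energy tT l0 l1 lM; rewrite -/(E t).
  have -> : \sum_i e i * (vfield (fun i => Y t i + e i) i - (1 - damp kappa e) * quad e i - dY t i) =
      \sum_i (y t i - Y t i) * (F t (y t) i - dY t i).
    apply: eq_bigr => i _; rewrite /F dfE// -/e; congr (_ * (vfield _ i - _ - _)).
    by apply/funext => k; rewrite /e addrC subrK.
  rewrite -/(sqn _) -/(E t).
  by move: (\sum_i _) (E t) => p q; lra.
have E0 : E 0 = 0.
  by rewrite /E /sqn big1// => i _; rewrite y0 subrr expr0n.
have G := gronwall T0 (mulr_ge0 (ler0n _ 2) K0) (mulr_ge0 (ler0n _ 2) D0) cE dEP dEle E0.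
exists y; split => // i t tT.
have := dy i t tT; rewrite /F dfE// damp_eq1 ?subrr ?mul0r ?subr0//.
by apply: le_trans small; rewrite ler_pM2l//; exact: G.
Qed.

End Truncation.

Lemma quad_lip M : 0 <= M -> exists2 L, 0 <= L & forall x y d, (forall i, `|x i| <= M) -> (forall i, `|y i| <= M) ->
  (forall i, `|x i - y i| <= d) -> forall i, `|vfield x i - vfield y i| <= L * d.
Proof.
move=> M0; pose Li i := \sum_j `|A i j| + \sum_j \sum_k `|B i j k| * (2 * M).
have Li0 i : 0 <= Li i.
  rewrite addr_ge0// sumr_ge0// => j _.
  by rewrite sumr_ge0// => k _; rewrite !mulr_ge0.
exists (\sum_i Li i); first exact: sumr_ge0.
move=> x y d xM yM xy i; have d0 : 0 <= d by apply: le_trans (xy i).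
apply: le_trans (_ : Li i * d <= _); last first.
  by rewrite ler_wpM2r// (bigD1 i)//= lerDl sumr_ge0.
have -> : vfield x i - vfield y i = \sum_j A i j * (x j - y j) + \sum_j \sum_k B i j k * (x j * x k - y j * y k).
  rewrite /vfield /quad opprD addrACA; congr (_ + _).
    by rewrite -sumrB; apply: eq_bigr => j _; rewrite mulrBr.
  rewrite -sumrB; apply: eq_bigr => j _; rewrite -sumrB; apply: eq_bigr => k _.
  by rewrite mulrBr.
rewrite mulrDl; apply: le_trans (ler_normD _ _) _; apply: lerD.
  rewrite mulr_suml; apply: le_trans (ler_norm_sum _ _ _) _; apply: ler_sum => j _.
  by rewrite normrM ler_wpM2l.
rewrite mulr_suml; apply: le_trans (ler_norm_sum _ _ _) _; apply: ler_sum => j _.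
rewrite mulr_suml; apply: le_trans (ler_norm_sum _ _ _) _; apply: ler_sum => k _.
rewrite normrM -mulrA ler_wpM2l//.
have -> : x j * x k - y j * y k = (x j - y j) * x k + y j * (x k - y k) by ring.
apply: le_trans (ler_normD _ _) _; rewrite !normrM.
have h1 := ler_pM (normr_ge0 _) (normr_ge0 _) (xy j) (xM k).
have h2 := ler_pM (normr_ge0 _) (normr_ge0 _) (yM j) (xy k).
by have -> : 2 * M * d = d * M + M * d; [ring|exact: lerD].
Qed.

(** The undamped field is Lipschitz on bounded sets only, but two continuous solutions on [0, T]
    stay in a common one. Gronwall's lemma with D = 0 then applies to the squared distance. *)
Lemma quadratic_ode_unique (y z : R -> I -> R) :
  (forall i, {within `[0, T], continuous (fun t => y t i)}) ->
  (forall i, {within `[0, T], continuous (fun t => z t i)}) ->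
  (forall i t, t \in `]0, T[ -> is_derive t 1 (fun t => y t i) (vfield (y t) i)) ->
  (forall i t, t \in `]0, T[ -> is_derive t 1 (fun t => z t i) (vfield (z t) i)) ->
  (forall i, y 0 i = z 0 i) -> forall i t, t \in `[0, T] -> y t i = z t i.
Proof.
move=> cy cz dy dz yz0.
have [M M0 MP] : exists2 M, 0 <= M & forall t i, t \in `[0, T] -> `|y t i| <= M /\ `|z t i| <= M.
  have H i := within_bounded (@cy i); have H' i := within_bounded (@cz i).
  exists (\sum_i (sval (cid2 (H i)) + sval (cid2 (H' i)))).
    by apply: sumr_ge0 => i _; rewrite addr_ge0//; case: cid2.
  move=> t i tT; rewrite (bigD1 i)//=.
  set S := \sum_(_ | _) _; have S0 : 0 <= S.
    by rewrite sumr_ge0// => j _; rewrite addr_ge0//; case: cid2.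
  move: S0; move: S => S; case: cid2 => m m0 /= /(_ t tT) h1; case: cid2 => m' m'0 /= /(_ t tT) h2 S0.
  by move: h1 h2; move: (`|_|) (`|_|) => p q; lra.
have [L L0 LP] := quad_lip M0.
pose E t := sqn (fun i => y t i - z t i).
have cE : {within `[0, T], continuous E}.
  apply: (@within_fsum R I _ _ (fun i t => (y t i - z t i) ^+ 2)) => i.
  have cd := withinB (@cy i) (@cz i).
  by move: (withinM cd cd); congr (continuous (from_subspace _ _)); apply/funext => t; rewrite expr2.
pose dE t := \sum_i 2 * ((y t i - z t i) * (vfield (y t) i - vfield (z t) i)).
have dEP t : t \in `]0, T[ -> is_derive t 1 E (dE t).
  move=> tT; apply: is_derive_fsum => i.
  have h1 := dy i t tT; have h2 := dz i t tT.
  have h3 : is_derive t 1 (fun t => y t i - z t i) (vfield (y t) i - vfield (z t) i) by exact: is_deriveB.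
  rewrite (_ : (fun x : R => _) = (fun t => (y t i - z t i) * (y t i - z t i))); last first.
    by apply/funext => s; rewrite expr2.
  have h4 := is_deriveM h3 h3.
  by apply: (is_derive_eq h4); rewrite /GRing.scale/= -mulr2n mulr_natl.
pose K := 2 * L * #|I|%:R.
have dEle t : t \in `]0, T[ -> dE t <= K * E t + 0.
  move=> tT; have tT' : t \in `[0, T] by apply: subset_itv_oo_cc.
  rewrite addr0; pose e i := y t i - z t i; pose d := Num.sqrt (sqn e).
  have ed i : `|e i| <= d := coord_le_sqn e i.
  apply: le_trans (_ : \sum_(i : I) 2 * (d * (L * d)) <= _).
    apply: ler_sum => i _; rewrite ler_wpM2l//; apply: le_trans (ler_norm _) _; rewrite normrM.
    apply: ler_pM => //; first exact: (ed i).
    by apply: LP => // j; have [] := MP t j tT'.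
  have -> : E t = d ^+ 2 by rewrite /d sqr_sqrtr// sqn_ge0.
  rewrite sumr_const -[X in X <= _]mulr_natl /K.
  have -> : 2 * L * #|I|%:R * d ^+ 2 = #|I|%:R * (2 * (d * (L * d))) by ring.
  exact: lexx.
have E0 : E 0 = 0 by rewrite /E /sqn big1// => i _; rewrite yz0 subrr expr0n.
have K0 : 0 <= K by rewrite /K !mulr_ge0.
move=> i t tT; have := gronwall T0 K0 (lexx 0) cE dEP dEle E0 tT.
rewrite !mul0r => Et.
apply/eqP; rewrite -subr_eq0 -sqrf_eq0; apply/eqP; apply: le_anti; rewrite sqr_ge0 andbT.
apply: le_trans Et; rewrite /E /sqn (bigD1 i)//= lerDl sumr_ge0// => j _; exact: sqr_ge0.
Qed.

End QuadraticODE.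

(** * The energy estimate *)

Section Energy.
Context {R : realType}.
Variable s : seq R.
Hypothesis sP : itv_partition 0 1 s.
Implicit Types (f : R -> R) (a b c x : R).
Local Notation PC := (PC s).
Local Notation PD := (PD s).
Local Notation PC1 := (PC1 s).

Lemma Int_sqr_le f : PC f -> Int (fun x => `|f x|) ^+ 2 <= ip f f.
Proof.
move=> cf; have ca := PC_abs cf.
have := cauchy_schwarz (sip_ip sP) ca (@PC_cst R s 1).
have -> : ip (fun x => `|f x|) (fun=> 1) = Int (fun x => `|f x|).
  by rewrite /ip -/(Int _); congr Int; apply/funext => x; rewrite mulr1.
have -> : ip (fun=> 1) (fun=> 1) = 1 :> R.
  by rewrite /ip -/(Int _) -[RHS](Int_cst sP); congr Int; apply/funext => x; rewrite mulr1.
rewrite mulr1; have -> : ip (fun x => `|f x|) (fun x => `|f x|) = ip f f => //.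
by rewrite /ip; congr Rintegral; apply/funext => x; rewrite -normrM -expr2 ger0_norm ?sqr_ge0.
Qed.

Lemma sqr_diff_le F f x y : PD F f -> PC f -> x \in `[0, 1] -> y \in `[0, 1] ->
  (F x - F y) ^+ 2 <= ip f f.
Proof.
move=> dF cf xI yI; apply: le_trans (Int_sqr_le cf).
by rewrite -[_ ^+ 2]real_normK ?num_real// lerXn2r ?nnegrE ?(le_trans (normr_ge0 _) (PD_le_Int_abs sP dF cf xI yI))// (PD_le_Int_abs sP dF cf).
Qed.

(** The Sobolev inequality in dimension one: integrate F(x)^2 <= 2 F(y)^2 + 2 (F(x) - F(y))^2 over
    y. *)
Lemma sqr_le_H1 F f x : PD F f -> PC f -> x \in `[0, 1] -> F x ^+ 2 <= 2 * (ip F F + ip f f).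
Proof.
move=> dF cf xI; have cF := PD_PC sP dF.
have c1 : PC (fun y => F y * F y) by exact: PCM.
rewrite mulrDr -[X in X <= _](Int_cst sP) -[2 * ip f f](Int_cst sP) -(IntZ sP 2 c1) -(IntD sP (PCZ 2 c1)); last exact: PC_cst.
apply: (le_Int sP); [exact: PC_cst|by apply: PCD; [exact: PCZ|exact: PC_cst]|].
move=> i y si yi; have yI : y \in `[0, 1] by apply: subset_itv_oo_cc; exact: cell01 yi.
have := sqr_diff_le dF cf xI yI; move: (ip f f) (F x) (F y) => A p q.
by move=> h; have := sqr_ge0 (p - 2 * q); nra.
Qed.

Lemma term_le K Q c a b : `|c| <= K -> a ^+ 2 <= Q -> b ^+ 2 <= Q -> c * a * b <= K * Q.
Proof.
move=> cK aQ bQ; have K0 : 0 <= K by apply: le_trans cK.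
apply: le_trans (ler_norm _) _; rewrite -mulrA normrM.
apply: ler_pM => //.
by rewrite ler_norml; have := sqr_ge0 (a - b); have := sqr_ge0 (a + b); nra.
Qed.

Lemma Int_lin c (f h : R -> R) : PC f -> PC h -> Int (fun x => c * f x + h x) = c * Int f + Int h.
Proof. by move=> cf ch; rewrite (IntD sP (PCZ c cf) ch) (IntZ sP c cf). Qed.

Lemma onep_bounds a b : 0 < a -> 0 < b ->
  [/\ b <= (1 + a) * (1 + b), a * b <= (1 + a) * (1 + b), 1 <= (1 + a) * (1 + b) & a <= (1 + a) * (1 + b)].
Proof.
move=> a0 b0; have ab : 0 < a * b by rewrite mulr_gt0.
have -> : (1 + a) * (1 + b) = 1 + a + b + a * b by ring.
by move: (a * b) ab => c c0; split; lra.
Qed.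

(** * The energy identity as a pointwise inequality *)

Section Pointwise.
Variables (eps l M Th X : R).
Hypotheses (eps0 : 0 < eps) (l0 : 0 <= l) (l1 : l <= 1) (M1 : 2 <= M) (lT : l * Th <= 1)
  (X0 : 0 <= X) (Th0 : 0 <= Th).
Variables (z z1 v v1 g g1 zh zh1 vh vh1 th th1 xi xi1 : R).
Hypotheses (zM : `|z| <= M) (z1M : `|z1| <= M) (vM : `|v| <= M) (v1M : `|v1| <= M)
  (gM : `|g| <= M) (g1M : `|g1| <= M) (rM : `|zh - z| <= M) (sM : `|vh - v| <= M)
  (thT : `|th| <= Th) (xiX : `|xi| <= X).

(* z, v are the exact solution, zh, vh its projections, th, xi the distances of the discrete
   solution from these, g is eta_b and l is the damping factor; a final 1 marks x-derivatives. *)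
Definition energy_density : R :=
  - ((g1 * (vh + xi) + g * (vh1 + xi1)) * th)
  - eps * (((zh1 + th1) * (vh + xi) + (zh + th) * (vh1 + xi1)) * th)
  + (1 - l) * eps * ((th1 * xi + th * xi1) * th)
  + ((eps * z1 + g1) * v + (eps * z + g) * v1) * th
  - (zh1 + th1) * xi - eps * ((vh + xi) * (vh1 + xi1) * xi)
  + (1 - l) * eps * (xi * xi1 * xi) + (z1 + eps * (v * v1)) * xi.

(* x-derivative of eps/2 th^2 (vh + l xi) + th xi + l eps/3 xi^3 + eps xi^2 (vh - v),
   which removes th1 and the terms cubic in the errors. *)
Definition exact_density : R :=
  eps * (th * th1 * (vh + l * xi)) + eps / 2 * (th ^+ 2 * (vh1 + l * xi1)) + (th1 * xi + th * xi1)
  + l * eps * (xi ^+ 2 * xi1) + eps * (2 * (xi * xi1 * (vh - v)) + xi ^+ 2 * (vh1 - v1)).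

(** The last two summands pay for products of a derivative of a projection error with two discrete
    errors. Such a derivative is small in L^2 only, so one of the discrete errors is replaced by its
    bound X or Th. *)
Definition quad_density : R := th ^+ 2 + xi ^+ 2 + xi1 ^+ 2 + (zh - z) ^+ 2 + (zh1 - z1) ^+ 2
  + (vh - v) ^+ 2 + (vh1 - v1) ^+ 2 + X ^+ 2 * (zh1 - z1) ^+ 2 + Th ^+ 2 * (vh1 - v1) ^+ 2.

(** With r, sg for the projection errors and r1, s1 for their derivatives, the sum is a list of 26
    products c a b with a^2, b^2 <= Q and |c| <= K, except for 2 K in the last one. The total is 27
    K Q, and 60 leaves a margin. In the exact derivative, the summand with vh - v trades xi^2 s1 for
    xi xi1 sg, whose factor sg is bounded. *)
Lemma energy_density_le : energy_density + exact_density <= 60 * ((1 + eps) * (1 + M)) * quad_density.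
Proof.
pose r := zh - z; pose r1 := zh1 - z1; pose sg := vh - v; pose s1 := vh1 - v1.
have Ezh : zh = z + r by rewrite /r; ring.
have Ezh1 : zh1 = z1 + r1 by rewrite /r1; ring.
have Evh : vh = v + sg by rewrite /sg; ring.
have Evh1 : vh1 = v1 + s1 by rewrite /s1; ring.
have rM' : `|r| <= M := rM. have sM' : `|sg| <= M := sM.
set Q := quad_density.
have EQ : Q = th ^+ 2 + xi ^+ 2 + xi1 ^+ 2 + r ^+ 2 + r1 ^+ 2 + sg ^+ 2 + s1 ^+ 2 + X ^+ 2 * r1 ^+ 2 + Th ^+ 2 * s1 ^+ 2 by [].
set K := (1 + eps) * (1 + M).
have -> : energy_density + exact_density =
  - g1 * sg * th + - g1 * xi * th + - g * s1 * th + - g * xi1 * th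
  + - (eps * z1) * sg * th + - (eps * v) * r1 * th + - (eps * sg) * r1 * th + - (eps * z1) * xi * th
  + - eps * (r1 * xi) * th + - (eps * z) * s1 * th + - (eps * v1) * r * th + - (eps * r) * s1 * th
  + - (eps * z) * xi1 * th + - (eps * r) * xi1 * th
  + - (eps / 2 * v1) * th * th + - (eps / 2) * (th * s1) * th + - (eps / 2 * (l * th)) * th * xi1
  + 1 * th * xi1 + - 1 * r1 * xi + - (eps * v) * s1 * xi + - (eps * v1) * sg * xi + - (eps * sg) * s1 * xi
  + - (eps * v) * xi1 * xi + - (eps * sg) * xi1 * xi + - (eps * v1) * xi * xi + 2 * eps * sg * xi * xi1.
  rewrite /energy_density /exact_density Ezh Ezh1 Evh Evh1.
  have Eh : eps = 2 * (eps / 2) by rewrite mulrC divfK.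
  move: (eps / 2) Eh => h ->.
  clearbody r r1 sg s1; clear; ring.
have M0 : 0 < M by apply: lt_le_trans M1.

have [KM KeM K_1 Kep] : [/\ M <= K, eps * M <= K, 1 <= K & eps <= K].
  exact: onep_bounds.
have he : eps / 2 <= eps by rewrite ler_pdivrMr// ler_peMr// ?ler1n// ltW.
have sq := fun x : R => sqr_ge0 x.
have pX : 0 <= X ^+ 2 * r1 ^+ 2 by rewrite mulr_ge0.
have pT : 0 <= Th ^+ 2 * s1 ^+ 2 by rewrite mulr_ge0.
have Q1 : th ^+ 2 <= Q by rewrite EQ; have := (sq xi, sq xi1, sq r, sq r1, sq sg, sq s1); move=> [[[[[? ?] ?] ?] ?] ?]; lra.
have Q2 : xi ^+ 2 <= Q by rewrite EQ; have := (sq th, sq xi1, sq r, sq r1, sq sg, sq s1); move=> [[[[[? ?] ?] ?] ?] ?]; lra.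
have Q3 : xi1 ^+ 2 <= Q by rewrite EQ; have := (sq th, sq xi, sq r, sq r1, sq sg, sq s1); move=> [[[[[? ?] ?] ?] ?] ?]; lra.
have Q4 : r ^+ 2 <= Q by rewrite EQ; have := (sq th, sq xi, sq xi1, sq r1, sq sg, sq s1); move=> [[[[[? ?] ?] ?] ?] ?]; lra.
have Q5 : r1 ^+ 2 <= Q by rewrite EQ; have := (sq th, sq xi, sq xi1, sq r, sq sg, sq s1); move=> [[[[[? ?] ?] ?] ?] ?]; lra.
have Q6 : sg ^+ 2 <= Q by rewrite EQ; have := (sq th, sq xi, sq xi1, sq r, sq r1, sq s1); move=> [[[[[? ?] ?] ?] ?] ?]; lra.
have Q7 : s1 ^+ 2 <= Q by rewrite EQ; have := (sq th, sq xi, sq xi1, sq r, sq r1, sq sg); move=> [[[[[? ?] ?] ?] ?] ?]; lra.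
have Q8 : (r1 * xi) ^+ 2 <= Q.
  apply: (@le_trans _ _ (X ^+ 2 * r1 ^+ 2)).
    rewrite exprMn mulrC ler_wpM2r// -[xi ^+ 2]real_normK ?num_real//.
    by rewrite lerXn2r ?nnegrE.
  by rewrite EQ; have := (sq th, sq xi, sq xi1, sq r, sq r1, sq sg, sq s1); move=> [[[[[[? ?] ?] ?] ?] ?] ?]; lra.
have Q9 : (th * s1) ^+ 2 <= Q.
  apply: (@le_trans _ _ (Th ^+ 2 * s1 ^+ 2)).
    rewrite exprMn ler_wpM2r// -[th ^+ 2]real_normK ?num_real//.
    by rewrite lerXn2r ?nnegrE.
  by rewrite EQ; have := (sq th, sq xi, sq xi1, sq r, sq r1, sq sg, sq s1); move=> [[[[[[? ?] ?] ?] ?] ?] ?]; lra.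
have K1 c : `|c| <= M -> `|- c| <= K.
  by rewrite normrN => h; apply: le_trans h KM.
have Ke c : `|c| <= M -> `|- (eps * c)| <= K.
  move=> h; rewrite normrN normrM gtr0_norm//.
  by apply: le_trans KeM; rewrite ler_wpM2l// ltW.
have K3 : `|1 : R| <= K by rewrite normr1.
have K3' : `|- 1 : R| <= K by rewrite normrN normr1.
have K4 : `|- eps| <= K by rewrite normrN gtr0_norm.
have K5 : `|- (eps / 2)| <= K by rewrite normrN gtr0_norm ?divr_gt0// (le_trans he).
have K6 : `|- (eps / 2 * v1)| <= K.
  rewrite normrN normrM gtr0_norm ?divr_gt0//.
  apply: le_trans KeM; apply: (@le_trans _ _ (eps / 2 * M)); first by rewrite ler_wpM2l// ltW// divr_gt0.
  by rewrite ler_wpM2r// ltW.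
(* This coefficient belongs to th xi1: of the products of third degree in th and xi, l th^2 xi1
   alone survives, and the damping bound l Th <= 1 makes it quadratic. *)
have K7 : `|- (eps / 2 * (l * th))| <= K.
  rewrite normrN normrM (normrM l) gtr0_norm ?divr_gt0// (ger0_norm l0).
  have : l * `|th| <= 1 by apply: le_trans lT; rewrite ler_wpM2l.
  move=> p1; apply: le_trans Kep; apply: le_trans he.
  by rewrite ler_piMr// ltW// divr_gt0.
have K8 : `|2 * eps * sg| <= 2 * K.
  rewrite normrM gtr0_norm ?mulr_gt0// -mulrA ler_wpM2l//.
  by apply: le_trans KeM; rewrite ler_wpM2l// ltW.
have T1 := term_le (K1 _ g1M) Q6 Q1. have T2 := term_le (K1 _ g1M) Q2 Q1.
have T3 := term_le (K1 _ gM) Q7 Q1. have T4 := term_le (K1 _ gM) Q3 Q1.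
have T5 := term_le (Ke _ z1M) Q6 Q1. have T6 := term_le (Ke _ vM) Q5 Q1.
have T7 := term_le (Ke _ sM') Q5 Q1. have T8 := term_le (Ke _ z1M) Q2 Q1.
have T9 := term_le K4 Q8 Q1. have T10 := term_le (Ke _ zM) Q7 Q1.
have T11 := term_le (Ke _ v1M) Q4 Q1. have T12 := term_le (Ke _ rM') Q7 Q1.
have T13 := term_le (Ke _ zM) Q3 Q1. have T14 := term_le (Ke _ rM') Q3 Q1.
have T15 := term_le K6 Q1 Q1. have T16 := term_le K5 Q9 Q1. have T17 := term_le K7 Q1 Q3.
have T18 := term_le K3 Q1 Q3. have T19 := term_le K3' Q5 Q2. have T20 := term_le (Ke _ vM) Q7 Q2.
have T21 := term_le (Ke _ v1M) Q6 Q2. have T22 := term_le (Ke _ sM') Q7 Q2.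
have T23 := term_le (Ke _ vM) Q3 Q2. have T24 := term_le (Ke _ sM') Q3 Q2.
have T25 := term_le (Ke _ v1M) Q2 Q2. have T26 := term_le K8 Q2 Q3.
have KQ : 0 <= K * Q by rewrite mulr_ge0 ?(le_trans _ Q1)// (le_trans _ K3).
have -> : 60 * K * Q = 60 * (K * Q) by rewrite mulrA.
rewrite -(mulrA 2 K Q) in T26.
have S1 := lerD (lerD (lerD T1 T2) (lerD T3 T4)) (lerD (lerD T5 T6) (lerD T7 T8)).
have S2 := lerD (lerD (lerD T9 T10) (lerD T11 T12)) (lerD (lerD T13 T14) (lerD T15 T16)).
have S3 := lerD (lerD (lerD T17 T18) (lerD T19 T20)) (lerD (lerD T21 T22) (lerD T23 T24)).
have S4 := lerD T25 T26.
have S := lerD (lerD S1 S2) (lerD S3 S4).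
apply: (@le_trans _ _ (27 * (K * Q))); last by rewrite ler_wpM2r// ler_nat.
have E : forall p : R, p + p + (p + p) + (p + p + (p + p)) + (p + p + (p + p) + (p + p + (p + p))) +
  (p + p + (p + p) + (p + p + (p + p)) + (p + 2 * p)) = 27 * p by move=> p; ring.
rewrite -E; apply: le_trans S; rewrite le_eqVlt; apply/orP; left; apply/eqP.
by rewrite !addrA.
Qed.

End Pointwise.

(** * The integrated energy inequality *)

Section Integrated.
Variables (eps l M Th X : R).
Hypotheses (eps0 : 0 < eps) (l0 : 0 <= l) (l1 : l <= 1) (M1 : 2 <= M) (lT : l * Th <= 1)
  (X0 : 0 <= X) (Th0 : 0 <= Th).
Variables (z z1 v v1 g g1 zh zh1 vh vh1 th th1 xi xi1 : R -> R).
Hypotheses (dz : PD z z1) (dv : PD v v1) (dg : PD g g1) (dzh : PD zh zh1) (dvh : PD vh vh1)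
  (dth : PD th th1) (dxi : PD xi xi1).
Hypotheses (cz1 : PC z1) (cv1 : PC v1) (cg1 : PC g1) (czh1 : PC zh1) (cvh1 : PC vh1)
  (cth1 : PC th1) (cxi1 : PC xi1).
Hypotheses (v0 : v 0 = 0) (v1_ : v 1 = 0) (vh0 : vh 0 = 0) (vh1_ : vh 1 = 0)
  (xi0 : xi 0 = 0) (xi1_ : xi 1 = 0).

Let cz := PD_PC sP dz. Let cv := PD_PC sP dv. Let cg := PD_PC sP dg. Let czh := PD_PC sP dzh.
Let cvh := PD_PC sP dvh. Let cth := PD_PC sP dth. Let cxi := PD_PC sP dxi.

Local Ltac pc := repeat first [exact: cz | exact: cv | exact: cg | exact: czh | exact: cvh | exact: cth
  | exact: cxi | exact: cz1 | exact: cv1 | exact: cg1 | exact: czh1 | exact: cvh1 | exact: cth1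
  | exact: cxi1 | exact: PC_cst | apply: PCB | apply: PCN | apply: PCD | apply: PCM | apply: PCX].

Let dens x := energy_density eps l (z x) (z1 x) (v x) (v1 x) (g x) (g1 x) (zh x) (zh1 x) (vh x) (vh1 x)
  (th x) (th1 x) (xi x) (xi1 x).
Let exac x := exact_density eps l (v x) (v1 x) (vh x) (vh1 x) (th x) (th1 x) (xi x) (xi1 x).
Let quadr x := quad_density Th X (z x) (z1 x) (v x) (v1 x) (zh x) (zh1 x) (vh x) (vh1 x) (th x) (xi x) (xi1 x).

Lemma Int_energy_density : Int dens =
  - ip (fun x => g1 x * (vh x + xi x) + g x * (vh1 x + xi1 x)) th
  - eps * ip (fun x => (zh1 x + th1 x) * (vh x + xi x) + (zh x + th x) * (vh1 x + xi1 x)) th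
  + (1 - l) * eps * ip (fun x => th1 x * xi x + th x * xi1 x) th
  + ip (fun x => (eps * z1 x + g1 x) * v x + (eps * z x + g x) * v1 x) th
  - ip (fun x => zh1 x + th1 x) xi
  - eps * ip (fun x => (vh x + xi x) * (vh1 x + xi1 x)) xi
  + (1 - l) * eps * ip (fun x => xi x * xi1 x) xi
  + ip (fun x => z1 x + eps * (v x * v1 x)) xi.
Proof.
pose a1 x := (g1 x * (vh x + xi x) + g x * (vh1 x + xi1 x)) * th x.
pose a2 x := ((zh1 x + th1 x) * (vh x + xi x) + (zh x + th x) * (vh1 x + xi1 x)) * th x.
pose a3 x := (th1 x * xi x + th x * xi1 x) * th x.
pose a4 x := ((eps * z1 x + g1 x) * v x + (eps * z x + g x) * v1 x) * th x.
pose a5 x := (zh1 x + th1 x) * xi x.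
pose a6 x := (vh x + xi x) * (vh1 x + xi1 x) * xi x.
pose a7 x := xi x * xi1 x * xi x.
pose a8 x := (z1 x + eps * (v x * v1 x)) * xi x.
have c1 : PC a1 by rewrite /a1; pc.
have c2 : PC a2 by rewrite /a2; pc.
have c3 : PC a3 by rewrite /a3; pc.
have c4 : PC a4 by rewrite /a4; pc.
have c5 : PC a5 by rewrite /a5; pc.
have c6 : PC a6 by rewrite /a6; pc.
have c7 : PC a7 by rewrite /a7; pc.
have c8 : PC a8 by rewrite /a8; pc.
have lin c (f h : R -> R) : PC f -> PC h -> PC (fun x => c * f x + h x).
  by move=> cf ch; apply: PCD => //; exact: PCZ.
have L8 := Int_lin ((1 - l) * eps) c7 c8; have d8 := lin ((1 - l) * eps) _ _ c7 c8.
have L7 := Int_lin (- eps) c6 d8; have d7 := lin (- eps) _ _ c6 d8.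
have L6 := Int_lin (-1) c5 d7; have d6 := lin (-1) _ _ c5 d7.
have L5 := Int_lin 1 c4 d6; have d5 := lin 1 _ _ c4 d6.
have L4 := Int_lin ((1 - l) * eps) c3 d5; have d4 := lin ((1 - l) * eps) _ _ c3 d5.
have L3 := Int_lin (- eps) c2 d4; have d3 := lin (- eps) _ _ c2 d4.
have L2 := Int_lin (-1) c1 d3.
rewrite L3 L4 L5 L6 L7 L8 in L2.
rewrite /ip -!/(Int _).
have -> : Int dens = Int (fun x => -1 * a1 x + (- eps * a2 x + ((1 - l) * eps * a3 x + (1 * a4 x + (-1 * a5 x +
  (- eps * a6 x + ((1 - l) * eps * a7 x + a8 x))))))).
  congr Int; apply/funext => x; rewrite /dens /energy_density /a1 /a2 /a3 /a4 /a5 /a6 /a7 /a8.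
  ring.
rewrite L2 -/a1 -/a2 -/a3 -/a4 -/a5 -/a6 -/a7 -/a8.
move: (Int a1) (Int a2) (Int a3) (Int a4) (Int a5) (Int a6) (Int a7) (Int a8) => *; ring.
Qed.

(** Adding [exac] does not change the integral: each term of its primitive E contains a factor xi or
    vh + l xi, which vanishes at both ends whatever th does there. *)
Lemma Int_energy_le :
  (forall i x, (i < size s)%N -> x \in `]node s i, node s i.+1[ ->
    [/\ `|z x| <= M, `|z1 x| <= M, `|v x| <= M & `|v1 x| <= M] /\
    [/\ `|g x| <= M, `|g1 x| <= M, `|zh x - z x| <= M & `|vh x - v x| <= M] /\
    `|th x| <= Th /\ `|xi x| <= X) ->
  Int dens <= 60 * ((1 + eps) * (1 + M)) *
    (ip th th + ip xi xi + ip xi1 xi1 + ip (fun x => zh x - z x) (fun x => zh x - z x)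
      + ip (fun x => zh1 x - z1 x) (fun x => zh1 x - z1 x) + ip (fun x => vh x - v x) (fun x => vh x - v x)
      + ip (fun x => vh1 x - v1 x) (fun x => vh1 x - v1 x)
      + X ^+ 2 * ip (fun x => zh1 x - z1 x) (fun x => zh1 x - z1 x)
      + Th ^+ 2 * ip (fun x => vh1 x - v1 x) (fun x => vh1 x - v1 x)).
Proof.
move=> H.
have cdens : PC dens by rewrite /dens /energy_density; pc.
have cexac : PC exac by rewrite /exac /exact_density; pc.
have cquad : PC quadr by rewrite /quadr /quad_density; pc.
pose E x := eps / 2 * (th x * th x * (vh x + l * xi x)) + th x * xi x + l * eps / 3 * (xi x * xi x * xi x)
   + eps * (xi x * xi x * (vh x - v x)).
have dE : PD E exac.
  have h1 := PDZ (eps / 2) (PDM (PDM dth dth) (PDD dvh (PDZ l dxi))).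
  have h2 := PDZ (l * eps / 3) (PDM (PDM dxi dxi) dxi).
  have h3 := PDZ eps (PDM (PDM dxi dxi) (PDB dvh dv)).
  have := PDD (PDD (PDD h1 (PDM dth dxi)) h2) h3.
  apply: PD_eqc => i si x xi_; rewrite /exac /exact_density.
  move: (th x) (th1 x) (xi x) (xi1 x) (vh x) (vh1 x) (v x) (v1 x) => {xi_} *.
  by field.
have E0 : Int exac = 0.
  rewrite (PD_Int sP cexac dE) /E xi0 xi1_ vh0 vh1_ v0 v1_; ring.
rewrite -[Int dens]addr0 -E0 -(IntD sP cdens cexac).
have IQ : Int quadr = ip th th + ip xi xi + ip xi1 xi1 + ip (fun x => zh x - z x) (fun x => zh x - z x)
      + ip (fun x => zh1 x - z1 x) (fun x => zh1 x - z1 x) + ip (fun x => vh x - v x) (fun x => vh x - v x)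
      + ip (fun x => vh1 x - v1 x) (fun x => vh1 x - v1 x)
      + X ^+ 2 * ip (fun x => zh1 x - z1 x) (fun x => zh1 x - z1 x)
      + Th ^+ 2 * ip (fun x => vh1 x - v1 x) (fun x => vh1 x - v1 x).
  have sqE f : (fun x => f x * f x) = (fun x => f x ^+ 2) by apply/funext => x; rewrite expr2.
  rewrite /ip -!/(Int _) !sqE -(IntZ sP); last by pc.
  rewrite -(IntZ sP); last by pc.
  do 8 (rewrite -(IntD sP); [|by pc|by pc]).
  by [].
rewrite -IQ -(IntZ sP _ cquad).
apply: (le_Int sP); [exact: PCD|exact: PCZ|].
move=> i x si xi_; have [[h1 h2 h3 h4] [[h5 h6 h7 h8] [h9 h10]]] := H i x si xi_.
exact: (energy_density_le (M := M)).
Qed.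

End Integrated.
End Energy.

(** * Projections of the exact solution *)

Section SmoothOnRectangle.
Context {R : realType}.
Variable T : R.
Hypothesis T0 : 0 < T.
Implicit Types (z : R -> R -> R) (t x : R) (f : R -> R).
Local Notation rect := (`[0, T] `*` `[0, 1] : set (R * R)).

Lemma C_rect_cont m z : C_rect T m z -> {within rect, continuous (fun p : R * R => z p.1 p.2)}.
Proof. by case: m => [|m] []. Qed.

Lemma C_rect_deriv m z t x : C_rect T m.+1 z -> t \in `[0, T] -> x \in `[0, 1] ->
  has_deriv `[0, T] (fun r => z r x) t (Dt T z t x) /\ has_deriv `[0, 1] (z t) x (Dx z t x).
Proof.
move=> [_ [D _ _]] tT xI; have [D1 D2] := D t x tT xI.
by split; [exact: (derivable_on_has_deriv T0 tT D1)|exact: (derivable_on_has_deriv ltr01 xI D2)].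
Qed.

Lemma C_rect_Dt m z : C_rect T m.+1 z -> C_rect T m (Dt T z).
Proof. by move=> [_ []]. Qed.

Lemma C_rect_Dx m z : C_rect T m.+1 z -> C_rect T m (Dx z).
Proof. by move=> [_ []]. Qed.

Lemma C_rect_iter m j z : C_rect T (j + m) z -> C_rect T m (iter j (@Dx R) z).
Proof.
elim: j z => [//|j IH] z; rewrite addSn => /C_rect_Dx/IH.
by rewrite -iterSr.
Qed.

Lemma C_rect_le m n z : (m <= n)%N -> C_rect T n z -> C_rect T m z.
Proof.
elim: m n z => [|m IH] n z mn; first by move=> /C_rect_cont.
case: n mn => // n mn [cz [D cDt cDx]]; split=> //.
by split=> //; apply: (IH n).
Qed.

Lemma C_rect_x m z t : C_rect T m z -> t \in `[0, T] -> {within `[0, 1], continuous (z t)}.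
Proof.
move=> /C_rect_cont/subspace_continuousP cz tT; apply/subspace_continuousP => x xI.
have := cz (t, x) (conj tT xI) => /cvgrPdist_le H; apply/cvgrPdist_le => e e0.
have := H e e0; rewrite !near_withinE => /nbhs_ballP[r /= r0 rP].
apply/nbhs_ballP; exists r => //= y yr yI; apply: (rP (t, y)) => //.
by split => //=; apply: ballxx.
Qed.

Lemma C_rect_bounded m z : C_rect T m z ->
  exists2 M, 0 <= M & forall t x, t \in `[0, T] -> x \in `[0, 1] -> `|z t x| <= M.
Proof.
move=> /C_rect_cont cz.
have cR : compact rect by apply: compact_setX; exact: segment_compact.
have /compact_bounded[N [_ NM]] := continuous_compact cz cR.
exists (Num.max 0 (N + 1)); first by rewrite le_max lexx.
move=> t x tT xI; apply: (NM (Num.max 0 (N + 1))); last by exists (t, x).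
by rewrite lt_max [X in _ || X]ltrDl ltr01 orbT.
Qed.

(** The bound on |c - t| is what allows [taylor_bound] to apply the mean value theorem a second
    time, between t and c. *)
Lemma mean_value f (f' : R -> R) t r : (forall t, t \in `[0, T] -> has_deriv `[0, T] f t (f' t)) ->
  t \in `[0, T] -> r \in `[0, T] ->
  exists c, [/\ c \in `[0, T], `|c - t| <= `|r - t| & f r - f t = f' c * (r - t)].
Proof.
move=> df tT rT.
have cf : {within `[0, T], continuous f}.
  by apply/subspace_continuousP => x xI; apply: has_deriv_cont (df x xI).
have D x : x \in `]0, T[ -> is_derive x 1 f (f' x).
  move=> xI; apply: (has_deriv_is_derive xI); apply: df; exact: subset_itv_oo_cc.
have H a b : a \in `[0, T] -> b \in `[0, T] -> a <= b ->
    exists c, [/\ c \in `[0, T], a <= c <= b & f b - f a = f' c * (b - a)].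
  rewrite !in_itv/= => /andP[a0 aT] /andP[b0 bT] ab.
  have Dab x : x \in `]a, b[ -> is_derive x 1 f (f' x).
    rewrite in_itv/= => /andP[x1 x2]; apply: D.
    by rewrite in_itv/= (le_lt_trans a0)// (lt_le_trans x2).
  have cab : {within `[a, b], continuous f}.
    apply: continuous_subspaceW cf => x /=; rewrite !in_itv/= => /andP[x1 x2].
    by rewrite (le_trans a0)// (le_trans x2).
  have [c] := MVT_segment ab Dab cab.
  rewrite in_itv/= => /andP[c1 c2] E; exists c; split=> //; last by rewrite c1.
  by rewrite in_itv/= (le_trans a0)// (le_trans c2).
have [tr|rt] := leP t r.
  have [c [cT /andP[c1 c2] E]] := H t r tT rT tr; exists c; split=> //.
  by rewrite !ger0_norm ?subr_ge0// lerD2r.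
have [c [cT /andP[c1 c2] E]] := H r t rT tT (ltW rt); exists c; split=> //.
  by rewrite distrC [X in _ <= X]distrC !ger0_norm ?subr_ge0// ?(ltW rt)// lerD2l lerN2.
by rewrite -opprB E -mulrN opprB.
Qed.

Lemma taylor_bound f (f' f'' : R -> R) M t r : (forall t, t \in `[0, T] -> has_deriv `[0, T] f t (f' t)) ->
  (forall t, t \in `[0, T] -> has_deriv `[0, T] f' t (f'' t)) ->
  (forall t, t \in `[0, T] -> `|f'' t| <= M) ->
  t \in `[0, T] -> r \in `[0, T] -> `|f r - f t - f' t * (r - t)| <= M * `|r - t| ^+ 2.
Proof.
move=> d1 d2 fM tT rT; have M0 : 0 <= M by apply: le_trans (fM t tT).
have [c [cT ct ->]] := mean_value d1 tT rT.
have [c' [c'T c't E]] := mean_value d2 tT cT.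
rewrite -mulrBl E !normrM expr2 mulrA ler_wpM2r//.
by apply: ler_pM => //; exact: fM.
Qed.

Section WithPartition.
Variable s : seq R.
Hypothesis sP : itv_partition 0 1 s.
Local Notation PC := (PC s).
Local Notation PD := (PD s).

Lemma has_deriv_PD f (f' : R -> R) : (forall x, x \in `[0, 1] -> has_deriv `[0, 1] f x (f' x)) -> PD f f'.
Proof.
move=> df; split.
  by apply/subspace_continuousP => x xI; apply: has_deriv_cont (df x xI).
move=> i x si xi; have xI := cell01 sP si xi.
by apply: (has_deriv_is_derive xI); apply: df; exact: subset_itv_oo_cc.
Qed.

Lemma C_rect_PD m z t : C_rect T m.+1 z -> t \in `[0, T] -> PD (z t) (Dx z t).
Proof. by move=> cz tT; apply: has_deriv_PD => x xI; have [] := C_rect_deriv cz tT xI. Qed.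

Lemma C_rect_PC m z t : C_rect T m z -> t \in `[0, T] -> PC (z t).
Proof. by move=> cz tT; apply: (PC_within sP); exact: C_rect_x cz tT. Qed.

Lemma ip_le_sup f g M : PC f -> PC g -> (forall i x, (i < size s)%N -> x \in `]node s i, node s i.+1[ -> `|f x| <= M) ->
  `|ip f g| <= M * Int (fun x => `|g x|).
Proof.
move=> cf cg fM; have ca := PC_abs cg.
have b i x : (i < size s)%N -> x \in `]node s i, node s i.+1[ -> `|f x * g x| <= M * `|g x|.
  by move=> si xi; rewrite normrM ler_wpM2r// (fM i).
rewrite ler_norml -mulNr -(IntZ sP M ca) -(IntZ sP (- M) ca); apply/andP; split.
  apply: (le_Int sP); [exact: PCZ|exact: PCM|].
  by move=> i x si xi; have := b i x si xi; rewrite ler_norml mulNr => /andP[].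
apply: (le_Int sP); [exact: PCM|exact: PCZ|].
by move=> i x si xi; have := b i x si xi; rewrite ler_norml => /andP[].
Qed.

(** Differentiation under the integral sign by Taylor's formula: the remainder M |r - t|^2 is
    uniform in x. This is why two derivatives are asked of z. *)
Lemma ip_has_deriv z phi t : C_rect T 2 z -> PC phi -> t \in `[0, T] ->
  has_deriv `[0, T] (fun r => ip (z r) phi) t (ip (Dt T z t) phi).
Proof.
move=> cz cphi tT e e0.
have [M M0 MP] := C_rect_bounded (C_rect_Dt (C_rect_Dt cz)).
pose P := Int (fun x => `|phi x|).
have P0 : 0 <= P by apply: (Int_ge0 sP); [exact: PC_abs|move=> *; exact: normr_ge0].
have K0 : 0 < M * P + 1 by rewrite ltr_wpDl// mulr_ge0.
have : \forall r \near t, `|r - t| <= e / (M * P + 1).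
  apply/nbhs_ballP; exists (e / (M * P + 1)); first by rewrite /= divr_gt0.
  by move=> y; rewrite /ball/= distrC => /ltW.
apply: filterS => r rt rT.
have c1 := C_rect_PC cz rT; have c2 := C_rect_PC cz tT; have c3 := C_rect_PC (C_rect_Dt cz) tT.
have S := sip_ip sP.
have -> : ip (z r) phi - ip (z t) phi - ip (Dt T z t) phi * (r - t) =
    ip (fun x => (z r x - z t x) - (r - t) * Dt T z t x) phi.
  by rewrite (sipB S (PCB c1 c2) (PCZ _ c3) cphi) (sipB S c1 c2 cphi) (sipZ S _ c3 cphi) [in RHS]mulrC.
apply: le_trans (_ : M * `|r - t| ^+ 2 * P <= _).
  apply: ip_le_sup => //; first by apply: PCB; [exact: PCB|exact: PCZ].
  move=> i x si xi; have xI : x \in `[0, 1] by apply: subset_itv_oo_cc; exact: cell01 xi.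
  rewrite mulrC; apply: (@taylor_bound (fun r => z r x) (fun r => Dt T z r x) (fun r => Dt T (Dt T z) r x)) => //.
  - by move=> t' t'T; have [] := C_rect_deriv cz t'T xI.
  - by move=> t' t'T; have [] := C_rect_deriv (C_rect_Dt cz) t'T xI.
  - by move=> t' t'T; apply: MP.
have -> : M * `|r - t| ^+ 2 * P = M * P * `|r - t| * `|r - t| by ring.
rewrite ler_wpM2r//; move: rt; rewrite ler_pdivlMr// => rt.
apply: le_trans rt; rewrite mulrC ler_wpM2l// lerDl//.
Qed.

Lemma has_deriv_unique f g t d1 d2 : t \in `[0, T] -> (forall r, r \in `[0, T] -> f r = g r) ->
  has_deriv `[0, T] f t d1 -> has_deriv `[0, T] g t d2 -> d1 = d2.
Proof.
move=> tT fg h1 h2.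
have h3 : has_deriv `[0, T] g t d1 by exact: has_deriv_eq fg h1.
have [_ <-] := (has_derivP g d1 T0 tT).2 h3.
by have [_ <-] := (has_derivP g d2 T0 tT).2 h2.
Qed.

(* Differentiating the identity (u_xx, psi) = - (u_x, psi') in time avoids
   exchanging the order of the derivatives. *)
Lemma ip_Dt_Dx w psi psi1 t : C_rect T 3 w -> PD psi psi1 -> PC psi1 -> psi 0 = 0 -> psi 1 = 0 ->
  t \in `[0, T] -> ip (Dt T (Dx w) t) psi = - ip (Dt T w t) psi1.
Proof.
move=> cw dpsi cpsi p0 p1 tT; have cpsi0 := PD_PC sP dpsi.
have cw2 : C_rect T 2 w by apply: C_rect_le cw.
have h1 := ip_has_deriv (C_rect_Dx cw) cpsi0 tT.
have h2 := has_deriv_lin (-1) (ip_has_deriv cw2 cpsi tT) (has_deriv_cst `[0, T] t 0).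
rewrite addr0 mulN1r in h2; apply: has_deriv_unique tT _ h1 h2 => r rT.
rewrite addr0 mulN1r; apply: (ibp sP (C_rect_PD cw rT) dpsi (C_rect_PC (C_rect_Dx cw) rT) cpsi).
by rewrite p0 p1 !mulr0.
Qed.

End WithPartition.

(** All errors are squared norms, whence the even exponents. The constant comes from the powers of
    (2 h)^2 and a bound M of the r-th derivative, so it is independent of the partition, of k and of
    t. *)
Lemma interpolation_error r z : (2 <= r)%N -> C_rect T r z ->
  exists2 C, 0 <= C & forall s k t, itv_partition 0 1 s -> (k <= r - 2)%N -> t \in `[0, T] ->
  exists Q, [/\ Sh r k s Q, Q 0 = z t 0 & Q 1 = z t 1] /\
    ip (fun x => Dx z t x - derive1 Q x) (fun x => Dx z t x - derive1 Q x) <= C * mesh s ^+ (2 * (r - 1)) /\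
    ip (fun x => z t x - Q x) (fun x => z t x - Q x) <= C * mesh s ^+ (2 * r).
Proof.
move=> r2 cz.
have cr : C_rect T 0 (iter r (@Dx R) z) by apply: C_rect_iter; rewrite addn0.
have [M M0 MP] := C_rect_bounded cr.
exists (4 ^+ r * M ^+ 2); first by rewrite mulr_ge0 ?sqr_ge0.
move=> s k t sP kr tT.
pose vs j := iter j (@Dx R) z t.
have dvs j : (j < r)%N -> PD s (vs j) (vs j.+1).
  move=> jr; apply: (C_rect_PD sP (m := 0)) => //; apply: C_rect_iter.
  by apply: C_rect_le cz; rewrite addn1.
have cvs : PC s (vs r) by exact: (C_rect_PC sP cr tT).
have ipM : ip (vs r) (vs r) <= M ^+ 2.
  rewrite /ip -/(Int _) -[X in _ <= X](Int_cst sP); apply: (le_Int sP); [exact: PCM|exact: PC_cst|].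
  move=> i x si xi; have xI : x \in `[0, 1] by apply: subset_itv_oo_cc; exact: (cell01 sP si).
  rewrite -expr2 -[vs r x ^+ 2]real_normK ?num_real// lerXn2r ?nnegrE//.
  exact: (MP t x tT xI).
have [Q [QS [E1 E2]]] := quasi_interpolation sP r2 kr dvs cvs.
have h0 := mesh_gt0 sP.
exists Q; split=> //.
have e (j : nat) : (2 * mesh s) ^+ 2 ^+ j = 4 ^+ j * mesh s ^+ (2 * j).
  by rewrite [(2 * _) ^+ 2]exprMn exprMn -[mesh s ^+ 2 ^+ j]exprM -[2 ^+ 2]natrX.
have F1 : ip (fun x => vs 1%N x - derive1 Q x) (fun x => vs 1%N x - derive1 Q x) <=
    4 ^+ (r - 1) * mesh s ^+ (2 * (r - 1)) * M ^+ 2.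
  by apply: le_trans E1 _; rewrite e ler_wpM2l// mulr_ge0// exprn_ge0// ltW.
have r1 : r = (r - 1).+1 by rewrite subn1 prednK// ltnW.
split.
  apply: le_trans F1 _; rewrite mulrAC ler_wpM2r ?exprn_ge0 ?(ltW h0)// ler_wpM2r ?sqr_ge0//.
  by rewrite ler_weXn2l ?ler1n// leq_subr.
have E4 : 4 ^+ r = 4 * 4 ^+ (r - 1) :> R by rewrite {1}r1 exprS.
have E5 : mesh s ^+ (2 * r) = mesh s ^+ 2 * mesh s ^+ (2 * (r - 1)) by rewrite -exprD; congr (_ ^+ _); lia.
apply: le_trans E2 _; apply: le_trans (ler_wpM2l (sqr_ge0 _) F1) _.
rewrite E4 E5 exprMn -[2 ^+ 2]natrX le_eqVlt; apply/orP; left; apply/eqP.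
by move: (4 ^+ (r - 1)) (mesh s ^+ (2 * (r - 1))) => p q'; ring.
Qed.

End SmoothOnRectangle.

(** * Errors of the L^2 and elliptic projections, bases of the spaces *)

Section ProjectionErrors.
Context {R : realType}.
Implicit Types (f g h v w : R -> R) (s : seq R) (mu : R).

Lemma sip_tri (W : set (R -> R)) B f g h : sip W B -> W f -> W g -> W h ->
  B (fun x => f x - h x) (fun x => f x - h x) <=
  2 * B (fun x => f x - g x) (fun x => f x - g x) + 2 * B (fun x => g x - h x) (fun x => g x - h x).
Proof.
move=> SB Wf Wg Wh; have WW := sip_W SB.
have W1 : W (fun x => f x - g x) by exact: subB.
have W2 : W (fun x => g x - h x) by exact: subB.
have := sip_sqr SB 1 W1 W2; have := sip_sqr SB (-1) W1 W2.
have e1 : (fun x => 1 * (f x - g x) + (g x - h x)) = (fun x => f x - h x) by apply/funext => x; ring.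
rewrite e1.
have := sip_ge0 SB (WW.2 (-1) _ _ W1 W2).
move: (B _ _) (B _ _) (B _ _) (B _ _) (B _ _) => a b c d e; rewrite !expr2; lra.
Qed.

Section WithPartition.
Variable s : seq R.
Hypothesis sP : itv_partition 0 1 s.
Local Notation PC := (PC s).
Local Notation PD := (PD s).
Local Notation PC1 := (PC1 s).

Lemma form_aE mu f f1 g g1 : PD f f1 -> PD g g1 -> PC f1 -> PC g1 ->
  form_a mu f g = ip f g + mu / 3 * ip f1 g1.
Proof.
move=> df dg cf cg; rewrite /form_a; congr (_ + _ * _).
have h1 := PD_PC1 df cf; have h2 := PD_PC1 dg cg.
by apply: (ip_eqc sP h1.2 h2.2); apply: PD_derive1.
Qed.

Lemma ip_diff_eqc f f1 g g1 : PD f f1 -> PD g g1 -> PC f1 -> PC g1 ->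
  ip (derive1 (fun x => f x - g x)) (derive1 (fun x => f x - g x)) =
  ip (fun x => f1 x - g1 x) (fun x => f1 x - g1 x).
Proof.
move=> df dg cf cg; have h := PD_PC1 (PDB df dg) (PCB cf cg).
by apply: (ip_eqc sP h.2 h.2); apply: PD_derive1; exact: PDB.
Qed.

Lemma Sh0_Sh r k : Sh0 r k s `<=` Sh r k s. Proof. by move=> f []. Qed.

Lemma Sh_PD r k f : Sh r k s f -> PD f (derive1 f).
Proof. by move=> /Sh_PC1[]. Qed.

Lemma Sh_PC_d r k f : Sh r k s f -> PC (derive1 f).
Proof. by move=> /Sh_PC1[]. Qed.

Lemma Sh_PC r k : Sh r k s `<=` PC.
Proof. by move=> f /Sh_PC1/(PC1_PC sP). Qed.

Lemma Sh0_PC1 r k : Sh0 r k s `<=` PC1.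
Proof. by move=> f /Sh0_Sh/Sh_PC1. Qed.

Lemma Sh_basis r k : exists n phi, ortho_family (@ip R) (Sh r k s) n phi /\ spanning (@ip R) (Sh r k s) n phi.
Proof.
apply: (PP_basis (r := r) (sip_ip sP) (sub_Sh s r k) (@Sh_PC r k) (@Sh_PP R s r k)).
move=> f Sf f0; rewrite (ip_eqc sP (Sh_PC Sf) (Sh_PC Sf) f0 f0).
by rewrite (sip0 (sip_ip sP))//; exact: PC_cst.
Qed.

Lemma Sh0_basis r k mu : 0 < mu -> exists n phi,
  ortho_family (form_a mu) (Sh0 r k s) n phi /\ spanning (form_a mu) (Sh0 r k s) n phi.
Proof.
move=> mu0; apply: (PP_basis (r := r) (sip_form_a sP mu0) (sub_Sh0 s r k) (@Sh0_PC1 r k)).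
  by move=> f /Sh0_Sh; exact: Sh_PP.
move=> f /Sh0_Sh Sf f0.
have ff0 := eqc_within sP (Sh_cont Sf) (@within_cst R _ 0) f0.
have d0 : PD f (fun=> 0) by apply: PD_eq01 (PD_cst s 0) => // x xI; rewrite ff0.
rewrite (form_aE mu d0 d0 (@PC_cst R s 0) (@PC_cst R s 0)).
rewrite (ip_eqc sP (Sh_PC Sf) (Sh_PC Sf) f0 f0).
by rewrite !(sip0 (sip_ip sP)) ?mulr0 ?addr0//; exact: PC_cst.
Qed.

(* Indexing both spaces by a single finite type makes the semidiscrete problem one quadratic
   system of ordinary differential equations. *)
Lemma product_basis r k mu : 0 < mu -> exists (I : finType) (Zf Uf : I -> R -> R),
  [/\ forall i, Sh r k s (Zf i), forall i, Sh0 r k s (Uf i),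
      forall i j, ip (Zf i) (Zf j) + form_a mu (Uf i) (Uf j) = (i == j)%:R &
      forall phi chi, Sh r k s phi -> Sh0 r k s chi -> exists c : I -> R, forall x, x \in `[0, 1] ->
        phi x = \sum_i c i * Zf i x /\ chi x = \sum_i c i * Uf i x].
Proof.
move=> mu0; have [n [phi [on sp]]] := Sh_basis r k; have [m [psi [on' sp']]] := Sh0_basis r k mu0.
have Si := sip_ip sP; have Sa := sip_form_a sP mu0.
pose Zf (i : 'I_n + 'I_m) : R -> R := if i is inl a then phi a else fun=> 0.
pose Uf (i : 'I_n + 'I_m) : R -> R := if i is inr a then psi a else fun=> 0.
have S0 := sub_Sh s r k; have S00 := sub_Sh0 s r k.
exists ('I_n + 'I_m)%type, Zf, Uf; split.
- by case=> [a|a] /=; [exact: on.1|exact: S0.1].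
- by case=> [a|a] /=; [exact: S00.1|exact: on'.1].
- have z f : PC f -> ip f (fun=> 0) = 0.
    by move=> cf; rewrite (sip_sym Si cf (@PC_cst R s 0)) (sip0 Si cf).
  have a0 f : PC1 f -> form_a mu (fun=> 0) f = 0 by move=> cf; rewrite (sip0 Sa cf).
  have a0' f : PC1 f -> form_a mu f (fun=> 0) = 0.
    by move=> cf; rewrite (sip_sym Sa cf (sub_PC1 s).1) (sip0 Sa cf).
  have p1 := (sub_PC1 s).1.
  case=> [a|a] [b|b] /=.
  + by rewrite on.2// a0// addr0.
  + by rewrite z ?a0 ?addr0//; [apply: Sh0_PC1; exact: on'.1|apply: Sh_PC; exact: on.1].
  + by rewrite (sip0 Si (Sh_PC (on.1 _ (ltn_ord b)))) (a0' _ (Sh0_PC1 (on'.1 _ (ltn_ord a)))) addr0.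
  + by rewrite on'.2// (sip0 Si (@PC_cst R s 0)) add0r.
- move=> f h Sf Hh.
  pose c (i : 'I_n + 'I_m) := if i is inl a then ip f (phi a) else if i is inr b then form_a mu h (psi b) else 0.
  have E1 x : \sum_i c i * Zf i x = ortho_proj (@ip R) n phi f x.
    by rewrite big_sumType/= [X in _ + X]big1 ?addr0// => i _; rewrite mulr0.
  have E2 x : \sum_i c i * Uf i x = ortho_proj (form_a mu) m psi h x.
    by rewrite big_sumType/= [X in X + _]big1 ?add0r// => i _; rewrite mulr0.
  have N w : Sh r k s w -> ip w w = 0 -> {in `[0, 1], w =1 fun=> 0}.
    move=> Sw w0; apply: (eqc_within sP (Sh_cont Sw) (@within_cst R _ 0)) => i si x xi.
    have h0 := Int_eq0 sP (PCM (Sh_PC Sw) (Sh_PC Sw)) (fun i x _ _ => sqr_ge0 _) w0 si xi.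
    by apply/eqP; rewrite -sqrf_eq0 expr2 h0.
  have Sr : Sh r k s (fun x => f x - ortho_proj (@ip R) n phi f x).
    by apply: subB => //; exact: proj_V.
  have Sr' : Sh0 r k s (fun x => h x - ortho_proj (form_a mu) m psi h x).
    by apply: subB => //; exact: proj_V.
  exists c => x xI; rewrite E1 E2; split; apply/eqP; rewrite -subr_eq0; apply/eqP.
    exact: (N _ Sr (sp _ Sf)).
  (* A residual that is null for the form a is also null in L^2, and continuity then makes it zero
     on [0, 1]. *)
  apply: (N _ (Sh0_Sh Sr') _ _ xI); apply/eqP; rewrite eq_le (sip_ge0 Si (Sh_PC (Sh0_Sh Sr'))) andbT.
  rewrite -(sp' _ Hh) /form_a lerDl; apply: mulr_ge0; first by rewrite divr_ge0// ltW.
  exact: (sip_ge0 Si (Sh_PC_d (Sh0_Sh Sr'))).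
Qed.

End WithPartition.

Variable T : R.
Hypothesis T0 : 0 < T.

(** Best approximation settles the function itself. For the derivative, P is compared with the
    interpolant Q: P - Q lies in S_h and is O(h^r), so the inverse inequality bounds its derivative
    by O(h^(r-1)). Quasiuniformity enters here. *)
Lemma L2_projection_error r q (z : R -> R -> R) : (2 <= r)%N -> C_rect T r z ->
  exists2 C, 0 <= C & forall s k t P, itv_partition 0 1 s -> quasiuniform q s -> (k <= r - 2)%N ->
    t \in `[0, T] -> is_L2_proj (Sh r k s) (z t) P ->
    ip (fun x => P x - z t x) (fun x => P x - z t x) <= C * mesh s ^+ (2 * (r - 1)) /\
    ip (fun x => derive1 P x - Dx z t x) (fun x => derive1 P x - Dx z t x) <= C * mesh s ^+ (2 * (r - 1)).
Proof.
move=> r2 cz; have [C C0 CP] := interpolation_error T0 r2 cz.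
have [Ci Ci0 CiP] := @inverse_inequality R r.
have q2 : 0 <= Ci * q ^+ 2 := mulr_ge0 Ci0 (sqr_ge0 q).
have qC : 0 <= 8 * (Ci * q ^+ 2) * C.
  by rewrite -mulrA; apply: mulr_ge0 => //; exact: mulr_ge0.
exists (8 * (Ci * q ^+ 2) * C + 2 * C); first by apply: addr_ge0 => //; exact: mulr_ge0.
move=> s k t P sP qu kr tT [SP orthP].
have [Q [[SQ _ _] [E1 E2]]] := CP s k t sP kr tT.
have Si := sip_ip sP; have h0 := mesh_gt0 sP.
have cz1 : C_rect T 1 z by apply: C_rect_le cz; exact: ltnW.
have dz := C_rect_PD T0 sP cz1 tT; have cDz := C_rect_PC sP (C_rect_Dx cz1) tT.
have czt := PD_PC sP dz.
have VV := sub_Sh s r k; have VW := @Sh_PC s sP r k.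
have cP := VW _ SP; have cQ := VW _ SQ.
have dP := Sh_PD SP; have cP1 := Sh_PC_d SP; have dQ := Sh_PD SQ; have cQ1 := Sh_PC_d SQ.
have swap f g : ip (fun x => f x - g x) (fun x => f x - g x) = ip (fun x => g x - f x) (fun x => g x - f x).
  by rewrite /ip; congr Rintegral; apply/funext => x; ring.
have best : ip (fun x => z t x - P x) (fun x => z t x - P x) <= C * mesh s ^+ (2 * r).
  apply: le_trans E2; apply: (orth_best Si VV VW czt SP _ SQ) => w Sw.
  by rewrite (sipB Si czt cP (VW _ Sw)) orthP// subrr.
set H := mesh s ^+ (2 * (r - 1)) in E1 *; have H0 : 0 <= H by rewrite exprn_ge0 ?ltW.
have E5 : mesh s ^+ (2 * r) = mesh s ^+ 2 * H by rewrite -exprD; congr (_ ^+ _); rewrite mulnBr -[X in (X + _)%N]muln1 subnKC// leq_mul2l ltnW.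
have h1 : mesh s ^+ 2 <= 1 by rewrite expr_le1 ?(ltW h0)// mesh_le1.
have best' : ip (fun x => P x - z t x) (fun x => P x - z t x) <= C * H.
  rewrite swap; apply: le_trans best _; rewrite E5 ler_wpM2l// ler_piMl//.
split.
  apply: le_trans best' _; rewrite ler_wpM2r//.
  by move: qC; move: (8 * _ * _) => c; lra.
have PQ : ip (fun x => P x - Q x) (fun x => P x - Q x) <= 4 * C * mesh s ^+ (2 * r).
  apply: le_trans (sip_tri Si cP czt cQ) _; rewrite swap.
  by move: best E2; rewrite E5; move: (ip _ _) (ip _ _) => a b; lra.
have SPQ : Sh r k s (fun x => P x - Q x) by apply: subB.
have [_ I2] := CiP s q _ sP qu (Sh_PP SPQ) (Sh_PC1 SPQ).
rewrite (ip_diff_eqc sP dP dQ cP1 cQ1) in I2.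
have I3 : ip (fun x => derive1 P x - derive1 Q x) (fun x => derive1 P x - derive1 Q x) <= 4 * (Ci * q ^+ 2) * C * H.
  apply: le_trans I2 _.
  have -> : 4 * (Ci * q ^+ 2) * C * H = Ci * q ^+ 2 / mesh s ^+ 2 * (4 * C * mesh s ^+ (2 * r)).
    by rewrite E5; field; rewrite gt_eqF.
  by apply: ler_wpM2l => //; apply: divr_ge0 => //; exact: sqr_ge0.
apply: le_trans (sip_tri Si cP1 cQ1 cDz) _.
rewrite [X in _ + 2 * X]swap.
move: I3 E1; move: (ip _ _) (ip _ _) => a b.
have -> : (8 * (Ci * q ^+ 2) * C + 2 * C) * H = 2 * (4 * (Ci * q ^+ 2) * C * H) + 2 * (C * H) by ring.
move: (4 * _ * _ * _) (C * H) => c d; lra.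
Qed.

(** Cea's argument: P is the best approximation in the norm of a, and the interpolant is a
    competitor because it keeps the boundary values. The L^2 error is taken at the rate of the H^1
    error, which is all the theorem asks, so no duality argument is involved. *)
Lemma elliptic_projection_error r mu (u : R -> R -> R) : (2 <= r)%N -> 0 < mu -> C_rect T r u ->
  (forall t, t \in `[0, T] -> u t 0 = 0 /\ u t 1 = 0) ->
  exists2 C, 0 <= C & forall s k t P, itv_partition 0 1 s -> (k <= r - 2)%N ->
    t \in `[0, T] -> is_elliptic_proj mu (Sh0 r k s) (u t) P ->
    ip (fun x => P x - u t x) (fun x => P x - u t x) <= C * mesh s ^+ (2 * (r - 1)) /\
    ip (fun x => derive1 P x - Dx u t x) (fun x => derive1 P x - Dx u t x) <= C * mesh s ^+ (2 * (r - 1)).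
Proof.
move=> r2 mu0 cz bc; have [C C0 CP] := interpolation_error T0 r2 cz.
pose K := (1 + mu / 3) * C.
have K0 : 0 <= K by rewrite /K mulr_ge0// addr_ge0// divr_ge0// ltW.
exists ((1 + 3 / mu) * K); first by rewrite mulr_ge0// addr_ge0// divr_ge0// ltW.
move=> s k t P sP kr tT [SP orthP].
have [Q [[SQ Q0 Q1] [E1 E2]]] := CP s k t sP kr tT.
have [u0 u1] := bc t tT; rewrite u0 in Q0; rewrite u1 in Q1.
have S0Q : Sh0 r k s Q by split.
have Si := sip_ip sP; have Sa := sip_form_a sP mu0; have h0 := mesh_gt0 sP.
have cz1 : C_rect T 1 u by apply: C_rect_le cz; exact: ltnW.
have dz := C_rect_PD T0 sP cz1 tT; have cDz := C_rect_PC sP (C_rect_Dx cz1) tT.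
have czt := PD_PC1 dz cDz.
have VV := sub_Sh0 s r k; have VW := @Sh0_PC1 s r k.
have dP := Sh_PD (Sh0_Sh SP); have cP1 := Sh_PC_d (Sh0_Sh SP).
have dQ := Sh_PD SQ; have cQ1 := Sh_PC_d SQ.
have swap f g : ip (fun x => f x - g x) (fun x => f x - g x) = ip (fun x => g x - f x) (fun x => g x - f x).
  by rewrite /ip; congr Rintegral; apply/funext => x; ring.
have best : form_a mu (fun x => u t x - P x) (fun x => u t x - P x) <=
    form_a mu (fun x => u t x - Q x) (fun x => u t x - Q x).
  apply: (orth_best Sa VV VW czt SP _ S0Q) => w Sw.
  by rewrite (sipB Sa czt (VW _ SP) (VW _ Sw)) orthP// subrr.
rewrite (form_aE sP mu (PDB dz dP) (PDB dz dP) (PCB cDz cP1) (PCB cDz cP1)) in best.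
rewrite (form_aE sP mu (PDB dz dQ) (PDB dz dQ) (PCB cDz cQ1) (PCB cDz cQ1)) in best.
rewrite swap [in X in _ /\ X]swap.
set H := mesh s ^+ (2 * (r - 1)) in E1 *; have H0 : 0 <= H by rewrite exprn_ge0 ?ltW.
have E5 : mesh s ^+ (2 * r) = mesh s ^+ 2 * H by rewrite -exprD; congr (_ ^+ _); rewrite mulnBr -[X in (X + _)%N]muln1 subnKC// leq_mul2l ltnW.
have h1 : mesh s ^+ 2 <= 1 by rewrite expr_le1 ?(ltW h0)// mesh_le1.
have E2' : ip (fun x => u t x - Q x) (fun x => u t x - Q x) <= C * H.
  by apply: le_trans E2 _; rewrite E5 ler_wpM2l// ler_piMl.
have p1 := sip_ge0 Si (PCB (PD_PC sP dz) (PD_PC sP dP)).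
have p2 := sip_ge0 Si (PCB cDz cP1).
have bK : ip (fun x => u t x - P x) (fun x => u t x - P x) +
    mu / 3 * ip (fun x => Dx u t x - derive1 P x) (fun x => Dx u t x - derive1 P x) <= K * H.
  apply: le_trans best _; rewrite /K mulrDl mulrDl mul1r -(mulrA (mu / 3)); apply: lerD => //.
  by rewrite ler_wpM2l// divr_ge0// ltW.
move: bK p1 p2; move: (ip _ _) (ip _ _) => b a bK a0 b0.
have KH : 0 <= K * H by rewrite mulr_ge0.
have m0 : 0 < mu / 3 by rewrite divr_gt0.
have m1 : 0 < 3 / mu by rewrite divr_gt0.
rewrite -mulrA; split.
  apply: (@le_trans _ _ (K * H)); first by apply: le_trans bK; rewrite lerDl mulr_ge0// ltW.
  by rewrite ler_peMl// lerDl ltW.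
apply: (@le_trans _ _ (3 / mu * (K * H))); last by rewrite ler_wpM2r// lerDr.
have -> : b = 3 / mu * (mu / 3 * b) by field; rewrite gt_eqF.
rewrite ler_pM2l//; apply: le_trans bK; rewrite lerDr//.
Qed.

End ProjectionErrors.

(** * The semidiscrete problem in coordinates *)

Section EvaluationPoints.
Context {R : realType} {I : finType} {P : Type}.
Variables (Q : set P) (F : I -> P -> R).
Hypothesis indep : forall c : I -> R, (forall p, Q p -> \sum_i c i * F i p = 0) -> forall i, c i = 0.
Local Notation row_at p := (\row_(a < #|I|) F (enum_val a) p).

Lemma sum_enum (f : I -> R) : \sum_i f i = \sum_(a < #|I|) f (enum_val a).
Proof. by rewrite (reindex (@enum_val I I))//; apply: onW_bij; exact: enum_val_bij. Qed.

(** If the points chosen so far give rank exactly d < #|I|, a nonzero column of the cokernel is a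
    combination vanishing at all of them. Independence provides a point where it does not vanish,
    and the row of that point raises the rank. *)
Lemma row_at_rank d : (d <= #|I|)%N -> exists N (p : 'I_N -> P), (forall k, Q (p k)) /\
  (d <= \rank (\matrix_(k < N) row_at (p k)))%N.
Proof.
elim: d => [_|d IH dI].
  have p0 : 'I_0 -> P by case.
  by exists 0, p0; split=> // -[].
have [N [p [Qp rk]]] := IH (ltnW dI); set M := \matrix_k _ in rk.
have [rk'|] := ltnP d (\rank M); first by exists N, p.
move=> rkd; have {}rk : \rank M = d by apply/eqP; rewrite eqn_leq rkd.
have co : cokermx M != 0 by rewrite -mxrank_eq0 mxrank_coker rk subn_eq0 -ltnNge.
have [j cj] : exists j, col j (cokermx M) != 0.
  apply: contrapT => H; case/eqP: co; apply/matrixP => a j; rewrite mxE.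
  apply: contrapT => /eqP aj; apply: H; exists j; apply: contra_neq aj => /colP/(_ a).
  by rewrite !mxE.
have [p' [Qp' np']] : exists p', Q p' /\ row_at p' *m cokermx M != 0.
  apply: contrapT => H; case/eqP: cj; apply/colP => a; rewrite mxE [RHS]mxE.
  have := @indep (fun i => cokermx M (enum_rank i) j) _ (enum_val a).
  rewrite enum_valK; apply => x Qx.
  have : row_at x *m cokermx M = 0 by apply: contrapT => /eqP ?; apply: H; exists x.
  move=> /matrixP/(_ ord0 j); rewrite mxE [X in _ = X]mxE => E; rewrite -[RHS]E sum_enum; apply: eq_bigr => b _.
  by rewrite enum_valK mulrC; congr (_ * _); rewrite mxE.
pose p1 (k : 'I_N.+1) := if unlift ord0 k is Some k' then p k' else p'.
exists N.+1, p1; split=> [k|]; first by rewrite /p1; case: unliftP => [? _|_].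
rewrite -rk; apply: rank_ltmx; rewrite ltmxE; apply/andP; split.
  apply/row_subP => k; rewrite rowK.
  have -> : row_at (p k) = row (lift ord0 k) (\matrix_k0 row_at (p1 k0)).
    by rewrite rowK /p1 liftK.
  exact: row_sub.
apply: contra np' => H; rewrite -submxE; apply: submx_trans H.
have -> : row_at p' = row ord0 (\matrix_k0 row_at (p1 k0)) by rewrite rowK /p1 unlift_none.
exact: row_sub.
Qed.

(** The evaluation matrix has full column rank, and W consists of the entries of a left inverse. *)
Lemma coord_from_values : exists N (p : 'I_N -> P) (W : I -> 'I_N -> R), (forall k, Q (p k)) /\
  forall (c : I -> R) i, c i = \sum_k W i k * \sum_j c j * F j (p k).
Proof.
have [N [p [Qp rk]]] := row_at_rank (leqnn #|I|); set M := \matrix_k _ in rk.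
have /row_fullP[B BM] : row_full M by rewrite /row_full eqn_leq rk rank_leq_col.
exists N, p, (fun i k => B (enum_rank i) k); split=> // c i.
pose v := \col_(a < #|I|) c (enum_val a).
have := mulmxA B M v; rewrite BM mul1mx => /matrixP/(_ (enum_rank i) ord0).
rewrite !mxE enum_rankK => <-; apply: eq_bigr => k _; congr (_ * _).
by rewrite mxE [RHS]sum_enum; apply: eq_bigr => a _; rewrite !mxE mulrC.
Qed.

End EvaluationPoints.

(** * The semidiscrete vector field and its energy inequality *)

Section GalerkinSystem.
Context {R : realType} {I : finType}.
Implicit Types (y e : I -> R) (F f w : R -> R).
Variable s : seq R.
Hypothesis sP : itv_partition 0 1 s.
Local Notation PC := (PC s).
Local Notation PD := (PD s).
Local Notation PC1 := (PC1 s).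

Definition comb (J : finType) (F : J -> R -> R) (c : J -> R) : R -> R := fun x => \sum_j c j * F j x.

Lemma comb_sub (W : set (R -> R)) (J : finType) (F : J -> R -> R) c : subspace_fun W ->
  (forall j, W (F j)) -> W (comb F c).
Proof.
move=> WW WF; rewrite /comb; elim: (index_enum J) => [|j l IH].
  by rewrite (_ : (fun _ => _) = fun=> 0); [exact: WW.1|apply/funext => x; rewrite big_nil].
rewrite (_ : (fun _ => _) = fun x => c j * F j x + \sum_(j <- l) c j * F j x); first exact: WW.2.
by apply/funext => x; rewrite big_cons.
Qed.

Lemma PD_comb (J : finType) (F F1 : J -> R -> R) c : (forall j, PD (F j) (F1 j)) -> PD (comb F c) (comb F1 c).
Proof.
move=> dF; rewrite /comb; elim: (index_enum J) => [|j l IH].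
  have E G : (fun x => \sum_(i <- [::]) c i * G i x) = (fun=> 0) :> (R -> R).
    by apply/funext => x; rewrite big_nil.
  by rewrite !E; exact: PD_cst.
have E G : (fun x => \sum_(i <- j :: l) c i * G i x) = fun x => c j * G j x + \sum_(i <- l) c i * G i x.
  by apply/funext => x; rewrite big_cons.
by rewrite !E; exact: PDD (PDZ _ (dF j)) IH.
Qed.

Lemma combD (J : finType) (F : J -> R -> R) (c d : J -> R) x : comb F (fun j => c j + d j) x = comb F c x + comb F d x.
Proof. by rewrite /comb -big_split; apply: eq_bigr => j _; rewrite mulrDl. Qed.

Lemma combB (J : finType) (F : J -> R -> R) (c d : J -> R) x : comb F (fun j => c j - d j) x = comb F c x - comb F d x.
Proof. by rewrite /comb -sumrB; apply: eq_bigr => j _; rewrite mulrBl. Qed.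

Lemma comb0 (J : finType) (F : J -> R -> R) c x : (forall j, F j x = 0) -> comb F c x = 0.
Proof. by move=> F0; rewrite /comb big1// => j _; rewrite F0 mulr0. Qed.

Lemma comb_mul (J K : finType) (F : J -> R -> R) (G : K -> R -> R) c d x :
  comb F c x * comb G d x = comb (fun p : J * K => fun x => F p.1 x * G p.2 x) (fun p => c p.1 * d p.2) x.
Proof.
rewrite /comb mulr_suml -(pair_bigA _ (fun j k => c j * d k * (F j x * G k x))); apply: eq_bigr => j _.
by rewrite mulr_sumr; apply: eq_bigr => k _; rewrite mulrACA.
Qed.

Lemma ipC f w : ip f w = ip w f.
Proof. by rewrite /ip; congr Rintegral; apply/funext => x; rewrite mulrC. Qed.

Lemma ip_comb (J : finType) (F : J -> R -> R) c w : (forall j, PC (F j)) -> PC w ->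
  ip (comb F c) w = \sum_j c j * ip (F j) w.
Proof.
move=> cF cw; rewrite /ip -!/(Int _).
rewrite -(Int_sum sP (index_enum J) c (f := fun j x => F j x * w x)); last by move=> j; exact: PCM.
congr Int; apply/funext => x; rewrite /comb mulr_suml; apply: eq_bigr => j _; by rewrite mulrA.
Qed.

Lemma ip_combr (J : finType) (F : J -> R -> R) c w : (forall j, PC (F j)) -> PC w ->
  ip w (comb F c) = \sum_j c j * ip w (F j).
Proof. by move=> cF cw; rewrite ipC ip_comb//; apply: eq_bigr => j _; rewrite ipC. Qed.

Variables (eps mu : R) (g g1 : R -> R) (Zf Uf : I -> R -> R).
Hypotheses (eps0 : 0 < eps) (mu0 : 0 < mu) (dg : PD g g1) (cg1 : PC g1).
Hypotheses (PZ : forall i, PC1 (Zf i)) (PU : forall i, PC1 (Uf i)).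
Hypotheses (U0 : forall i, Uf i 0 = 0) (U1 : forall i, Uf i 1 = 0).
Local Notation Zf1 := (fun i => derive1 (Zf i)).
Local Notation Uf1 := (fun i => derive1 (Uf i)).

Let dZ i : PD (Zf i) (Zf1 i). Proof. exact: (PZ i).1. Qed.
Let dU i : PD (Uf i) (Uf1 i). Proof. exact: (PU i).1. Qed.
Let cZ i : PC (Zf i). Proof. exact: PC1_PC. Qed.
Let cU i : PC (Uf i). Proof. exact: PC1_PC. Qed.
Let cZ1 i : PC (Zf1 i). Proof. exact: (PZ i).2. Qed.
Let cU1 i : PC (Uf1 i). Proof. exact: (PU i).2. Qed.
Let cg : PC g := PD_PC sP dg.

Let cc (J : finType) (F : J -> R -> R) c : (forall j, PC (F j)) -> PC (comb F c).
Proof. by move=> cF; apply: (comb_sub c (sub_PC s) cF). Qed.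

(** Entry i is the sum of the two equations tested with the pair ([Zf i], [Uf i]). For a family
    orthonormal for (., .) + a(., .) nothing has to be inverted, and [galA], [galB] are the linear
    and quadratic parts of the time derivative. *)
Definition galA i j : R :=
  - ip (fun x => g1 x * Uf j x + g x * Uf1 j x) (Zf i) - ip (Zf1 j) (Uf i).
Definition galB i j k : R :=
  - eps * ip (fun x => Zf1 j x * Uf k x + Zf j x * Uf1 k x) (Zf i)
  - eps * ip (fun x => Uf j x * Uf1 k x) (Uf i).

Lemma quad_galB e i : quad galB e i =
  - eps * ip (fun x => comb Zf1 e x * comb Uf e x + comb Zf e x * comb Uf1 e x) (Zf i)
  - eps * ip (fun x => comb Uf e x * comb Uf1 e x) (Uf i).
Proof.
pose c (p : I * I) := e p.1 * e p.2.
have -> : (fun x => comb Zf1 e x * comb Uf e x + comb Zf e x * comb Uf1 e x) =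
    comb (fun p : I * I => fun x => Zf1 p.1 x * Uf p.2 x + Zf p.1 x * Uf1 p.2 x) c.
  apply/funext => x; by rewrite !comb_mul -[LHS]big_split; apply: eq_bigr => p _; rewrite /= -mulrDr.
have -> : (fun x => comb Uf e x * comb Uf1 e x) = comb (fun p : I * I => fun x => Uf p.1 x * Uf1 p.2 x) c.
  by apply/funext => x; rewrite comb_mul.
rewrite !ip_comb//; [|by move=> p; exact: PCM|by move=> p; apply: PCD; exact: PCM].
rewrite !mulr_sumr -sumrB /quad pair_bigA; apply: eq_bigr => p _; rewrite /galB /c.
by move: (ip _ _) (ip _ _) => a b; ring.
Qed.

Lemma vfield_gal y i : vfield galA galB y i =
  - ip (fun x => g1 x * comb Uf y x + g x * comb Uf1 y x) (Zf i) - ip (comb Zf1 y) (Uf i)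
  - eps * ip (fun x => comb Zf1 y x * comb Uf y x + comb Zf y x * comb Uf1 y x) (Zf i)
  - eps * ip (fun x => comb Uf y x * comb Uf1 y x) (Uf i).
Proof.
rewrite /vfield quad_galB.
have -> : (fun x => g1 x * comb Uf y x + g x * comb Uf1 y x) =
    comb (fun j x => g1 x * Uf j x + g x * Uf1 j x) y.
  apply/funext => x; rewrite /comb !mulr_sumr -big_split; apply: eq_bigr => j _ /=; ring.
rewrite !ip_comb//; last by move=> j; apply: PCD; exact: PCM.
rewrite -!sumrN -big_split addrA/= mulNr; congr (_ - _ - _); apply: eq_bigr => j _; rewrite /galA.
by move: (ip _ _) (ip _ _) => a b; ring.
Qed.

(* The inner parenthesis is the time derivative of the coordinates of the projections of the
   exact solution (exact_residual). *)
Lemma energy_gal l e Yt (z z1 v v1 : R -> R) : PD z z1 -> PD v v1 -> PC z1 -> PC v1 ->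
  \sum_i e i * (vfield galA galB (fun i => Yt i + e i) i - (1 - l) * quad galB e i -
    (- ip (fun x => (eps * z1 x + g1 x) * v x + (eps * z x + g x) * v1 x) (Zf i)
     - ip (fun x => z1 x + eps * (v x * v1 x)) (Uf i))) =
  Int (fun x => energy_density eps l (z x) (z1 x) (v x) (v1 x) (g x) (g1 x) (comb Zf Yt x) (comb Zf1 Yt x)
    (comb Uf Yt x) (comb Uf1 Yt x) (comb Zf e x) (comb Zf1 e x) (comb Uf e x) (comb Uf1 e x)).
Proof.
move=> dz dv cz1 cv1; have cz := PD_PC sP dz; have cv := PD_PC sP dv.
have D (F F1 : I -> R -> R) c : (forall j, PD (F j) (F1 j)) -> PD (comb F c) (comb F1 c) by exact: PD_comb.
rewrite (Int_energy_density sP eps l dz dv dg (D _ _ Yt dZ) (D _ _ Yt dU) (D _ _ e dZ) (D _ _ e dU)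
  cz1 cv1 cg1 (cc Yt cZ1) (cc Yt cU1) (cc e cZ1) (cc e cU1)).
rewrite !ip_combr//; try by repeat first [exact: cz1 | exact: cv1 | exact: cg1 | exact: cz | exact: cv | exact: cg | exact: cc
  | exact: PC_cst | apply: PCD | apply: PCM].
rewrite !mulr_sumr -!sumrN -!big_split; apply: eq_bigr => i _ /=.
rewrite vfield_gal quad_galB.
have E (F : I -> R -> R) : comb F (fun i => Yt i + e i) = fun x => comb F Yt x + comb F e x by apply/funext => x; exact: combD.
rewrite !E.
move: (ip _ _) (ip _ _) (ip _ _) (ip _ _) (ip _ _) (ip _ _) (ip _ _) (ip _ _) => a1 a2 a3 a4 a5 a6 a7 a8.
ring.
Qed.

Hypothesis orth : forall i j, ip (Zf i) (Zf j) + form_a mu (Uf i) (Uf j) = (i == j)%:R.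

(** Parseval's identity: the Euclidean norm of the coordinates is the energy of the pair of
    functions. *)
Lemma sqn_gal e : sqn e =
  ip (comb Zf e) (comb Zf e) + (ip (comb Uf e) (comb Uf e) + mu / 3 * ip (comb Uf1 e) (comb Uf1 e)).
Proof.
rewrite !ip_comb//; try exact: cc.
rewrite mulr_sumr -!big_split; apply: eq_bigr => i _ /=.
rewrite !ip_combr//.
have -> : e i * (\sum_j e j * ip (Zf i) (Zf j)) + (e i * (\sum_j e j * ip (Uf i) (Uf j)) +
    mu / 3 * (e i * (\sum_j e j * ip (Uf1 i) (Uf1 j)))) = e i * (\sum_j e j * (i == j)%:R).
  rewrite [mu / 3 * _]mulrCA -!mulrDr; congr (_ * _); rewrite mulr_sumr -!big_split.
  apply: eq_bigr => j _; rewrite -orth /form_a; move: (ip _ _) (ip _ _) (ip _ _) => a b c /=; ring.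
rewrite (bigD1 i)//= eqxx mulr1 big1 ?addr0 ?expr2// => j ji.
by rewrite eq_sym (negbTE ji) mulr0.
Qed.

Lemma norm_le_sqrt (a b : R) : a ^+ 2 <= b -> `|a| <= Num.sqrt b.
Proof. by move=> ab; rewrite -sqrtr_sqr ler_wsqrtr. Qed.

(** [Int_energy_le] is applied with Th^2 = kappa |th|^2, from the inverse inequality, and X^2 =
    |xi'|^2, from xi(0) = 0. The summands with X^2 and Th^2 are then at most |xi'|^2 and |th|^2,
    because delta <= 1 and kappa delta <= 1; this doubles 60 to 120, and four projection errors give
    240. The factor 1 + 3 / mu recovers |xi'|^2 from a(xi, xi). *)
Lemma energy_gal_le M kappa delta l e Yt (z z1 v v1 : R -> R) :
  PD z z1 -> PD v v1 -> PC z1 -> PC v1 -> v 0 = 0 -> v 1 = 0 -> 2 <= M -> 0 < kappa ->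
  (forall x, x \in `[0, 1] -> [/\ `|z x| <= M, `|z1 x| <= M, `|v x| <= M & `|v1 x| <= M] /\
    `|g x| <= M /\ `|g1 x| <= M) ->
  (forall i x, (i < size s)%N -> x \in `]node s i, node s i.+1[ ->
    comb Zf e x ^+ 2 <= kappa * ip (comb Zf e) (comb Zf e)) ->
  ip (fun x => comb Zf Yt x - z x) (fun x => comb Zf Yt x - z x) <= delta ->
  ip (fun x => comb Zf1 Yt x - z1 x) (fun x => comb Zf1 Yt x - z1 x) <= delta ->
  ip (fun x => comb Uf Yt x - v x) (fun x => comb Uf Yt x - v x) <= delta ->
  ip (fun x => comb Uf1 Yt x - v1 x) (fun x => comb Uf1 Yt x - v1 x) <= delta ->
  delta <= 1 -> kappa * delta <= 1 -> 0 <= l -> l <= 1 -> l * (kappa * sqn e) <= 1 ->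
  \sum_i e i * (vfield galA galB (fun i => Yt i + e i) i - (1 - l) * quad galB e i -
    (- ip (fun x => (eps * z1 x + g1 x) * v x + (eps * z x + g x) * v1 x) (Zf i)
     - ip (fun x => z1 x + eps * (v x * v1 x)) (Uf i))) <=
  120 * ((1 + eps) * (1 + M)) * (1 + 3 / mu) * sqn e + 240 * ((1 + eps) * (1 + M)) * delta.
Proof.
move=> dz dv cz1 cv1 v0 v1_ M2 k0 bM inv E1 E2 E3 E4 d1 kd l0 l1 le; rewrite energy_gal//.
have Si := sip_ip sP.
have D (F F1 : I -> R -> R) c : (forall j, PD (F j) (F1 j)) -> PD (comb F c) (comb F1 c) by exact: PD_comb.
have S := sqn_gal e.
have a0 := sip_ge0 Si (cc e cZ); have b0 := sip_ge0 Si (cc e cU); have c0 := sip_ge0 Si (cc e cU1).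
have dxi := D _ _ e dU; have dth := D _ _ e dZ; have dzh := D _ _ Yt dZ; have dvh := D _ _ Yt dU.
have xi0 : comb Uf e 0 = 0 by exact: comb0.
have xi1_ : comb Uf e 1 = 0 by exact: comb0.
set a := ip (comb Zf e) (comb Zf e) in S a0 inv *; set b := ip (comb Uf e) (comb Uf e) in S b0.
set c := ip (comb Uf1 e) (comb Uf1 e) in S c0.
have M0 : 0 <= M by apply: le_trans M2.
have m0 : 0 <= mu / 3 * c by rewrite mulr_ge0// divr_ge0// ltW.
(* By the Sobolev inequality the projection errors are at most 2 in the sup norm, as delta <= 1;
   hence the requirement 2 <= M. *)
have close f f1 x : PD f f1 -> PC f1 -> ip f f <= delta -> ip f1 f1 <= delta -> x \in `[0, 1] -> `|f x| <= M.
  move=> df cf h1 h2 xI; rewrite -[X in _ <= X](ger0_norm M0) -[X in _ <= X]sqrtr_sqr; apply: norm_le_sqrt.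
  apply: le_trans (sqr_le_H1 sP df cf xI) _.
  have M4 : 2 * 2 <= M ^+ 2 by rewrite expr2; apply: ler_pM.
  by move: (ip _ _) (ip _ _) h1 h2 => p q h1 h2; lra.
have X2 : Num.sqrt c ^+ 2 = c by rewrite sqr_sqrtr.
have T2 : Num.sqrt (kappa * a) ^+ 2 = kappa * a by rewrite sqr_sqrtr// mulr_ge0// ltW.
(* Since l <= 1, (l Th)^2 <= l Th^2 <= l kappa |e|^2 <= 1. *)
have lT : l * Num.sqrt (kappa * a) <= 1.
  have ka0 : 0 <= kappa * a by rewrite mulr_ge0// ltW.
  rewrite -[X in _ <= X]sqrtr1 -[X in X * _](ger0_norm l0) -sqrtr_sqr -sqrtrM ?sqr_ge0// ler_wsqrtr//.
  apply: le_trans le; rewrite expr2 -mulrA; apply: ler_pM => //.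
    by rewrite mulr_ge0.
  apply: le_trans (_ : kappa * a <= _); first exact: ler_piMl.
  by rewrite ler_pM2l// S lerDl addr_ge0.
have := @Int_energy_le R s sP eps l M (Num.sqrt (kappa * a)) (Num.sqrt c) eps0 l0 M2 lT (sqrtr_ge0 _) (sqrtr_ge0 _)
  z z1 v v1 g g1 (comb Zf Yt) (comb Zf1 Yt) (comb Uf Yt) (comb Uf1 Yt) (comb Zf e) (comb Zf1 e) (comb Uf e)
  (comb Uf1 e) dz dv dg dzh dvh dth dxi cz1 cv1 cg1 (cc Yt cZ1) (cc Yt cU1) (cc e cZ1) (cc e cU1) v0 v1_
  (comb0 _ U0) (comb0 _ U1) xi0 xi1_.
rewrite -/a -/b -/c X2 T2 => H; apply: le_trans (H _) _ => {H}.
  move=> i x si xi; have xI : x \in `[0, 1] by apply: subset_itv_oo_cc; exact: cell01 xi.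
  have [[h1 h2 h3 h4] [h5 h6]] := bM x xI; split=> //; split.
    split=> //.
    - exact: (close _ _ x (PDB dzh dz) (PCB (cc Yt cZ1) cz1)).
    - exact: (close _ _ x (PDB dvh dv) (PCB (cc Yt cU1) cv1)).
  split; apply: norm_le_sqrt; first exact: (inv i).
  have := sqr_diff_le sP dxi (cc e cU1) xI in01_0; by rewrite xi0 subr0.
have p2 := sip_ge0 Si (PCB (cc Yt cZ1) cz1); have p4 := sip_ge0 Si (PCB (cc Yt cU1) cv1).
rewrite S; move: E1 E2 E3 E4 p2 p4 => {inv bM close}.
move: (ip _ _) (ip _ _) (ip _ _) (ip _ _) => r1 r2 s1 s2 E1 E2 E3 E4 p2 p4.
have G0 : 0 <= 60 * ((1 + eps) * (1 + M)) by rewrite !mulr_ge0// addr_ge0// ltW.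
have Q : a + b + c <= (1 + 3 / mu) * (a + (b + mu / 3 * c)).
  have -> : (1 + 3 / mu) * (a + (b + mu / 3 * c)) = a + b + c + (mu / 3 * c + 3 / mu * (a + b)).
    by field; rewrite gt_eqF.
  by rewrite lerDl addr_ge0// mulr_ge0 ?addr_ge0// divr_ge0// ltW.
have -> : 120 * ((1 + eps) * (1 + M)) * (1 + 3 / mu) * (a + (b + mu / 3 * c)) + 240 * ((1 + eps) * (1 + M)) * delta =
    60 * ((1 + eps) * (1 + M)) * (2 * ((1 + 3 / mu) * (a + (b + mu / 3 * c))) + 4 * delta) by ring.
apply: ler_wpM2l => //.
have B1 : c * s1 <= c by apply: ler_piMr => //; apply: le_trans d1.
have B2 : kappa * a * r1 <= a.
  rewrite (mulrC kappa) -mulrA; apply: ler_piMr => //; apply: le_trans kd.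
  by rewrite ler_pM2l.
move: B1 B2 Q b0 E1 E2 E3 E4; move: (c * s1) (kappa * a * r1) ((1 + 3 / mu) * _) => u v' w.
by clearbody a b c; lra.
Qed.

End GalerkinSystem.

(** * The weak equations in coordinates *)

Section WeakForm.
Context {R : realType} {I : finType}.
Variable s : seq R.
Hypothesis sP : itv_partition 0 1 s.
Local Notation PC := (PC s).
Local Notation PD := (PD s).
Local Notation PC1 := (PC1 s).
Variables (eps mu : R) (g g1 : R -> R) (Zf Uf : I -> R -> R).
Hypotheses (mu0 : 0 < mu) (dg : PD g g1) (cg1 : PC g1).
Hypotheses (PZ : forall i, PC1 (Zf i)) (PU : forall i, PC1 (Uf i)).
Hypothesis orth : forall i j, ip (Zf i) (Zf j) + form_a mu (Uf i) (Uf j) = (i == j)%:R.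
Local Notation Zf1 := (fun i => derive1 (Zf i)).
Local Notation Uf1 := (fun i => derive1 (Uf i)).

Let dZ i : PD (Zf i) (Zf1 i). Proof. exact: (PZ i).1. Qed.
Let dU i : PD (Uf i) (Uf1 i). Proof. exact: (PU i).1. Qed.
Let cZ i : PC (Zf i). Proof. exact: PC1_PC. Qed.
Let cU i : PC (Uf i). Proof. exact: PC1_PC. Qed.
Let cZ1 i : PC (Zf1 i). Proof. exact: (PZ i).2. Qed.
Let cU1 i : PC (Uf1 i). Proof. exact: (PU i).2. Qed.
Let cg : PC g := PD_PC sP dg.
Let cc (F : I -> R -> R) c : (forall j, PC (F j)) -> PC (comb F c).
Proof. by move=> cF; apply: (comb_sub c (sub_PC s) cF). Qed.

Lemma eqc01 (f h : R -> R) : {in `[0, 1], f =1 h} -> eqc s f h.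
Proof. by move=> fh i si x xi; apply: fh; apply: subset_itv_oo_cc; exact: cell01 xi. Qed.

(** The weak equation as a function of the coordinates y of the solution and d of its time
    derivative, with products already differentiated. The formulation with [derive1] is reduced to
    it for any functions that agree with the combinations on [0, 1]. *)
Definition mass_form d y phi :=
  ip (comb Zf d) phi + eps * ip (fun x => comb Zf1 y x * comb Uf y x + comb Zf y x * comb Uf1 y x) phi
    + ip (fun x => g1 x * comb Uf y x + g x * comb Uf1 y x) phi.

Definition momentum_form d y chi :=
  ip (comb Uf d) chi + mu / 3 * ip (comb Uf1 d) (derive1 chi) + ip (comb Zf1 y) chi
    + eps * ip (fun x => comb Uf y x * comb Uf1 y x) chi.

Lemma mass_formE d y (zt zh uh phi phi' : R -> R) : {in `[0, 1], zt =1 comb Zf d} ->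
  {in `[0, 1], zh =1 comb Zf y} -> {in `[0, 1], uh =1 comb Uf y} -> PC phi' -> {in `[0, 1], phi =1 phi'} ->
  ip zt phi + eps * ip (derive1 (fun x => zh x * uh x)) phi + ip (derive1 (fun x => g x * uh x)) phi =
  mass_form d y phi'.
Proof.
move=> zt_ zh_ uh_ cp p_; have ep := @eqc01 phi' phi (fun x xI => esym (p_ x xI)).
have dz : PD zh (comb Zf1 y) by apply: PD_eq01 (PD_comb y dZ) => // x xI; rewrite zh_.
have du : PD uh (comb Uf1 y) by apply: PD_eq01 (PD_comb y dU) => // x xI; rewrite uh_.
have e1 := PD_derive1 (PDM dz du); have e2 := PD_derive1 (PDM dg du).
symmetry; rewrite /mass_form; congr (_ + _ * _ + _); apply: (ip_eqc sP) => //.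
- exact: cc.
- by apply: eqc01 => x xI; rewrite zt_.
- by apply: PCD; apply: PCM; exact: cc.
- move=> i si x xi; rewrite (e1 i si x xi).
  have xI : x \in `[0, 1] by apply: subset_itv_oo_cc; exact: cell01 xi.
  by rewrite zh_// uh_.
- by apply: PCD; apply: PCM => //; exact: cc.
- move=> i si x xi; rewrite (e2 i si x xi).
  have xI : x \in `[0, 1] by apply: subset_itv_oo_cc; exact: cell01 xi.
  by rewrite uh_.
Qed.

Lemma momentum_formE d y (ut zh uh chi chi' : R -> R) : {in `[0, 1], ut =1 comb Uf d} ->
  {in `[0, 1], zh =1 comb Zf y} -> {in `[0, 1], uh =1 comb Uf y} -> PC1 chi' -> {in `[0, 1], chi =1 chi'} ->
  form_a mu ut chi + ip (derive1 zh) chi + eps * ip (fun x => uh x * derive1 uh x) chi =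
  momentum_form d y chi'.
Proof.
move=> ut_ zh_ uh_ cp p_; have ep := @eqc01 chi' chi (fun x xI => esym (p_ x xI)).
have cp0 := PC1_PC sP cp.
have dt : PD ut (comb Uf1 d) by apply: PD_eq01 (PD_comb d dU) => // x xI; rewrite ut_.
have dz : PD zh (comb Zf1 y) by apply: PD_eq01 (PD_comb y dZ) => // x xI; rewrite zh_.
have du : PD uh (comb Uf1 y) by apply: PD_eq01 (PD_comb y dU) => // x xI; rewrite uh_.
have dp : PD chi (derive1 chi') by apply: PD_eq01 cp.1 => // x xI; rewrite p_.
have e1 := PD_derive1 dz; have e2 := PD_derive1 du.
symmetry; rewrite /momentum_form (form_aE sP mu dt dp (cc d cU1) cp.2).
congr (_ + _ + _ + _ * _); apply: (ip_eqc sP) => //.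
- exact: cc.
- by apply: eqc01 => x xI; rewrite ut_.
- exact: cc.
- by move=> i si x xi; rewrite (e1 i si x xi).
- by apply: PCM; exact: cc.
- move=> i si x xi; rewrite (e2 i si x xi).
  have xI : x \in `[0, 1] by apply: subset_itv_oo_cc; exact: cell01 xi.
  by rewrite uh_.
Qed.

(** The sum vanishes for all c exactly when d is the vector field at y. Both directions are used: to
    verify the weak equations for a solution of the system, and to extract the system from the weak
    equations. *)
Lemma residual_form d y c : mass_form d y (comb Zf c) + momentum_form d y (comb Uf c) =
  \sum_i c i * (d i - vfield (galA g g1 Zf Uf) (galB eps Zf Uf) y i).
Proof.
have E : ip (comb Zf d) (comb Zf c) + (ip (comb Uf d) (comb Uf c) + mu / 3 * ip (comb Uf1 d) (comb Uf1 c)) =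
    \sum_i c i * d i.
  rewrite !(ip_combr sP)//; try exact: cc.
  rewrite mulr_sumr -!big_split; apply: eq_bigr => i _ /=; rewrite !(ip_comb sP)//.
  have -> : c i * (\sum_j d j * ip (Zf j) (Zf i)) + (c i * (\sum_j d j * ip (Uf j) (Uf i)) +
      mu / 3 * (c i * (\sum_j d j * ip (Uf1 j) (Uf1 i)))) = c i * (\sum_j d j * (j == i)%:R).
    rewrite [mu / 3 * _]mulrCA -!mulrDr; congr (_ * _); rewrite mulr_sumr -!big_split.
    apply: eq_bigr => j _; rewrite -orth /form_a; move: (ip _ _) (ip _ _) (ip _ _) => a b e /=; ring.
  rewrite (bigD1 i)//= eqxx mulr1 big1 ?addr0// => j ji.
  by rewrite (negbTE ji) mulr0.
have D : ip (comb Uf1 d) (derive1 (comb Uf c)) = ip (comb Uf1 d) (comb Uf1 c).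
  symmetry; apply: (ip_eqc sP); [exact: cc|exact: cc|by []|].
  by move=> i si x xi; rewrite (PD_derive1 (PD_comb c dU) si xi).
rewrite /mass_form /momentum_form D.
under [RHS]eq_bigr => i _ do rewrite mulrBr.
rewrite sumrB -E.
have -> : \sum_i c i * vfield (galA g g1 Zf Uf) (galB eps Zf Uf) y i =
    - ip (fun x => g1 x * comb Uf y x + g x * comb Uf1 y x) (comb Zf c) - ip (comb Zf1 y) (comb Uf c)
    - eps * ip (fun x => comb Zf1 y x * comb Uf y x + comb Zf y x * comb Uf1 y x) (comb Zf c)
    - eps * ip (fun x => comb Uf y x * comb Uf1 y x) (comb Uf c).
  rewrite !(ip_combr sP)//; try by repeat first [exact: cg1 | exact: cg | exact: cc | apply: PCD | apply: PCM].
  rewrite !mulr_sumr -!sumrN -!big_split; apply: eq_bigr => i _ /=.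
  rewrite (vfield_gal sP eps dg cg1 PZ PU).
  move: (ip _ _) (ip _ _) (ip _ _) (ip _ _) => a1 a2 a3 a4; ring.
move: (ip _ _) (ip _ _) (ip _ _) (ip _ _) (ip _ _) (ip _ _) (ip _ _) => a1 a2 a3 a4 a5 a6 a7; ring.
Qed.

Lemma mass_form0 d y : mass_form d y (fun=> 0) = 0.
Proof.
have Si := sip_ip sP; have c0 := @PC_cst R s 0.
have z f : PC f -> ip f (fun=> 0) = 0 by move=> cf; rewrite (sip_sym Si cf c0) (sip0 Si cf).
rewrite /mass_form !z ?mulr0 ?addr0//; try exact: cc.
  by apply: PCD; apply: PCM => //; exact: cc.
by apply: PCD; apply: PCM; exact: cc.
Qed.

Lemma momentum_form0 d y : momentum_form d y (fun=> 0) = 0.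
Proof.
have Si := sip_ip sP; have c0 := @PC_cst R s 0.
have z f : PC f -> ip f (fun=> 0) = 0 by move=> cf; rewrite (sip_sym Si cf c0) (sip0 Si cf).
rewrite /momentum_form (_ : derive1 _ = fun=> 0); last by apply/funext => x; rewrite derive1_cst.
rewrite !z ?mulr0 ?addr0//; try exact: cc.
by apply: PCM; exact: cc.
Qed.

End WeakForm.

(** * The exact solution tested with finite element functions *)

Section ExactSolution.
Context {R : realType}.
Variables (T eps mu beta : R) (b zeta0 u0 : R -> R) (zeta u : R -> R -> R).
Hypotheses (T0 : 0 < T) (cz : C_rect T 2 zeta) (cu : C_rect T 4 u) (cb : C_on `[0, 1] 2 b).
Hypothesis sol : ibvp_solution T eps mu beta b zeta0 u0 zeta u.

Definition eta_b1 x := - beta * deriv_on `[0, 1] b x.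
Local Notation g := (eta_b beta b).
Local Notation g1 := eta_b1.

Lemma eta_b_deriv x : x \in `[0, 1] -> has_deriv `[0, 1] g x (g1 x).
Proof.
move=> xI; have := has_deriv_lin (- beta) (C_on_deriv cb xI) (has_deriv_cst `[0, 1] x 1).
rewrite addr0; apply: has_deriv_eq => //= y _; rewrite /eta_b; ring.
Qed.

Lemma eta_b1_cont : {within `[0, 1], continuous g1}.
Proof. by have [_ [_ [c _]]] := cb; exact: (withinZ c). Qed.

Variable s : seq R.
Hypothesis sP : itv_partition 0 1 s.
Local Notation PC := (PC s).
Local Notation PD := (PD s).
Local Notation PC1 := (PC1 s).

Lemma exact_mass t : t \in `[0, T] -> eqc s (Dt T zeta t)
  (fun x => - ((eps * Dx zeta t x + g1 x) * u t x + (eps * zeta t x + g x) * Dx u t x)).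
Proof.
move=> tT i si x xi; have xI : x \in `[0, 1] by apply: subset_itv_oo_cc; exact: cell01 xi.
have dz := C_rect_PD T0 sP cz tT; have du := C_rect_PD T0 sP cu tT.
have dg := has_deriv_PD sP eta_b_deriv.
have := PDM (PDD (PDZ eps dz) dg) du => -[_ /(_ i x si xi)] d.
have {}d := @is_derive_has_deriv R `[0, 1] _ _ _ d.
have [_ dx] := (has_derivP _ _ ltr01 xI).2 d.
have := ibvp_mass sol tT xI; rewrite /Dx /eta dx => /eqP; rewrite addr_eq0 => /eqP->.
by [].
Qed.

(** This is the derivative of the coordinates of the projections: by their definition these are
    pairings of zeta and u themselves, so only the smooth solution is differentiated in time. The
    term u_xxt is moved onto psi by [ip_Dt_Dx], for which psi has to vanish at the ends. *)
Lemma exact_residual phi psi t : PC phi -> PC1 psi -> psi 0 = 0 -> psi 1 = 0 -> t \in `[0, T] ->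
  has_deriv `[0, T] (fun r => ip (zeta r) phi + form_a mu (u r) psi) t
    (- ip (fun x => (eps * Dx zeta t x + g1 x) * u t x + (eps * zeta t x + g x) * Dx u t x) phi
     - ip (fun x => Dx zeta t x + eps * (u t x * Dx u t x)) psi).
Proof.
move=> cp pp p0 p1 tT; have cps := PC1_PC sP pp.
have cu2 : C_rect T 2 u by apply: C_rect_le cu.
have cDu : C_rect T 3 (Dx u) := C_rect_Dx cu.
have cDu2 : C_rect T 2 (Dx u) by apply: C_rect_le cDu.
have h1 := ip_has_deriv T0 sP cz cp tT.
have h2 := ip_has_deriv T0 sP cu2 cps tT.
have h3 := ip_has_deriv T0 sP cDu2 pp.2 tT.
have h4 := has_deriv_lin 1 h1 (has_deriv_lin (mu / 3) h3 h2).
have e3 := ip_Dt_Dx T0 sP cDu pp.1 pp.2 p0 p1 tT.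
have PCt m z : C_rect T m z -> PC (z t) by move=> c; exact: (C_rect_PC sP c tT).
have cdz := PCt _ _ (C_rect_Dt cz).
have e1 := ip_eqc sP cdz cp (exact_mass tT) (fun i si x xi => erefl).
have Si := sip_ip sP.
have e2 : ip (Dt T u t) psi - mu / 3 * ip (Dt T (Dx (Dx u)) t) psi =
    - ip (fun x => Dx zeta t x + eps * (u t x * Dx u t x)) psi.
  have c1 := PCt _ _ (C_rect_Dt cu); have c2 := PCt _ _ (C_rect_Dt (C_rect_Dx cDu)).
  have c3 : PC (fun x => Dx zeta t x + eps * (u t x * Dx u t x)).
    apply: PCD; first exact: PCt (C_rect_Dx cz).
    by apply: PCZ; apply: PCM; [exact: PCt cu|exact: PCt cDu].
  rewrite -(sipZ Si _ c2 cps) -(sipB Si c1 (PCZ _ c2) cps) -[RHS]mulN1r -(sipZ Si _ c3 cps).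
  apply: (ip_eqc sP) => //; first by apply: PCB => //; exact: PCZ.
  move=> i si x xi; have xI : x \in `[0, 1] by apply: subset_itv_oo_cc; exact: cell01 xi.
  have := ibvp_momentum sol tT xI.
  by move: (Dt T u t x) (Dx zeta t x) (u t x) (Dx u t x) (Dt T _ t x) => p q v w z; lra.
have -> : - ip (fun x => (eps * Dx zeta t x + g1 x) * u t x + (eps * zeta t x + g x) * Dx u t x) phi =
    ip (Dt T zeta t) phi.
  rewrite e1 -mulN1r -(sipZ Si)//; last first.
    have dg := has_deriv_PD sP eta_b_deriv; have cg1 := PC_within sP eta_b1_cont.
    apply: PCD; apply: PCM; [|exact: PCt cu| |exact: PCt cDu]; apply: PCD => //.
    - by apply: PCZ; exact: PCt (C_rect_Dx cz).
    - by apply: PCZ; exact: PCt cz.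
    - exact: (PD_PC sP dg).
  by rewrite /ip; congr Rintegral; apply/funext => x; rewrite mulN1r.
rewrite -e2.
have -> : ip (Dt T zeta t) phi + (ip (Dt T u t) psi - mu / 3 * ip (Dt T (Dx (Dx u)) t) psi) =
    1 * ip (Dt T zeta t) phi + (mu / 3 * ip (Dt T (Dx u) t) (derive1 psi) + ip (Dt T u t) psi).
  rewrite e3; move: (ip _ _) (ip _ _) (ip _ _) => p q v; ring.
apply: has_deriv_eq h4 => // r rT.
have du := C_rect_PD T0 sP cu rT.
rewrite (form_aE sP mu du pp.1 (C_rect_PC sP cDu rT) pp.2).
by rewrite mul1r; congr (_ + _); rewrite addrC.
Qed.

End ExactSolution.

(** * Equivalence of the semidiscrete problem with the system of equations *)

Section GalerkinSolution.
Context {R : realType} {I : finType}.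
Variables (T eps mu beta : R) (b zeta0 u0 : R -> R).
Hypotheses (T0 : 0 < T) (mu0 : 0 < mu) (cb : C_on `[0, 1] 2 b).
Variable s : seq R.
Hypothesis sP : itv_partition 0 1 s.
Local Notation PC := (PC s).
Local Notation PD := (PD s).
Local Notation PC1 := (PC1 s).
Variables (r k : nat) (Zf Uf : I -> R -> R).
Hypotheses (SZ : forall i, Sh r k s (Zf i)) (SU : forall i, Sh0 r k s (Uf i)).
Hypothesis orth : forall i j, ip (Zf i) (Zf j) + form_a mu (Uf i) (Uf j) = (i == j)%:R.
Hypothesis span : forall phi chi, Sh r k s phi -> Sh0 r k s chi -> exists c : I -> R,
  forall x, x \in `[0, 1] -> phi x = \sum_i c i * Zf i x /\ chi x = \sum_i c i * Uf i x.
Local Notation Zf1 := (fun i => derive1 (Zf i)).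
Local Notation Uf1 := (fun i => derive1 (Uf i)).
Local Notation g := (eta_b beta b).
Local Notation g1 := (eta_b1 beta b).
Local Notation A := (galA g g1 Zf Uf).
Local Notation B := (galB eps Zf Uf).

Let PZ i : PC1 (Zf i). Proof. exact: (@Sh_PC1 R s r k). Qed.
Let PU i : PC1 (Uf i). Proof. exact: (@Sh0_PC1 R s r k). Qed.
Let cZ i : PC (Zf i). Proof. exact: PC1_PC. Qed.
Let cU i : PC (Uf i). Proof. exact: PC1_PC. Qed.
Let cZ1 i : PC (Zf1 i). Proof. exact: (PZ i).2. Qed.
Let cU1 i : PC (Uf1 i). Proof. exact: (PU i).2. Qed.
Let dg : PD g g1 := has_deriv_PD sP (@eta_b_deriv R beta b cb).
Let cg1 : PC g1 := PC_within sP (@eta_b1_cont R beta b cb).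
Let cc (F : I -> R -> R) c : (forall j, PC (F j)) -> PC (comb F c).
Proof. by move=> cF; apply: (comb_sub c (sub_PC s) cF). Qed.
Let SZc c : Sh r k s (comb Zf c). Proof. exact: (comb_sub c (sub_Sh s r k) SZ). Qed.
Let SUc c : Sh0 r k s (comb Uf c). Proof. exact: (comb_sub c (sub_Sh0 s r k) SU). Qed.
Let Sh_0 : Sh r k s (fun=> 0) := (sub_Sh s r k).1.
Let Sh0_0 : Sh0 r k s (fun=> 0) := (sub_Sh0 s r k).1.

Lemma comb_delta (F : I -> R -> R) i : comb F (fun j => (j == i)%:R) = F i.
Proof.
apply/funext => x; rewrite /comb (bigD1 i)//= eqxx mul1r big1 ?addr0// => j /negbTE->.
by rewrite mul0r.
Qed.

Lemma ip_0r f : PC f -> ip f (fun=> 0) = 0.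
Proof. by move=> cf; rewrite ipC (sip0 (sip_ip sP) cf). Qed.

Lemma form_a_0r f : PC1 f -> form_a mu f (fun=> 0) = 0.
Proof.
by move=> cf; rewrite (sip_sym (sip_form_a sP mu0) cf (sub_PC1 s).1) (sip0 (sip_form_a sP mu0) cf).
Qed.

Lemma form_a_combr w c : PC1 w -> form_a mu w (comb Uf c) = \sum_i c i * form_a mu w (Uf i).
Proof.
move=> cw; have cw0 := PC1_PC sP cw; rewrite (form_aE sP mu cw.1 (PD_comb c (fun i => (PU i).1)) cw.2 (cc c cU1)).
rewrite (ip_combr sP c cU cw0) (ip_combr sP c cU1 cw.2).
rewrite mulr_sumr -big_split; apply: eq_bigr => i _ /=.
by rewrite mulrCA -mulrDr.
Qed.

Lemma coord_comb c i : ip (comb Zf c) (Zf i) + form_a mu (comb Uf c) (Uf i) = c i.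
Proof.
have Sa := sip_form_a sP mu0.
have PUc : PC1 (comb Uf c) by exact: (@Sh0_PC1 R s r k).
rewrite (ip_comb sP)// (sip_sym Sa PUc (PU i)) form_a_combr// -big_split (bigD1 i)//=.
rewrite -mulrDr orth eqxx mulr1 big1 ?addr0// => j ji.
by rewrite (sip_sym Sa (PU i) (PU j)) -mulrDr orth (negbTE ji) mulr0.
Qed.

Lemma pairing_comb f w c phi chi : PC f -> PC1 w ->
  {in `[0, 1], phi =1 comb Zf c} -> {in `[0, 1], chi =1 comb Uf c} ->
  ip f phi + form_a mu w chi = \sum_i c i * (ip f (Zf i) + form_a mu w (Uf i)).
Proof.
move=> cf cw p_ c_; have dU := PD_comb c (fun i => (PU i).1).
have dc : PD chi (comb Uf1 c) by apply: PD_eq01 dU => // x xI; rewrite c_.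
rewrite (form_aE sP mu cw.1 dc cw.2 (cc c cU1)) -(ip_eqc sP cf (cc c cZ) (fun i si x xi => erefl)); last first.
  by apply: (eqc01 sP) => x xI; rewrite p_.
rewrite -(ip_eqc sP (PC1_PC sP cw) (cc c cU) (fun i si x xi => erefl)); last first.
  by apply: (eqc01 sP) => x xI; rewrite c_.
rewrite -(form_aE sP mu cw.1 dU cw.2 (cc c cU1)) form_a_combr// (ip_combr sP)// -big_split.
by apply: eq_bigr => i _; rewrite [RHS]mulrDr.
Qed.

(** The sum of the two pairings is reproduced for every pair of test functions; taking one of them
    to be 0 separates the two projections. *)
Lemma proj_comb f w c : PC f -> PC1 w -> (forall i, c i = ip f (Zf i) + form_a mu w (Uf i)) ->
  is_L2_proj (Sh r k s) f (comb Zf c) /\ is_elliptic_proj mu (Sh0 r k s) w (comb Uf c).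
Proof.
move=> cf cw cE; have cZc := cc c cZ; have PUc : PC1 (comb Uf c) by exact: (@Sh0_PC1 R s r k).
have E phi chi : Sh r k s phi -> Sh0 r k s chi ->
    ip (comb Zf c) phi + form_a mu (comb Uf c) chi = ip f phi + form_a mu w chi.
  move=> Sp Sc; have [d dP] := span Sp Sc.
  have p_ : {in `[0, 1], phi =1 comb Zf d} by move=> x /dP[].
  have c_ : {in `[0, 1], chi =1 comb Uf d} by move=> x /dP[].
  rewrite (pairing_comb cZc PUc p_ c_) (pairing_comb cf cw p_ c_); apply: eq_bigr => i _.
  by rewrite (coord_comb c i) cE.
split; split; [exact: SZc| |exact: SUc|].
  by move=> phi Sp; have := E phi _ Sp Sh0_0; rewrite (form_a_0r PUc) (form_a_0r cw) !addr0.
move=> chi Sc; have e := E (fun=> 0) chi Sh_0 Sc.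
by rewrite (ip_0r cZc) (ip_0r cf) in e; exact: (addrI 0 e).
Qed.

Lemma proj_coord f w c p q : is_L2_proj (Sh r k s) f p -> is_elliptic_proj mu (Sh0 r k s) w q ->
  {in `[0, 1], p =1 comb Zf c} -> {in `[0, 1], q =1 comb Uf c} ->
  forall i, c i = ip f (Zf i) + form_a mu w (Uf i).
Proof.
move=> [Sp pE] [Sq qE] p_ q_ i.
rewrite -(pE _ (SZ i)).
rewrite -(qE _ (SU i)).
rewrite -[LHS]coord_comb.
apply: f_equal2.
  apply: (ip_eqc sP) => //; first exact: cc.
  by apply: (eqc01 sP) => x xI; rewrite p_.
have dU := PD_comb c (fun i => (PU i).1).
have dq : PD q (comb Uf1 c) by apply: PD_eq01 dU => // x xI; rewrite q_.
rewrite (form_aE sP mu dU (PU i).1 (cc c cU1) (cU1 i)) (form_aE sP mu dq (PU i).1 (cc c cU1) (cU1 i)).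
congr (_ + _); apply: (ip_eqc sP) => //; first exact: cc.
by apply: (eqc01 sP) => x xI; rewrite q_.
Qed.

Lemma comb_indep c : {in `[0, 1], comb Zf c =1 fun=> 0} -> {in `[0, 1], comb Uf c =1 fun=> 0} -> forall i, c i = 0.
Proof.
move=> Zc Uc i; rewrite -(coord_comb c i); have c0 := @PC_cst R s 0; have Si := sip_ip sP.
have dU : PD (comb Uf c) (fun=> 0) by apply: PD_eq01 (PD_cst s 0) => // x xI; rewrite Uc.
rewrite (form_aE sP mu dU (PU i).1 c0 (cU1 i)) (sip0 Si (cU1 i)) mulr0 addr0.
rewrite (ip_eqc sP (cc c cZ) (cZ i) (eqc01 sP Zc) (fun i si x xi => erefl)).
rewrite (ip_eqc sP (cc c cU) (cU i) (eqc01 sP Uc) (fun i si x xi => erefl)).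
by rewrite !(sip0 Si)// addr0.
Qed.

Lemma has_deriv_comb (J : finType) (F : J -> R -> R) (D : set R) (y : R -> J -> R) d t x :
  (forall j, has_deriv D (fun r => y r j) t (d j)) -> has_deriv D (fun r => comb F (y r) x) t (comb F d x).
Proof.
move=> dy; rewrite /comb; elim: (index_enum J) => [|j l IH].
  rewrite big_nil (_ : (fun _ => _) = fun=> 0); first exact: has_deriv_cst.
  by apply/funext => q; rewrite big_nil.
rewrite big_cons mulrC (_ : (fun _ => _) = fun q => F j x * y q j + \sum_(j <- l) y q j * F j x).
  exact: has_deriv_lin.
by apply/funext => q; rewrite big_cons mulrC.
Qed.

Lemma galerkin_solution (y : R -> I -> R) :
  (forall i t, t \in `[0, T] -> is_derive t 1 (fun t => y t i) (vfield A B (y t) i)) ->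
  is_L2_proj (Sh r k s) zeta0 (comb Zf (y 0)) -> is_elliptic_proj mu (Sh0 r k s) u0 (comb Uf (y 0)) ->
  semidiscrete_solution r k s T eps mu beta b zeta0 u0 (fun t => comb Zf (y t)) (fun t => comb Uf (y t)).
Proof.
move=> dy iz iu.
have D F t x : t \in `[0, T] -> has_deriv `[0, T] (fun t => comb F (y t) x) t (comb F (vfield A B (y t)) x).
  by move=> tT; apply: has_deriv_comb => j; apply: is_derive_has_deriv; exact: dy.
have DE (F : I -> R -> R) t x : t \in `[0, T] -> Dt T (fun t => comb F (y t)) t x = comb F (vfield A B (y t)) x.
  by move=> tT; have [_] := (has_derivP _ _ T0 tT).2 (D F t x tT).
(* Only the sum of the two equations follows from the system directly; each one is obtained below by
   taking the other test function to be 0. *)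
have E t phi chi : t \in `[0, T] -> Sh r k s phi -> Sh0 r k s chi ->
    mass_form eps g g1 Zf Uf (vfield A B (y t)) (y t) phi + momentum_form eps mu Zf Uf (vfield A B (y t)) (y t) chi = 0.
  move=> tT Sp Sc; have [c cP] := span Sp Sc.
  have p_ : {in `[0, 1], phi =1 comb Zf c} by move=> x /cP[].
  have c_ : {in `[0, 1], chi =1 comb Uf c} by move=> x /cP[].
  have re0 : forall f : R -> R, {in `[0, 1], f =1 f} by [].
  rewrite -(mass_formE sP eps dg cg1 PZ PU (zt := comb Zf (vfield A B (y t))) (zh := comb Zf (y t)) (uh := comb Uf (y t))
    (re0 _) (re0 _) (re0 _) (Sh_PC sP Sp) (re0 _)).
  rewrite (mass_formE sP eps dg cg1 PZ PU (re0 _) (re0 _) (re0 _) (cc c cZ) p_).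
  rewrite -(momentum_formE sP eps mu PZ PU (ut := comb Uf (vfield A B (y t))) (zh := comb Zf (y t)) (uh := comb Uf (y t))
    (re0 _) (re0 _) (re0 _) (Sh0_PC1 Sc) (re0 _)).
  rewrite (momentum_formE sP eps mu PZ PU (re0 _) (re0 _) (re0 _) (Sh0_PC1 (SUc c)) c_).
  rewrite (residual_form sP eps dg cg1 PZ PU orth) big1// => i _; by rewrite subrr mulr0.
split.
- by move=> t _; exact: SZc.
- by move=> t _; exact: SUc.
- by move=> t x tT xI; have [] := (has_derivP _ _ T0 tT).2 (D Zf t x tT).
- by move=> t x tT xI; have [] := (has_derivP _ _ T0 tT).2 (D Uf t x tT).
- move=> t phi tT Sp.
  rewrite (mass_formE sP eps dg cg1 PZ PU (d := vfield A B (y t)) (y := y t) _ _ _ (Sh_PC sP Sp) (phi' := phi))//; last by move=> x xI; exact: DE.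
  by have := E t phi _ tT Sp Sh0_0; rewrite (momentum_form0 sP)// addr0.
- move=> t chi tT Sc.
  rewrite (momentum_formE sP eps mu PZ PU (d := vfield A B (y t)) (y := y t) _ _ _ (Sh0_PC1 Sc) (chi' := chi))//; last by move=> x xI; exact: DE.
  by have := E t _ chi tT Sh_0 Sc; rewrite (mass_form0 sP eps dg cg1)// add0r.
- exact: iz.
- exact: iu.
Qed.

(* Coordinates are linear in finitely many point values, hence differentiable in time. *)
Lemma galerkin_coordinates zh uh : semidiscrete_solution r k s T eps mu beta b zeta0 u0 zh uh ->
  exists c : R -> I -> R,
  [/\ forall t x, t \in `[0, T] -> x \in `[0, 1] -> zh t x = comb Zf (c t) x /\ uh t x = comb Uf (c t) x,
      forall i t, t \in `[0, T] -> has_deriv `[0, T] (fun t => c t i) t (vfield A B (c t) i) &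
      forall i, c 0 i = ip zeta0 (Zf i) + form_a mu u0 (Uf i)].
Proof.
case=> Szh Suh dz du mass mom iz iu.
have [c cP] : exists c : R -> I -> R, forall t, t \in `[0, T] -> forall x, x \in `[0, 1] ->
    zh t x = comb Zf (c t) x /\ uh t x = comb Uf (c t) x.
  have H t : exists c : I -> R, t \in `[0, T] -> forall x, x \in `[0, 1] ->
      zh t x = comb Zf c x /\ uh t x = comb Uf c x.
    have [tT|tT] := boolP (t \in `[0, T]); last by exists (fun=> 0).
    by have [c cP] := span (Szh t tT) (Suh t tT); exists c.
  by have [c cP] := choice H; exists c.
(* The two components become one function of a point and a flag, so that independence of the pairs
   is independence of functions. *)
pose F i (p : R * bool) := if p.2 then Zf i p.1 else Uf i p.1.
have [|N [p [W [Qp cW]]]] := @coord_from_values R I (R * bool)%type (fun p => p.1 \in `[0, 1]) F.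
  move=> d d0; apply: comb_indep => x xI; [exact: (d0 (x, true))|exact: (d0 (x, false))].
pose val t (j : 'I_N) := if (p j).2 then zh t (p j).1 else uh t (p j).1.
pose dval t (j : 'I_N) := if (p j).2 then Dt T zh t (p j).1 else Dt T uh t (p j).1.
(* A linear combination with weights W written as [comb] of constant functions, evaluated at the
   arbitrary point 0, so that [has_deriv_comb] applies. *)
pose d t i := comb (fun j (_ : R) => W i j) (dval t) 0.
have dc i t : t \in `[0, T] -> has_deriv `[0, T] (fun t => c t i) t (d t i).
  move=> tT; have h : has_deriv `[0, T] (fun t => comb (fun j (_ : R) => W i j) (val t) 0) t (d t i).
    apply: has_deriv_comb => j; rewrite /val /dval; case: (p j).2; apply: (derivable_on_has_deriv T0 tT);
      [exact: dz|exact: du].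
  apply: has_deriv_eq h => // q qT; rewrite [RHS]cW /comb; apply: eq_bigr => j _; rewrite mulrC; congr (_ * _).
  by rewrite /val /F; have [h1 h2] := cP q qT _ (Qp j); case: (p j).2; rewrite ?h1 ?h2.
have Dz t : t \in `[0, T] -> {in `[0, 1], Dt T zh t =1 comb Zf (d t)}.
  move=> tT x xI; have h1 := derivable_on_has_deriv T0 tT (dz t x tT xI).
  have h2 : has_deriv `[0, T] (fun q => comb Zf (c q) x) t (comb Zf (d t) x).
    by apply: has_deriv_comb => j; exact: dc.
  by apply: (has_deriv_unique T0 tT _ h1 h2) => q qT; have [] := cP q qT x xI.
have Du t : t \in `[0, T] -> {in `[0, 1], Dt T uh t =1 comb Uf (d t)}.
  move=> tT x xI; have h1 := derivable_on_has_deriv T0 tT (du t x tT xI).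
  have h2 : has_deriv `[0, T] (fun q => comb Uf (c q) x) t (comb Uf (d t) x).
    by apply: has_deriv_comb => j; exact: dc.
  by apply: (has_deriv_unique T0 tT _ h1 h2) => q qT; have [] := cP q qT x xI.
have zc t : t \in `[0, T] -> {in `[0, 1], zh t =1 comb Zf (c t)} by move=> tT x xI; have [] := cP t tT x xI.
have uc t : t \in `[0, T] -> {in `[0, 1], uh t =1 comb Uf (c t)} by move=> tT x xI; have [] := cP t tT x xI.
exists c; split.
- by move=> t x tT xI; exact: cP.
- move=> i t tT; have -> : vfield A B (c t) i = d t i; last exact: dc.
  have h1 := mass t _ tT (SZ i); have h2 := mom t _ tT (SU i).
  have re0 : forall f : R -> R, {in `[0, 1], f =1 f} by [].
  rewrite (mass_formE sP eps dg cg1 PZ PU (Dz t tT) (zc t tT) (uc t tT) (cZ i) (re0 _)) in h1.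
  rewrite (momentum_formE sP eps mu PZ PU (Du t tT) (zc t tT) (uc t tT) (PU i) (re0 _)) in h2.
  have := residual_form sP eps dg cg1 PZ PU orth (d t) (c t) (fun j => (j == i)%:R).
  rewrite !comb_delta h1 h2 addr0 (bigD1 i)//= eqxx mul1r big1 ?addr0; last by move=> j /negbTE->; rewrite mul0r.
  by move=> /esym/eqP; rewrite subr_eq0 => /eqP.
- have t0T : (0 : R) \in `[0, T] by rewrite in_itv/= lexx ltW.
  exact: proj_coord iz iu (zc 0 t0T) (uc 0 t0T).
Qed.

Lemma galerkin_unique zh uh zh' uh' :
  semidiscrete_solution r k s T eps mu beta b zeta0 u0 zh uh ->
  semidiscrete_solution r k s T eps mu beta b zeta0 u0 zh' uh' ->
  forall t x, t \in `[0, T] -> x \in `[0, 1] -> zh' t x = zh t x /\ uh' t x = uh t x.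
Proof.
move=> /galerkin_coordinates[c [cP dc c0]] /galerkin_coordinates[c' [cP' dc' c0']] t x tT xI.
have [-> ->] := cP t x tT xI; have [-> ->] := cP' t x tT xI.
have wc (e : R -> I -> R) : (forall i t, t \in `[0, T] -> has_deriv `[0, T] (fun t => e t i) t (vfield A B (e t) i)) ->
    forall i, {within `[0, T], continuous (fun t => e t i)}.
  by move=> de i; apply/subspace_continuousP => q qT; apply: has_deriv_cont (de i q qT).
have dd (e : R -> I -> R) : (forall i t, t \in `[0, T] -> has_deriv `[0, T] (fun t => e t i) t (vfield A B (e t) i)) ->
    forall i t, t \in `]0, T[ -> is_derive t 1 (fun t => e t i) (vfield A B (e t) i).
  by move=> de i q qT; apply: (has_deriv_is_derive qT); apply: de; exact: subset_itv_oo_cc.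
have E : c' t = c t.
  apply/funext => i; apply: (quadratic_ode_unique T0 (wc _ dc') (wc _ dc) (dd _ dc') (dd _ dc)) => // j.
  by rewrite c0 c0'.
by rewrite E.
Qed.

End GalerkinSolution.

(* Gronwall's constants for the differential inequality of energy_gal_le. *)
Definition growth_rate (R : realType) (eps mu M : R) : R := 120 * ((1 + eps) * (1 + M)) * (1 + 3 / mu).
Definition growth (R : realType) (T eps mu M : R) : R := 480 * ((1 + eps) * (1 + M)) * T * expR (2 * growth_rate eps mu M * T).

Lemma growth_ge0 (R : realType) (T eps mu M : R) : 0 < T -> 0 < eps -> 0 <= M -> 0 <= growth T eps mu M.
Proof.
move=> T0 eps0 M0; have q0 : 0 <= 480 * ((1 + eps) * (1 + M)).
  by apply: mulr_ge0; [exact: ler0n|rewrite mulr_ge0// addr_ge0// ltW].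
by apply: mulr_ge0; [exact: mulr_ge0 q0 (ltW T0)|exact: expR_ge0].
Qed.

(** * Existence up to time T and the error bound on a fixed partition *)

Section ErrorEstimate.
Context {R : realType} {I : finType}.
Variables (T eps mu beta : R) (b zeta0 u0 : R -> R) (zeta u : R -> R -> R).
Hypotheses (T0 : 0 < T) (eps0 : 0 < eps) (mu0 : 0 < mu) (cz : C_rect T 2 zeta) (cu : C_rect T 4 u)
  (cb : C_on `[0, 1] 2 b) (sol : ibvp_solution T eps mu beta b zeta0 u0 zeta u).
Variable s : seq R.
Hypothesis sP : itv_partition 0 1 s.
Local Notation PC := (PC s).
Local Notation PD := (PD s).
Local Notation PC1 := (PC1 s).
Variables (r k : nat) (Zf Uf : I -> R -> R).
Hypotheses (SZ : forall i, Sh r k s (Zf i)) (SU : forall i, Sh0 r k s (Uf i)).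
Hypothesis orth : forall i j, ip (Zf i) (Zf j) + form_a mu (Uf i) (Uf j) = (i == j)%:R.
Hypothesis span : forall phi chi, Sh r k s phi -> Sh0 r k s chi -> exists c : I -> R,
  forall x, x \in `[0, 1] -> phi x = \sum_i c i * Zf i x /\ chi x = \sum_i c i * Uf i x.
Local Notation Zf1 := (fun i => derive1 (Zf i)).
Local Notation Uf1 := (fun i => derive1 (Uf i)).
Local Notation g := (eta_b beta b).
Local Notation g1 := (eta_b1 beta b).
Local Notation A := (galA g g1 Zf Uf).
Local Notation B := (galB eps Zf Uf).

Variables (M kappa delta : R).
Hypotheses (M2 : 2 <= M) (kappa0 : 0 < kappa) (delta0 : 0 <= delta) (delta1 : delta <= 1)
  (kappa_delta : kappa * delta <= 1).
Hypothesis solM : forall t x, t \in `[0, T] -> x \in `[0, 1] ->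
  [/\ `|zeta t x| <= M, `|Dx zeta t x| <= M, `|u t x| <= M & `|Dx u t x| <= M].
Hypothesis gM : forall x, x \in `[0, 1] -> `|g x| <= M /\ `|g1 x| <= M.
Hypothesis inv : forall v i x, Sh r k s v -> (i < size s)%N -> x \in `]node s i, node s i.+1[ ->
  v x ^+ 2 <= kappa * ip v v.
Hypothesis projZ : forall t P, t \in `[0, T] -> is_L2_proj (Sh r k s) (zeta t) P ->
  ip (fun x => P x - zeta t x) (fun x => P x - zeta t x) <= delta /\
  ip (fun x => derive1 P x - Dx zeta t x) (fun x => derive1 P x - Dx zeta t x) <= delta.
Hypothesis projU : forall t P, t \in `[0, T] -> is_elliptic_proj mu (Sh0 r k s) (u t) P ->
  ip (fun x => P x - u t x) (fun x => P x - u t x) <= delta /\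
  ip (fun x => derive1 P x - Dx u t x) (fun x => derive1 P x - Dx u t x) <= delta.

Local Notation G := (growth T eps mu M).
Hypothesis smallG : kappa * (delta * G) <= 1.

Let PZ i : PC1 (Zf i). Proof. exact: (@Sh_PC1 R s r k). Qed.
Let PU i : PC1 (Uf i). Proof. exact: (@Sh0_PC1 R s r k). Qed.
Let dZ i : PD (Zf i) (Zf1 i). Proof. exact: (PZ i).1. Qed.
Let dU i : PD (Uf i) (Uf1 i). Proof. exact: (PU i).1. Qed.
Let cZ i : PC (Zf i). Proof. exact: PC1_PC. Qed.
Let cU i : PC (Uf i). Proof. exact: PC1_PC. Qed.
Let cZ1 i : PC (Zf1 i). Proof. exact: (PZ i).2. Qed.
Let cU1 i : PC (Uf1 i). Proof. exact: (PU i).2. Qed.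
Let dg : PD g g1 := has_deriv_PD sP (@eta_b_deriv R beta b cb).
Let cg1 : PC g1 := PC_within sP (@eta_b1_cont R beta b cb).
Let cc (F : I -> R -> R) c : (forall j, PC (F j)) -> PC (comb F c).
Proof. by move=> cF; apply: (comb_sub c (sub_PC s) cF). Qed.
Let U0 i : Uf i 0 = 0. Proof. by have [] := SU i. Qed.
Let U1 i : Uf i 1 = 0. Proof. by have [] := SU i. Qed.
Let dzt t (tT : t \in `[0, T]) : PD (zeta t) (Dx zeta t) := C_rect_PD T0 sP cz tT.
Let dut t (tT : t \in `[0, T]) : PD (u t) (Dx u t) := C_rect_PD T0 sP cu tT.
Let czt t (tT : t \in `[0, T]) : PC (Dx zeta t) := C_rect_PC sP (C_rect_Dx cz) tT.
Let cut t (tT : t \in `[0, T]) : PC (Dx u t) := C_rect_PC sP (C_rect_Dx cu) tT.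
Let M0 : 0 <= M. Proof. exact: le_trans M2. Qed.

(** The coordinates of the pair of projections at time t, as [projY] confirms; this is the reference
    curve of [quadratic_ode_near]. *)
Definition proj_coords t i := ip (zeta t) (Zf i) + form_a mu (u t) (Uf i).
Local Notation Y := proj_coords.

Let projY t : t \in `[0, T] ->
  is_L2_proj (Sh r k s) (zeta t) (comb Zf (Y t)) /\ is_elliptic_proj mu (Sh0 r k s) (u t) (comb Uf (Y t)).
Proof.
by move=> tT; apply: (proj_comb mu0 sP SZ SU orth span (PD_PC sP (dzt tT)) (PD_PC1 (dut tT) (cut tT))).
Qed.

Let swap (f h : R -> R) : ip (fun x => f x - h x) (fun x => f x - h x) = ip (fun x => h x - f x) (fun x => h x - f x).
Proof. by rewrite /ip; congr Rintegral; apply/funext => x; ring. Qed.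

Let err t : t \in `[0, T] ->
  [/\ ip (fun x => comb Zf (Y t) x - zeta t x) (fun x => comb Zf (Y t) x - zeta t x) <= delta,
      ip (fun x => comb Zf1 (Y t) x - Dx zeta t x) (fun x => comb Zf1 (Y t) x - Dx zeta t x) <= delta,
      ip (fun x => comb Uf (Y t) x - u t x) (fun x => comb Uf (Y t) x - u t x) <= delta &
      ip (fun x => comb Uf1 (Y t) x - Dx u t x) (fun x => comb Uf1 (Y t) x - Dx u t x) <= delta].
Proof.
move=> tT; have [p1 p2] := projY tT; have [a1 a2] := projZ tT p1; have [a3 a4] := projU tT p2.
have E F (c : I -> R) f : (forall i, PC1 (F i)) -> PC f ->
    ip (fun x => comb (fun i => derive1 (F i)) c x - f x) (fun x => comb (fun i => derive1 (F i)) c x - f x) =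
    ip (fun x => derive1 (comb F c) x - f x) (fun x => derive1 (comb F c) x - f x).
  move=> PF cf; have d := PD_derive1 (PD_comb c (fun i => (PF i).1)).
  have cF : PC (comb (fun i => derive1 (F i)) c) by apply: cc => i; exact: (PF i).2.
  by apply: (ip_eqc sP); try exact: PCB; move=> i si x xi; rewrite (d i si x xi).
split; [exact: a1| |exact: a3|].
  by rewrite (E Zf _ _ PZ (czt tT)).
by rewrite (E Uf _ _ PU (cut tT)).
Qed.

Let near : exists y : R -> I -> R,
  [/\ forall i t, t \in `[0, T] -> is_derive t 1 (fun t => y t i) (vfield A B (y t) i), y 0 = Y 0 &
      forall t, t \in `[0, T] -> sqn (fun i => y t i - Y t i) <= delta * G].
Proof.
pose K := growth_rate eps mu M; pose c := (1 + eps) * (1 + M).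
have c0 : 0 <= c by rewrite mulr_ge0// addr_ge0// ltW.
have K0 : 0 <= K.
  apply: mulr_ge0; first by rewrite mulr_ge0.
  by rewrite addr_ge0// divr_ge0// ltW.
have EG : 2 * (240 * c * delta) * T * expR (2 * K * T) = delta * G by rewrite /growth -/K -/c; ring.
have dY i t := exact_residual T0 cz cu cb sol sP (cZ i) (PU i) (U0 i) (U1 i) (t := t).
pose dY' t i := - ip (fun x => (eps * Dx zeta t x + g1 x) * u t x + (eps * zeta t x + g x) * Dx u t x) (Zf i)
     - ip (fun x => Dx zeta t x + eps * (u t x * Dx u t x)) (Uf i).
have cY i : {within `[0, T], continuous (fun t => Y t i)}.
  by apply/subspace_continuousP => t tT; apply: has_deriv_cont (dY i t tT).
have dYP i t : t \in `]0, T[ -> is_derive t 1 (fun t => Y t i) (dY' t i).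
  by move=> tT; apply: (has_deriv_is_derive tT); apply: dY; exact: subset_itv_oo_cc.
have en t e l : t \in `]0, T[ -> 0 <= l -> l <= 1 -> l * (kappa * sqn e) <= 1 ->
    \sum_i e i * (vfield A B (fun i => Y t i + e i) i - (1 - l) * quad B e i - dY' t i) <= K * sqn e + 240 * c * delta.
  move=> /subset_itv_oo_cc tT l0 l1 ls; have [e1 e2 e3 e4] := err tT.
  have [bc0 bc1] := ibvp_bc sol tT.
  apply: (energy_gal_le sP eps0 mu0 dg cg1 PZ PU U0 U1 orth (dzt tT) (dut tT) (czt tT) (cut tT) bc0 bc1 M2 kappa0
    _ _ e1 e2 e3 e4 delta1 kappa_delta l0 l1 ls).
    by move=> x xI; split; [exact: solM|exact: gM].
  by move=> i x; apply: inv; apply: (comb_sub e (sub_Sh s r k) SZ).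
have D0 : 0 <= 240 * c * delta by rewrite -mulrA; apply: mulr_ge0; [exact: ler0n|exact: mulr_ge0 c0 delta0].
have sm : kappa * (2 * (240 * c * delta) * T * expR (2 * K * T)) <= 1 by rewrite EG.
have [y [dy y0 yY]] := quadratic_ode_near T0 K0 D0 kappa0 cY dYP en sm.
by exists y; split=> // t tT; rewrite -EG; exact: yY.
Qed.

(** Both errors are split at the projection. With e the coordinates of the discrete part, |e|^2 <=
    delta G, and each squared norm is at most delta (4 + 2 (1 + 3 / mu) G): the 4 comes from the
    projection errors of u and u_x, the rest from e, where 1 + 3 / mu recovers the H^1 norm from
    a. *)
Lemma galerkin_near : exists zh uh,
  semidiscrete_solution r k s T eps mu beta b zeta0 u0 zh uh /\
  forall t, t \in `[0, T] -> normL2 (fun x => zeta t x - zh t x) + normH1 (fun x => u t x - uh t x) <=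
    2 * Num.sqrt (delta * (4 + 2 * ((1 + 3 / mu) * G))).
Proof.
have fin1 (p q d w : R) : p <= d -> q <= w -> 0 <= d -> 2 * p + 2 * q <= 4 * d + 2 * w by lra.
have fin2 (p q v z d w : R) : p <= d -> v <= d -> q + z <= w -> 2 * p + 2 * q + (2 * v + 2 * z) <= 4 * d + 2 * w.
  by lra.
have [y [dy y0 yY]] := near.
have t0T : (0 : R) \in `[0, T] by rewrite in_itv/= lexx ltW.
(* The initial data agree with the solution at time 0 on [0, 1] only, so the pairings have to be
   transferred from one to the other. *)
have [i1 i2] : is_L2_proj (Sh r k s) zeta0 (comb Zf (y 0)) /\ is_elliptic_proj mu (Sh0 r k s) u0 (comb Uf (y 0)).
  have ez := @eqc01 R s sP (zeta 0) zeta0 (fun x xI => ibvp_init_zeta sol xI).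
  have du0 : PD u0 (Dx u 0) by apply: PD_eq01 (dut t0T) => // x xI; rewrite (ibvp_init_u sol xI).
  have cz0 : PC zeta0 := PC_eqc ez (PD_PC sP (dzt t0T)).
  apply: (proj_comb mu0 sP SZ SU orth span cz0 (PD_PC1 du0 (cut t0T))) => i.
  rewrite y0 /proj_coords; apply: f_equal2.
    exact: (ip_eqc sP (PD_PC sP (dzt t0T)) (cZ i) ez (fun i si x xi => erefl)).
  rewrite (form_aE sP mu (dut t0T) (dU i) (cut t0T) (cU1 i)) (form_aE sP mu du0 (dU i) (cut t0T) (cU1 i)).
  congr (_ + _); apply: (ip_eqc sP (PD_PC sP (dut t0T)) (cU i)) => //.
  exact: (@eqc01 R s sP (u 0) u0 (fun x xI => ibvp_init_u sol xI)).
exists (fun t => comb Zf (y t)), (fun t => comb Uf (y t)); split.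
  exact: (galerkin_solution T0 cb sP SZ SU orth span dy i1 i2).
move=> t tT; have Si := sip_ip sP; have [e1 e2 e3 e4] := err tT.
have G0 : 0 <= G by exact: growth_ge0.
pose e i := Y t i - y t i.
have se : sqn e <= delta * G.
  by apply: le_trans (yY t tT); rewrite /sqn le_eqVlt; apply/orP; left; apply/eqP; apply: eq_bigr => i _; rewrite /e -sqrrN opprB.
have E (F : I -> R -> R) : (fun x => comb F (Y t) x - comb F (y t) x) = comb F e by apply/funext => x; rewrite combB.
have T1 := sip_tri Si (PD_PC sP (dzt tT)) (cc (Y t) cZ) (cc (y t) cZ).
have T2 := sip_tri Si (PD_PC sP (dut tT)) (cc (Y t) cU) (cc (y t) cU).
have T3 := sip_tri Si (cut tT) (cc (Y t) cU1) (cc (y t) cU1).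
rewrite E (swap (zeta t) (comb Zf (Y t))) in T1; rewrite E (swap (u t) (comb Uf (Y t))) in T2.
rewrite E (swap (Dx u t) (comb Uf1 (Y t))) in T3.
have S := sqn_gal sP PZ PU orth e.
have a0 := sip_ge0 Si (cc e cZ); have b0 := sip_ge0 Si (cc e cU); have c0 := sip_ge0 Si (cc e cU1).
have m0 : 0 < mu / 3 by rewrite divr_gt0.
have n0 : 0 <= 3 / mu by rewrite divr_ge0// ltW.
have Q : ip (comb Uf e) (comb Uf e) + ip (comb Uf1 e) (comb Uf1 e) <= (1 + 3 / mu) * (delta * G).
  apply: le_trans (_ : _ <= (1 + 3 / mu) * sqn e) _; last by rewrite ler_wpM2l// addr_ge0.
  rewrite S; move: a0 b0 c0; move: (ip _ _) (ip _ _) (ip _ _) => v q p p0 q0 v0.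
  have -> : (1 + 3 / mu) * (p + (q + mu / 3 * v)) = q + v + (p + mu / 3 * v + 3 / mu * (p + q)).
    by field; rewrite gt_eqF.
  by rewrite lerDl !addr_ge0// mulr_ge0// ?addr_ge0// ltW.
have Q' : ip (comb Zf e) (comb Zf e) <= delta * G.
  by apply: le_trans se; rewrite S lerDl addr_ge0// mulr_ge0// ltW.
have dG : 0 <= delta * G by exact: mulr_ge0.
set W := delta * (4 + _).
have EW : W = 4 * delta + 2 * ((1 + 3 / mu) * (delta * G)) by rewrite /W; ring.
have mG : delta * G <= (1 + 3 / mu) * (delta * G) by rewrite mulrDl mul1r lerDl mulr_ge0.
rewrite mulr_natl mulr2n; apply: lerD.
  rewrite /normL2 ler_wsqrtr// EW; apply: le_trans T1 _.
  exact: fin1 e1 (le_trans Q' mG) delta0.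
have du := PDB (dut tT) (PD_comb (y t) dU).
have cu1 := PCB (cut tT) (cc (y t) cU1).
have cu0 := PD_PC sP du.
have N1 : ip (derive1 (fun x => u t x - comb Uf (y t) x)) (derive1 (fun x => u t x - comb Uf (y t) x)) =
    ip (fun x => Dx u t x - comb Uf1 (y t) x) (fun x => Dx u t x - comb Uf1 (y t) x).
  by symmetry; apply: (ip_eqc sP cu1 cu1) => i si x xi; rewrite (PD_derive1 du si xi).
rewrite /normH1 /normL2 N1 !sqr_sqrtr; [|exact: (sip_ge0 Si cu1)|exact: (sip_ge0 Si cu0)].
rewrite ler_wsqrtr// EW; apply: le_trans (lerD T2 T3) _.
exact: fin2 e3 e4 Q.
Qed.

End ErrorEstimate.

(** * Choice of the constants and of the mesh threshold *)

Lemma common_bound (R : realType) (a1 a2 a3 a4 a5 a6 : R) :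
  0 <= a1 -> 0 <= a2 -> 0 <= a3 -> 0 <= a4 -> 0 <= a5 -> 0 <= a6 ->
  exists M, [/\ 2 <= M, a1 <= M, a2 <= M & a3 <= M] /\ [/\ a4 <= M, a5 <= M & a6 <= M].
Proof. by move=> *; exists (2 + (a1 + a2 + a3 + a4 + a5 + a6)); split; split; lra. Qed.

Lemma threshold_gt0 (R : realType) (K C G : R) : 0 <= K -> 0 <= C -> 0 <= G -> 0 < (1 + C + K * C + K * C * G)^-1.
Proof.
move=> K0 C0 G0; have KC := mulr_ge0 K0 C0; have KCG := mulr_ge0 KC G0.
by rewrite invr_gt0 !ltr_wpDr.
Qed.

(** H stands for h^(2 (r - 1)), and H <= h^2 is where r >= 2 enters: against the factor 1 / h of the
    inverse inequality one power of h is left over, and the threshold makes C h, K C h and K C G h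
    at most 1. *)
Lemma small_mesh (R : realType) (K C G h H : R) : 0 <= K -> 0 <= C -> 0 <= G -> 0 < h -> h <= 1 -> 0 <= H -> H <= h ^+ 2 ->
  h <= (1 + C + K * C + K * C * G)^-1 ->
  [/\ C * H <= 1, K / h * (C * H) <= 1 & K / h * (C * H * G) <= 1].
Proof.
move=> K0 C0 G0 h0 h1 H0 Hh; have KC := mulr_ge0 K0 C0; have KCG := mulr_ge0 KC G0.
have := threshold_gt0 K0 C0 G0; rewrite invr_gt0 => D0.
rewrite -div1r ler_pdivlMr// mulrC !mulrDl mul1r => D1.
have a1 := mulr_ge0 C0 (ltW h0); have a2 := mulr_ge0 KC (ltW h0); have a3 := mulr_ge0 KCG (ltW h0).
have B1 : C * H <= C * h by rewrite ler_wpM2l// (le_trans Hh)// expr2 ler_piMl// ltW.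
have B2 : K / h * (C * H) <= K * C * h.
  have -> : K * C * h = K / h * (C * h ^+ 2) by field; rewrite gt_eqF.
  by rewrite ler_wpM2l ?divr_ge0 ?ler_wpM2l// ltW.
have B3 : K / h * (C * H * G) <= K * C * G * h.
  by rewrite mulrA [X in _ <= X]mulrAC ler_wpM2r.
by move: B1 B2 B3; move: (C * H) (K / h * _) (K / h * _) => *; split; lra.
Qed.

Theorem theorem2p2 (R : realType) (r : nat) (hr : (2 <= r)%N) :
  (* m : the number of continuous derivatives meant by "sufficiently smooth" *)
  exists m : nat,
  forall (k : nat) (T eps mu beta q : R) (b zeta0 u0 : R -> R)
    (zeta u : R -> R -> R),
  (k <= r - 2)%N ->
  0 < T -> 0 < eps -> 0 < mu -> 0 < beta ->
  C_on `[0, 1] 2 b ->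
  (forall x, x \in `[0, 1] -> 0 < eta_b beta b x) ->
  C_rect T m zeta -> C_rect T m u ->
  (forall t x, t \in `[0, T] -> x \in `[0, 1] -> 0 < eta eps beta b zeta t x) ->
  ibvp_solution T eps mu beta b zeta0 u0 zeta u ->
  exists h0 C : R, 0 < h0 /\
  forall s : seq R, itv_partition 0 1 s -> quasiuniform q s -> mesh s <= h0 ->
  exists zetah uh : R -> R -> R,
    [/\ semidiscrete_solution r k s T eps mu beta b zeta0 u0 zetah uh,
        forall zetah' uh' : R -> R -> R,
          semidiscrete_solution r k s T eps mu beta b zeta0 u0 zetah' uh' ->
          forall t x, t \in `[0, T] -> x \in `[0, 1] ->
            zetah' t x = zetah t x /\ uh' t x = uh t x
      & forall t, t \in `[0, T] ->
          normL2 (fun x => zeta t x - zetah t x)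
            + normH1 (fun x => u t x - uh t x) <= C * mesh s ^+ (r - 1)].
Proof.
(* The interpolation errors use r derivatives, the differentiation in time of the pairings four of u
   and two of zeta; r + 4 covers all of these. *)
exists (r + 4)%N => k T eps mu beta q b zeta0 u0 zeta u kr T0 eps0 mu0 _ cb _ cz cu _ sol.
have cz2 : C_rect T 2 zeta by apply: C_rect_le cz; rewrite (leq_trans hr)// leq_addr.
have czr : C_rect T r zeta by apply: C_rect_le cz; rewrite leq_addr.
have cur : C_rect T r u by apply: C_rect_le cu; rewrite leq_addr.
have cu4 : C_rect T 4 u by apply: C_rect_le cu; rewrite leq_addl.
have [C1 C10 E1] := L2_projection_error T0 q hr czr.
have [C2 C20 E2] := elliptic_projection_error T0 hr mu0 cur (ibvp_bc sol).
have [Ci Ci0 inv] := inverse_inequality (R := R) r.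
have [M1 M10 B1] := C_rect_bounded cz2; have [M2 M20 B2] := C_rect_bounded (C_rect_Dx cz2).
have [M3 M30 B3] := C_rect_bounded cu4; have [M4 M40 B4] := C_rect_bounded (C_rect_Dx cu4).
have cg : {within `[0, 1], continuous (eta_b beta b)}.
  by apply/subspace_continuousP => x xI; apply: has_deriv_cont (eta_b_deriv beta cb xI).
have [M5 M50 B5] := within_bounded cg; have [M6 M60 B6] := within_bounded (@eta_b1_cont R beta b cb).
have [M [[Mg2 MM1 MM2 MM3] [MM4 MM5 MM6]]] := common_bound M10 M20 M30 M40 M50 M60.
(* kappa = K / h must be positive, whereas Ci may be 0 and nothing is known yet about the sign of
   q. *)
have [K K0 KP] : exists2 K, 0 < K & Ci * q <= K.
  exists (Ci * `|q| + 1); first by rewrite ltr_wpDl// mulr_ge0.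
  by rewrite (@le_trans _ _ (Ci * `|q|))// ?lerDl// ler_wpM2l// ler_norm.
pose G := growth T eps mu M; pose C := C1 + C2.
have C0 : 0 <= C by exact: addr_ge0.
have G0 : 0 <= G by apply: growth_ge0 => //; exact: le_trans Mg2.
pose X := 4 + 2 * ((1 + 3 / mu) * G).
exists (1 + C + K * C + K * C * G)^-1, (2 * Num.sqrt (C * X)); split.
  exact: threshold_gt0 (ltW K0) C0 G0.
move=> s sP qu sh; have h0 := mesh_gt0 sP; have h1 := mesh_le1 sP.
set h := mesh s in sh h0 h1 *; pose H := h ^+ (2 * (r - 1)).
have H0 : 0 <= H by rewrite exprn_ge0// ltW.
have Hh : H <= h ^+ 2.
  by apply: ler_wiXn2l => //; [exact: ltW|rewrite leq_pmulr// subn_gt0].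
have [d1 kd sG] := small_mesh (ltW K0) C0 G0 h0 h1 H0 Hh sh.
have d0 : 0 <= C * H by exact: mulr_ge0.
have k0 : 0 < K / h by exact: divr_gt0.
have [I [Zf [Uf [SZ SU orth span]]]] := product_basis sP r k mu0.
have solM t x : t \in `[0, T] -> x \in `[0, 1] ->
    [/\ `|zeta t x| <= M, `|Dx zeta t x| <= M, `|u t x| <= M & `|Dx u t x| <= M].
  move=> tT xI; split; [apply: le_trans MM1|apply: le_trans MM2|apply: le_trans MM3|apply: le_trans MM4].
  - exact: B1.
  - exact: B2.
  - exact: B3.
  - exact: B4.
have gM x : x \in `[0, 1] -> `|eta_b beta b x| <= M /\ `|eta_b1 beta b x| <= M.
  by move=> xI; split; [apply: le_trans MM5; exact: B5|apply: le_trans MM6; exact: B6].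
have invS v i x : Sh r k s v -> (i < size s)%N -> x \in `]node s i, node s i.+1[ -> v x ^+ 2 <= K / h * ip v v.
  move=> Sv si xi; have [/(_ i x si xi) + _] := inv s q v sP qu (Sh_PP Sv) (Sh_PC1 Sv).
  move=> /le_trans; apply; rewrite ler_wpM2r ?(sip_ge0 (sip_ip sP) (Sh_PC sP Sv))//.
  by rewrite ler_pM2r ?invr_gt0.
have HC1 : C1 * H <= C * H by rewrite ler_wpM2r// lerDl.
have HC2 : C2 * H <= C * H by rewrite ler_wpM2r// lerDr.
have pZ t P : t \in `[0, T] -> is_L2_proj (Sh r k s) (zeta t) P ->
    ip (fun x => P x - zeta t x) (fun x => P x - zeta t x) <= C * H /\
    ip (fun x => derive1 P x - Dx zeta t x) (fun x => derive1 P x - Dx zeta t x) <= C * H.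
  by move=> tT pP; have [e1 e2] := E1 s k t P sP qu kr tT pP; split; apply: le_trans HC1.
have pU t P : t \in `[0, T] -> is_elliptic_proj mu (Sh0 r k s) (u t) P ->
    ip (fun x => P x - u t x) (fun x => P x - u t x) <= C * H /\
    ip (fun x => derive1 P x - Dx u t x) (fun x => derive1 P x - Dx u t x) <= C * H.
  by move=> tT pP; have [e1 e2] := E2 s k t P sP kr tT pP; split; apply: le_trans HC2.
have [zh [uh [Szu est]]] := galerkin_near T0 eps0 mu0 cz2 cu4 cb sol sP SZ SU orth span Mg2 k0 d0 d1 kd solM gM
  invS pZ pU sG.
exists zh, uh; split=> //.
  by move=> zh' uh' Szu'; exact: (galerkin_unique T0 mu0 cb sP SZ SU orth span Szu Szu').
move=> t tT; apply: le_trans (est t tT) _.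
have -> : C * H * (4 + 2 * ((1 + 3 / mu) * growth T eps mu M)) = C * X * (h ^+ (r - 1)) ^+ 2.
  by rewrite -exprM mulnC -/H -/G /X; ring.
have m0 : 0 <= 1 + 3 / mu by rewrite addr_ge0// divr_ge0// ltW.
have X0 : 0 <= X := addr_ge0 (ler0n R 4) (mulr_ge0 (ler0n R 2) (mulr_ge0 m0 G0)).
by rewrite sqrtrM ?mulr_ge0// sqrtr_sqr ger0_norm ?exprn_ge0 ?(ltW h0)// mulrA.
Qed.
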